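(* Let $\pi$ and $\pi'$ be smooth $\overline{\mathbf F}_p$-representations of $G=\mathrm{GL}_2(F)$, and suppose $\pi$ is irreducible and admits a central character. Then: (i) if $\pi$ is in the principal series, then $\pi|_P$ has length $2$ as a representation of $P$; otherwise $\pi|_P$ is an irreducible representation of $P$. (ii) Restriction of maps to $P$ induces an isomorphism $\mathrm{Hom}_P(\mathrm{Sp},\pi')\cong \mathrm{Hom}_G(\mathrm{Ind}_P^G\mathbf 1,\pi')$ (where a $G$-map $\mathrm{Ind}_P^G\mathbf 1\to\pi'$ is restricted to the $P$-stable complement of $\mathbf 1$ identified with $\mathrm{Sp}|_P$), and if $\pi$ is not in the special series then $\mathrm{Hom}_P(\pi,\pi')\cong\mathrm{Hom}_G(\pi,\pi')$.
   Context: $F$ is a non-Archimedean local field with ring of integers $\mathfrak o$, maximal ideal $\mathfrak p$, uniformizer $\varpi$, residue field $\mathbf F_q$ of characteristic $p$. $G=\mathrm{GL}_2(F)$, $P$ the subgroup of upper triangular matrices, $T$ the diagonal torus, $U$ the upper unipotent subgroup. All representations are on $\overline{\mathbf F}_p$-vector spaces and smooth (every vector has open stabilizer). For a smooth character $\chi:T\to\overline{\mathbf F}_p^\times$, viewed as a character of $P$ via $P\to P/U\cong T$, $\mathrm{Ind}_P^G\chi$ is the space of locally constant $f:G\to\overline{\mathbf F}_p$ with $f(bg)=\chi(b)f(g)$ for $b\in P$, with $G$ acting by right translation. $\chi^s$ denotes the character $\chi^s(\mathrm{diag}(a,d))=\chi(\mathrm{diag}(d,a))$. $\mathrm{Sp}$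 is defined by the exact sequence $0\to\mathbf 1\to\mathrm{Ind}_P^G\mathbf 1\to\mathrm{Sp}\to 0$. An irreducible smooth representation of $G$ with central character is: a character $\psi\circ\det$; in the principal series if it is $\mathrm{Ind}_P^G\chi$ with $\chi\neq\chi^s$; in the special series if it is $\mathrm{Sp}\otimes\psi\circ\det$ for a smooth character $\psi:F^\times\to\overline{\mathbf F}_p^\times$; supersingular if it is not isomorphic to a subquotient of $\mathrm{Ind}_P^G\chi$ for any smooth character $\chi$ of $T$. (Every irreducible smooth representation with central character is of exactly one of these four types.) *)

(* Defs.v *)
From HB Require Import structures.
From mathcomp Require Import all_boot all_order all_algebra.
Set Implicit Arguments. Unset Strict Implicit. Unset Printing Implicit Defensive.
Import Order.TTheory GRing.Theory Num.Theory.
Local Open Scope ring_scope.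

(* x lies in p^n (the n-th power of the maximal ideal); v 0 is junk *)
Definition inpn (F : fieldType) (v : F -> int) (n : nat) (x : F) : Prop :=
  x = 0 \/ (n%:Z <= v x).

Definition integral (F : fieldType) (v : F -> int) (x : F) : Prop :=
  x = 0 \/ (0 <= v x).

Record nonarch_local_field (p : nat) (F : fieldType) (v : F -> int) : Prop := {
  val_mul : forall x y, x != 0 -> y != 0 -> v (x * y) = v x + v y;
  val_add : forall x y, x != 0 -> y != 0 -> x + y != 0 ->
              Num.min (v x) (v y) <= v (x + y);
  val_surj : forall n : int, exists x, x != 0 /\ v x = n;
  residue_finite : exists s : seq F, (forall r, r \in s -> integral v r) /\
     forall x, integral v x -> exists2 r, r \in s & inpn v 1 (x - r);
  residue_char : inpn v 1 (p%:R : F);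
  complete : forall u : nat -> F,
     (forall n, exists N, forall m m', (N <= m)%N -> (N <= m')%N ->
         inpn v n (u m - u m')) ->
     exists l, forall n, exists N, forall m, (N <= m)%N -> inpn v n (u m - l)
}.

Definition is_Fpbar (p : nat) (k : closedFieldType) : Prop :=
  p \in [pchar k] /\ forall x : k, exists n, (0 < n)%N /\ x ^+ (p ^ n) = x.

Definition inG (F : fieldType) (g : 'M[F]_2) : Prop := \det g != 0.
Definition inP (F : fieldType) (g : 'M[F]_2) : Prop :=
  inG g /\ g ord_max ord0 = 0.

(* principal congruence subgroup K_n = 1 + M_2(p^n) (used with n >= 1); the K_n (resp.
   K_n /\ P) form a neighbourhood basis of 1 in G (resp. P) *)
Definition congr_sub (F : fieldType) (v : F -> int) (n : nat) (g : 'M[F]_2) :=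
  forall i j, inpn v n (g i j - (1%:M : 'M[F]_2) i j).

Definition smooth_char1 (F : fieldType) (v : F -> int) (k : fieldType)
  (psi : F -> k) : Prop :=
  [/\ forall a, a != 0 -> psi a != 0,
      forall a b, a != 0 -> b != 0 -> psi (a * b) = psi a * psi b &
      exists n, (0 < n)%N /\ forall a, inpn v n (a - 1) -> psi a = 1].

(* smooth character of T; chi a d is the value at diag(a,d) *)
Definition smooth_charT (F : fieldType) (v : F -> int) (k : fieldType)
  (chi : F -> F -> k) : Prop :=
  [/\ forall a d, a != 0 -> d != 0 -> chi a d != 0,
      forall a d a' d', a != 0 -> d != 0 -> a' != 0 -> d' != 0 ->
         chi (a * a') (d * d') = chi a d * chi a' d' &
      exists n, (0 < n)%N /\ forall a d, inpn v n (a - 1) -> inpn v n (d - 1) ->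
         chi a d = 1].

Definition chi_neq_s (F : fieldType) (k : fieldType) (chi : F -> F -> k) :=
  exists a d, [/\ a != 0, d != 0 & chi a d != chi d a].

(* rho is a smooth representation of the subgroup H (= inG or inP) of G on V;
   the values of rho outside H are irrelevant *)
Definition is_rep (F : fieldType) (v : F -> int) (k : fieldType)
  (H : 'M[F]_2 -> Prop) (V : lmodType k) (rho : 'M[F]_2 -> V -> V) : Prop :=
  [/\ forall g, H g -> forall (a : k) x y, rho g (a *: x + y) = a *: rho g x + rho g y,
      forall x, rho 1%:M x = x,
      forall g h, H g -> H h -> forall x, rho (g *m h) x = rho g (rho h x) &
      forall x, exists n, (0 < n)%N /\ forall g, congr_sub v n g -> H g -> rho g x = x].

Definition subspace (k : fieldType) (V : lmodType k) (S : V -> Prop) : Prop :=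
  [/\ S 0, forall x y, S x -> S y -> S (x + y) & forall (a : k) x, S x -> S (a *: x)].

Definition stable (F : fieldType) (k : fieldType) (H : 'M[F]_2 -> Prop)
  (V : lmodType k) (rho : 'M[F]_2 -> V -> V) (S : V -> Prop) : Prop :=
  forall g x, H g -> S x -> S (rho g x).

Definition irreducible (F : fieldType) (k : fieldType) (H : 'M[F]_2 -> Prop)
  (V : lmodType k) (rho : 'M[F]_2 -> V -> V) : Prop :=
  (exists x : V, x != 0) /\
  forall S, subspace S -> stable H rho S -> (forall x, S x -> x = 0) \/ (forall x, S x).

(* length exactly 2 as a representation of H: a composition series
   0 < S < V with S and V/S irreducible *)
Definition length2 (F : fieldType) (k : fieldType) (H : 'M[F]_2 -> Prop)
  (V : lmodType k) (rho : 'M[F]_2 -> V -> V) : Prop :=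
  exists S, [/\ subspace S, stable H rho S,
    (exists x, S x /\ x != 0) /\
      (forall S', subspace S' -> stable H rho S' -> (forall x, S' x -> S x) ->
         (forall x, S' x -> x = 0) \/ (forall x, S x -> S' x)) &
    (exists x, ~ S x) /\
      (forall S', subspace S' -> stable H rho S' -> (forall x, S x -> S' x) ->
         (forall x, S' x -> S x) \/ (forall x, S' x))].

Definition central_char (F : fieldType) (k : fieldType) (V : lmodType k)
  (rho : 'M[F]_2 -> V -> V) : Prop :=
  exists omega : F -> k, forall a, a != 0 -> forall x, rho a%:M x = omega a *: x.

Definition rt (F : fieldType) (k : Type) (g : 'M[F]_2) (f : 'M[F]_2 -> k) :
  'M[F]_2 -> k := fun h => f (h *m g).

(* f is an element of Ind_P^G chi: a locally constant function on G with
   f(bg) = chi(b) f(g); functions are on all of M_2(F), extended by 0 off G *)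
Definition inInd (F : fieldType) (v : F -> int) (k : fieldType)
  (chi : F -> F -> k) (f : 'M[F]_2 -> k) : Prop :=
  [/\ forall h, ~ inG h -> f h = 0,
      forall b h, inP b -> inG h -> f (b *m h) = chi (b ord0 ord0) (b ord_max ord_max) * f h &
      forall h, inG h -> exists n, (0 < n)%N /\ forall g, congr_sub v n g -> f (h *m g) = f h].

Definition chi1 (F : fieldType) (k : fieldType) : F -> F -> k := fun _ _ => 1.
Arguments chi1 : clear implicits.

Definition lc (F : fieldType) (k : fieldType) (a : k) (f1 f2 : 'M[F]_2 -> k) :
  'M[F]_2 -> k := fun h => a * f1 h + f2 h.

Definition linear_on (F : fieldType) (k : fieldType) (V : lmodType k)
  (D : ('M[F]_2 -> k) -> Prop) (Phi : ('M[F]_2 -> k) -> V) : Prop :=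
  forall a f1 f2, D f1 -> D f2 -> Phi (lc a f1 f2) = a *: Phi f1 + Phi f2.

Definition principal_series (F : fieldType) (v : F -> int) (k : fieldType)
  (V : lmodType k) (rho : 'M[F]_2 -> V -> V) : Prop :=
  exists chi : F -> F -> k, [/\ smooth_charT v chi, chi_neq_s chi &
    exists T : V -> ('M[F]_2 -> k),
      [/\ forall (a : k) x y, T (a *: x + y) = lc a (T x) (T y),
          forall x, inInd v chi (T x),
          injective T,
          forall f, inInd v chi f -> exists x, T x = f &
          forall g x, inG g -> T (rho g x) = rt g (T x)]].

(* pi is in the special series: pi ~= Sp (x) psi o det, where
   Sp = Ind_P^G 1 / 1; i.e. there is a surjective G-map
   (Ind_P^G 1) (x) (psi o det) -> pi whose kernel is the line of constants *)
Definition special_series (F : fieldType) (v : F -> int) (k : fieldType)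
  (V : lmodType k) (rho : 'M[F]_2 -> V -> V) : Prop :=
  exists psi : F -> k, smooth_char1 v psi /\
    exists T : ('M[F]_2 -> k) -> V,
      [/\ linear_on (inInd v (chi1 F k)) T,
          forall x, exists2 f, inInd v (chi1 F k) f & T f = x,
          forall f, inInd v (chi1 F k) f ->
             (T f = 0 <-> exists c, forall h, inG h -> f h = c) &
          forall g f, inG g -> inInd v (chi1 F k) f ->
             T (fun h => psi (\det g) * rt g f h) = rho g (T f)].

(* the P-stable complement of the constants in Ind_P^G 1, identified with
   Sp|_P : the functions vanishing at the identity *)
Definition inSpP (F : fieldType) (v : F -> int) (k : fieldType)
  (f : 'M[F]_2 -> k) : Prop :=
  inInd v (chi1 F k) f /\ f 1%:M = 0.

(* Main.v *)
Require Import Defs.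
From HB Require Import structures.
From mathcomp Require Import all_boot all_order all_algebra.
From mathcomp Require Import boolp functions.
From mathcomp Require Import ring zify.
Import Order.TTheory GRing.Theory Num.Theory.
Set Implicit Arguments. Unset Strict Implicit. Unset Printing Implicit Defensive.
Local Open Scope ring_scope.

(* Write t = diag(w, 1) for a uniformizer w, Pm = [0 1; w 0], s = [0 1; 1 0], and N for the Hecke
   operator on vectors fixed by the pro-p Iwahori subgroup I.

   A nonzero P-stable subspace contains a nonzero I-fixed vector on which the torus units and the
   center act by a character, because a p-group acting on a nonzero space in characteristic p fixes
   a nonzero vector and t contracts the upper unipotent group. A comparison with the compact
   induction shows that the images of that vector under powers of N span a finite-dimensional
   space, so the subspace also contains such a vector x with N x = c x.
   Moreover s N x = Pm x + D x with D in the group algebra of P, and G = P I u P Pm I.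

   If c = 0 then Pm x = - D x, so every P-stable subspace containing x is G-stable. If c is not 0,
   the same identity shows that a proper P-stable S containing x satisfies V = S + k Pm x, with P
   acting on V / S through a character chi; the quotient map induces an isomorphism of V with
   Ind chi, since the functions of Ind chi vanishing at 1 form an irreducible representation of P.

   If phi is a P-linear map on the functions of Ind 1 vanishing at 1, and f is the indicator function
   of P s U(o), then 1 = f + Pm f and phi f + Pm (phi f) turns out to be fixed by G; taking it as the
   image of 1 extends phi to Ind 1.

   Let T be a P-linear map from V to V'. If c is not 0, then T x = c^-m N^m T x is I-fixed, and
   delta = T (Pm x) - Pm (T x) spans a line on which P, hence by smoothness G, acts by a character
   psi o det; T (g y) - g (T y) is a multiple of delta which, divided by psi (det g), is as
   a function of g in Ind 1, and if delta is not 0 this identifies V with Sp (x) psi o det. If c = 0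
   one finds an eigenvector z with N z = 0 and N Pm z = a z; these two relations transfer to T z and
   T (Pm z) and force both to be I-fixed, whence T (Pm z) = - D (T z) = Pm (T z). In both cases T
   commutes with G on a generator. *)

(** * Polynomials in a linear operator *)

(** Admissibility is not assumed: the I-fixed vectors of an irreducible V are not known to be
    finite-dimensional, so an eigenvector of N cannot be taken for granted. Irreducibility only says
    that one vector is a group algebra multiple of another, and the difficulty is to convert such a
    relation, whose group algebra element is unknown, into a polynomial in N. Functions on G serve
    as test objects that control this element. In characteristic p there is no averaging over
    compact groups; fixed vectors of finite p-groups in suitable subspaces take its place. The
    residue representatives are not assumed closed under addition or multiplication, so sums over
    them are only ever transformed by permuting residue classes. For a P-linear T the point is that
    N and D lie in the group algebra of P and commute with T, while s and Pm need not. A second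
    difficulty is that T x is a priori fixed only by the part of I inside P; lower unipotent
    invariance starts at an unknown depth given by smoothness and is improved step by step by N and
    D. *)

Section LinearOperators.
Variable k : fieldType.

Definition lin (V W : lmodType k) (f : V -> W) : Prop :=
  forall a x y, f (a *: x + y) = a *: f x + f y.

Section LinTheory.
Variables (V W : lmodType k) (f : V -> W).
Hypothesis lf : lin f.

Lemma linD x y : f (x + y) = f x + f y.
Proof. by rewrite -[x]scale1r lf !scale1r. Qed.

Lemma lin0 : f 0 = 0.
Proof. by apply: (addrI (f 0)); rewrite -linD !addr0. Qed.

Lemma linZ a x : f (a *: x) = a *: f x.
Proof. by rewrite -[a *: x]addr0 lf lin0 addr0. Qed.

Lemma linN x : f (- x) = - f x.
Proof. by rewrite -scaleN1r linZ scaleN1r. Qed.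

Lemma linB x y : f (x - y) = f x - f y.
Proof. by rewrite linD linN. Qed.

Lemma lin_sum (I : Type) (r : seq I) (P : pred I) (F : I -> V) :
  f (\sum_(i <- r | P i) F i) = \sum_(i <- r | P i) f (F i).
Proof. exact: (big_morph f linD lin0). Qed.

End LinTheory.

Section Subspace.
Variables (V : lmodType k) (S : V -> Prop).
Hypothesis hS : subspace S.

Lemma sub0 : S 0. Proof. by case: hS. Qed.
Lemma subD x y : S x -> S y -> S (x + y). Proof. by case: hS => _ h _; apply: h. Qed.
Lemma subZ a x : S x -> S (a *: x). Proof. by case: hS => _ _; apply. Qed.
Lemma subN x : S x -> S (- x). Proof. by move=> h; rewrite -scaleN1r; apply: subZ. Qed.
Lemma subB x y : S x -> S y -> S (x - y).
Proof. by move=> hx hy; apply: subD => //; apply: subN. Qed.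
Lemma subsum (I : eqType) (r : seq I) (F : I -> V) :
  (forall i, i \in r -> S (F i)) -> S (\sum_(i <- r) F i).
Proof.
move=> h; rewrite big_seq; elim/big_rec: _ => [|i x hi hx]; first exact: sub0.
by apply: subD => //; apply: h.
Qed.
End Subspace.

Section PolynomialAction.
Variables (V : lmodType k) (f : V -> V).

Definition pact (P : {poly k}) (x : V) : V := \sum_(i < size P) P`_i *: iter i f x.

Lemma pactE n (P : {poly k}) x : (size P <= n)%N ->
  pact P x = \sum_(i < n) P`_i *: iter i f x.
Proof.
move=> le; rewrite /pact (big_ord_widen n (fun i => P`_i *: iter i f x) le).
rewrite big_mkcond; apply: eq_bigr => i _; case: ltnP => // h.
by rewrite nth_default // scale0r.
Qed.

Lemma pactD P Q x : pact (P + Q) x = pact P x + pact Q x.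
Proof.
set n := maxn (size P) (size Q).
rewrite !(@pactE n) ?leq_maxl ?leq_maxr ?size_polyD //.
by rewrite -big_split; apply: eq_bigr => i _; rewrite coefD scalerDl.
Qed.

Lemma pactZ a P x : pact (a *: P) x = a *: pact P x.
Proof.
rewrite !(@pactE (size P)) ?size_scale_leq // scaler_sumr.
by apply: eq_bigr => i _; rewrite coefZ scalerA.
Qed.

Lemma pactC a x : pact a%:P x = a *: x.
Proof. by rewrite (@pactE 1%N) ?size_polyC_leq1 // big_ord1 coefC. Qed.

Lemma pactXn n x : pact 'X^n x = iter n f x.
Proof.
rewrite /pact size_polyXn (bigD1 ord_max) //= coefXn eqxx scale1r big1 ?addr0 //.
by move=> i ne; rewrite coefXn -(inj_eq val_inj) /= in ne *; rewrite (negPf ne) scale0r.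
Qed.

Hypothesis lf : lin f.

Lemma lin_iter n : lin (iter n f).
Proof. by elim: n => //= n IH a x y /=; rewrite IH lf. Qed.

Lemma lin_pact P : lin (pact P).
Proof.
move=> a x y; rewrite /pact scaler_sumr -big_split; apply: eq_bigr => i _.
by rewrite (@lin_iter i) scalerDr !scalerA mulrC.
Qed.

Lemma pactMX P x : pact (P * 'X) x = f (pact P x).
Proof.
have [->|nz] := eqVneq P 0.
  by rewrite mul0r /pact size_poly0 big_ord0 lin0.
rewrite /pact size_mulX // big_ord_recl coefMX scale0r add0r lin_sum //.
by apply: eq_bigr => i _; rewrite linZ //= coefMX.
Qed.

Lemma pactXC P c x : pact (P * ('X - c%:P)) x = f (pact P x) - c *: pact P x.
Proof.
have -> : P * ('X - c%:P) = P * 'X + (- c) *: P by rewrite mulrBr [P * c%:P]mulrC mul_polyC scaleNr.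
by rewrite pactD pactMX pactZ scaleNr.
Qed.

Lemma pact_commute (g : V -> V) P x : lin g ->
  (forall i, g (iter i f x) = iter i f (g x)) -> g (pact P x) = pact P (g x).
Proof.
by move=> lg h; rewrite /pact lin_sum //; apply: eq_bigr => i _; rewrite linZ // h.
Qed.

Section Invariant.
Variable S : V -> Prop.
Hypotheses (hS : subspace S) (fS : forall x, S x -> S (f x)).

Lemma iter_sub n x : S x -> S (iter n f x).
Proof. by move=> hx; elim: n => //= n; apply: fS. Qed.

Lemma pact_sub P x : S x -> S (pact P x).
Proof. by move=> hx; apply: subsum => // i _; apply: subZ => //; apply: iter_sub. Qed.
End Invariant.

End PolynomialAction.
End LinearOperators.

(** * Eigenvectors and fixed vectors of commuting operators *)

Section Eigenvectors.
Variables (k : closedFieldType) (V : lmodType k).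

(* The eigenvector is itself a polynomial in [f] applied to [x], so it lies in every
   [f]-stable subspace containing [x]. *)
Lemma pact_eigen (f : V -> V) P x : lin f -> P != 0 -> pact f P x = 0 -> x != 0 ->
  exists Q c, pact f Q x != 0 /\ f (pact f Q x) = c *: pact f Q x.
Proof.
move=> lf; move: {2}(size P) (erefl (size P)) => n.
elim: n P => [|n IH] P sP nz Px xnz; first by rewrite -size_poly_eq0 sP in nz.
case: n IH sP => [|n] IH sP.
  have [c cnz Pc] : exists2 c, c != 0 & P = c%:P by apply/size_poly1P; rewrite sP.
  move: Px; rewrite Pc pactC => /eqP; rewrite scaler_eq0 (negPf cnz) => /= x0.
  by rewrite x0 in xnz.
have [c rc] : exists c, root P c by apply/closed_rootP; rewrite sP.
have [Q PQ] := factor_theorem _ _ rc; rewrite {}PQ in sP nz Px rc *.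
have Qnz : Q != 0 by apply: contraNneq nz => ->; rewrite mul0r.
rewrite pactXC // in Px.
have [Qx|Qx] := eqVneq (pact f Q x) 0.
  apply: (IH Q) => //; move: sP.
  by rewrite size_Mmonic ?monicXsubC // size_XsubC addn2 /= => -[].
by exists Q, c; split=> //; apply/eqP; rewrite -subr_eq0 Px.
Qed.

(** An operator of finite order M on [S] is killed by X^M - 1, so [pact_eigen] finds an eigenvector
    inside [S]. The remaining operators preserve this eigenspace because they commute on [S], which
    allows the induction on the list. *)
Lemma common_eigenvector (I : eqType) (fs : seq I) (f : I -> V -> V) (S : V -> Prop) :
  subspace S -> (exists2 x, S x & x != 0) ->
  (forall i, lin (f i)) -> (forall i x, S x -> S (f i x)) ->
  (forall i j x, S x -> f i (f j x) = f j (f i x)) ->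
  (forall i, exists2 M, (0 < M)%N & forall x, S x -> iter M (f i) x = x) ->
  exists2 y, S y & y != 0 /\ forall i, i \in fs -> exists c, f i y = c *: y.
Proof.
move=> hS hx lf fS fC fM; elim: fs S hS hx fS fC fM => [|i fs IH] S hS [x Sx xnz] fS fC fM.
  by exists x.
have [M M0 hM] := fM i.
have [||||Q [c [ynz yc]]] := @pact_eigen (f i) ('X^M - 1) x => //.
- by rewrite -size_poly_eq0 size_XnsubC.
- by rewrite -polyC1 -polyCN pactD pactXn pactC hM // scaleN1r subrr.
set y := pact _ _ _ in ynz yc.
have Sy : S y by apply: pact_sub => // z; apply: fS.
case: (IH (fun z => S z /\ f i z = c *: z)) => [|||||z [Sz zc] [znz ze]].
- split; first by split; [exact: sub0 | rewrite lin0 // scaler0].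
  + move=> u w [Su uc] [Sw wc]; split; first exact: subD.
    by rewrite linD // uc wc scalerDr.
  + move=> a u [Su uc]; split; first exact: subZ.
    by rewrite linZ // uc !scalerA mulrC.
- by exists y.
- by move=> j z [Sz zc]; split; [exact: fS | rewrite fC // zc linZ].
- by move=> j l z [Sz _]; apply: fC.
- by move=> j; have [M' M'0 h] := fM j; exists M' => // z [Sz _]; apply: h.
exists z => //; split=> // j; rewrite inE => /orP[/eqP->|]; last exact: ze.
by exists c.
Qed.

(* An eigenvalue of an operator of p-power order is 1 in characteristic p. *)
Lemma common_fixed_vector (p : nat) (I : eqType) (fs : seq I) (f : I -> V -> V)
    (S : V -> Prop) : p \in [pchar k] ->
  subspace S -> (exists2 x, S x & x != 0) ->
  (forall i, lin (f i)) -> (forall i x, S x -> S (f i x)) ->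
  (forall i j x, S x -> f i (f j x) = f j (f i x)) ->
  (forall i, exists e, forall x, S x -> iter (p ^ e) (f i) x = x) ->
  exists2 y, S y & y != 0 /\ forall i, i \in fs -> f i y = y.
Proof.
move=> pk hS hx lf fS fC fM.
case: (common_eigenvector fs hS hx lf fS fC) => [|y Sy [ynz ye]].
  move=> i; have [e he] := fM i; exists (p ^ e)%N => //.
  by rewrite expn_gt0 prime_gt0 // (pcharf_prime pk).
exists y => //; split=> // i ii; have [c yc] := ye i ii; have [e he] := fM i.
have := he y Sy.
have -> n : iter n (f i) y = c ^+ n *: y.
  by elim: n => [|n IH] /=; rewrite ?expr0 ?scale1r // IH linZ // yc scalerA -exprSr.
move/eqP; rewrite -[X in _ == X]scale1r -subr_eq0 -scalerBl scaler_eq0 (negPf ynz) orbF.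
have -> : c ^+ (p ^ e) - 1 = (c - 1) ^+ (p ^ e).
  have pe : [pchar k].-nat (p ^ e)%N by rewrite pnatX pnatE ?(pcharf_prime pk) // pk.
  by rewrite exprDn_pchar // exprNn_pchar // expr1n.
by rewrite expf_eq0 subr_eq0 => /andP[_ /eqP c1]; rewrite yc c1 scale1r.
Qed.
End Eigenvectors.

(** * The valuation and the residue field *)

Section Valuation.
Variables (p : nat) (F : fieldType) (v : F -> int).
Hypothesis hF : nonarch_local_field p v.

(** Fractional ideals: negative exponents appear as soon as elements are conjugated by powers of t.
    The boolean form, unlike [inpn], can be rewritten. *)
Definition inp (n : int) (x : F) : bool := (x == 0) || (n <= v x).

Lemma inpnP n x : reflect (inpn v n x) (inp n%:Z x).
Proof. by apply: (iffP orP) => -[]; [move/eqP; left | right | move->; left | right]. Qed.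

Lemma integralP x : reflect (integral v x) (inp 0 x).
Proof. by apply: (iffP orP) => -[]; [move/eqP; left | right | move->; left | right]. Qed.

Lemma vM x y : x != 0 -> y != 0 -> v (x * y) = v x + v y.
Proof. exact: (val_mul hF). Qed.

Lemma v1 : v 1 = 0.
Proof.
have := @vM 1 1 (oner_neq0 _) (oner_neq0 _); rewrite mulr1 => h.
by apply: (addrI (v 1)); rewrite addr0 -h.
Qed.

Lemma vN1 : v (- 1) = 0.
Proof.
have nz : (-1 : F) != 0 by rewrite oppr_eq0 oner_neq0.
have := @vM (-1) (-1) nz nz; rewrite mulrNN mulr1 v1; lia.
Qed.

Lemma vN x : v (- x) = v x.
Proof.
have [->|nz] := eqVneq x 0; first by rewrite oppr0.
by rewrite -mulN1r vM ?oppr_eq0 ?oner_neq0 // vN1 add0r.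
Qed.

Lemma vV x : x != 0 -> v x^-1 = - v x.
Proof.
move=> nz; apply: (addrI (v x)); rewrite subrr -vM ?invr_eq0 // mulfV //; exact: v1.
Qed.

Lemma vf x y : x != 0 -> y != 0 -> v (x / y) = v x - v y.
Proof. by move=> x0 y0; rewrite vM ?invr_eq0 // vV. Qed.

Lemma inp0 n : inp n 0. Proof. by rewrite /inp eqxx. Qed.

Lemma inpE n x : x != 0 -> inp n x = (n <= v x).
Proof. by rewrite /inp => /negPf->. Qed.

Lemma inpN n x : inp n (- x) = inp n x.
Proof. by rewrite /inp oppr_eq0 vN. Qed.

Lemma inpD n x y : inp n x -> inp n y -> inp n (x + y).
Proof.
have [->|x0] := eqVneq x 0; first by rewrite add0r.
have [->|y0] := eqVneq y 0; first by rewrite addr0.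
have [->|s0] := eqVneq (x + y) 0; first by rewrite inp0.
rewrite !inpE // => hx hy; apply: le_trans (val_add hF x0 y0 s0).
by rewrite le_min hx.
Qed.

Lemma inpB n x y : inp n x -> inp n y -> inp n (x - y).
Proof. by move=> hx hy; rewrite inpD ?inpN. Qed.

Lemma inpBC n x y : inp n (x - y) = inp n (y - x).
Proof. by rewrite -inpN opprB. Qed.

Lemma inp_trans n y x z : inp n (x - y) -> inp n (y - z) -> inp n (x - z).
Proof. by move=> h1 h2; have := inpD h1 h2; rewrite addrA subrK. Qed.

Lemma inpDl n x y : inp n y -> inp n (x + y) = inp n x.
Proof.
move=> hy; apply/idP/idP => h; last exact: inpD.
by rewrite -[x](addrK y) inpB.
Qed.

Lemma inpM m n x y : inp m x -> inp n y -> inp (m + n) (x * y).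
Proof.
have [->|x0] := eqVneq x 0; first by rewrite mul0r !inp0.
have [->|y0] := eqVneq y 0; first by rewrite mulr0 !inp0.
by rewrite !inpE ?mulf_neq0 // vM // => *; apply: lerD.
Qed.

Lemma inp_le m n x : m <= n -> inp n x -> inp m x.
Proof. by move=> le /orP[h|h]; rewrite /inp ?h // (le_trans le h) orbT. Qed.

Lemma inpMl n x y : inp 0 x -> inp n y -> inp n (x * y).
Proof. by move=> hx hy; rewrite -[n]add0r inpM. Qed.

Lemma inpMr n x y : inp n x -> inp 0 y -> inp n (x * y).
Proof. by move=> hx hy; rewrite -[n]addr0 inpM. Qed.

Lemma inp01 : inp 0 1. Proof. by rewrite inpE ?oner_neq0 // v1. Qed.

Lemma inp1_0 x : inp 1 x -> inp 0 x. Proof. exact: inp_le. Qed.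

Lemma inp_nat n : inp 0 n%:R.
Proof. by elim: n => [|n IH]; rewrite ?inp0 // -addn1 natrD inpD // inp01. Qed.

Lemma inp_sum n (I : eqType) (r : seq I) (G : I -> F) :
  (forall i, i \in r -> inp n (G i)) -> inp n (\sum_(i <- r) G i).
Proof.
move=> h; rewrite big_seq; elim/big_rec: _ => [|i x hi hx]; first exact: inp0.
by rewrite inpD // h.
Qed.

Definition vunit (x : F) : bool := (x != 0) && (v x == 0).

Lemma vunit_neq0 x : vunit x -> x != 0. Proof. by case/andP. Qed.
Lemma vunit_inp x : vunit x -> inp 0 x.
Proof. by case/andP=> x0 /eqP vx; rewrite inpE // vx. Qed.
Lemma vunitM x y : vunit x -> vunit y -> vunit (x * y).
Proof.
case/andP=> x0 /eqP vx /andP[y0 /eqP vy].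
by rewrite /vunit mulf_neq0 //= vM // vx vy.
Qed.
Lemma vunitV x : vunit x -> vunit x^-1.
Proof. by case/andP=> x0 /eqP vx; rewrite /vunit invr_eq0 x0 vV // vx oppr0 eqxx. Qed.
Lemma vunitN x : vunit (- x) = vunit x.
Proof. by rewrite /vunit oppr_eq0 vN. Qed.
Lemma vunit1 : vunit 1. Proof. by rewrite /vunit oner_neq0 v1 eqxx. Qed.
Lemma vunitX x n : vunit x -> vunit (x ^+ n).
Proof. by move=> h; elim: n => [|n IH]; rewrite ?vunit1 // exprS vunitM. Qed.

Lemma vunitE x : vunit x = inp 0 x && ~~ inp 1 x.
Proof.
have [->|x0] := eqVneq x 0; first by rewrite /vunit eqxx !inp0.
by rewrite !inpE // /vunit x0 /=; lia.
Qed.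

Lemma vunitD x y : vunit x -> inp 1 y -> vunit (x + y).
Proof.
rewrite !vunitE => /andP[h0 h1] hy; rewrite inpD ?(inp1_0 hy) //=.
by rewrite inpDl.
Qed.

Lemma vunit_congr x y : inp 1 (x - y) -> vunit y -> vunit x.
Proof. by move=> h /vunitD/(_ h); rewrite subrKC. Qed.

Lemma one_vunit x : inp 1 (x - 1) -> vunit x.
Proof. by move=> h; apply: (vunit_congr h); apply: vunit1. Qed.

Lemma inpMu n x y : vunit x -> inp n (x * y) = inp n y.
Proof.
move=> ux; apply/idP/idP => h; last exact: inpMl (vunit_inp ux) h.
by rewrite -(mulKf (vunit_neq0 ux) y) inpMl // vunit_inp // vunitV.
Qed.

Lemma inpMur n x y : vunit y -> inp n (x * y) = inp n x.
Proof. by move=> uy; rewrite mulrC inpMu. Qed.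

Lemma inp1_inv z : z != 0 -> inp 1 z -> inp 0 z^-1 = false.
Proof. by move=> z0; rewrite !inpE ?invr_eq0 // vV //; lia. Qed.

Lemma inp_invN z : z != 0 -> ~~ inp 0 z -> inp 1 z^-1.
Proof. by move=> z0; rewrite !inpE ?invr_eq0 // vV //; lia. Qed.

Lemma one_mul n x y : 1 <= n -> inp n (x - 1) -> inp n (y - 1) -> inp n (x * y - 1).
Proof.
move=> n1 hx hy; have -> : x * y - 1 = x * (y - 1) + (x - 1) by ring.
rewrite inpD // inpMu // one_vunit //; exact: inp_le hx.
Qed.

Lemma one_inv n x : 1 <= n -> inp n (x - 1) -> inp n (x^-1 - 1).
Proof.
move=> n1 hx; have ux : vunit x by rewrite one_vunit //; apply: inp_le hx.
have -> : x^-1 - 1 = - (x^-1 * (x - 1)).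
  by rewrite mulrBr mulVf ?vunit_neq0 // mulr1 opprB.
by rewrite inpN inpMu ?vunitV.
Qed.

Lemma uniformizer_ex : exists2 w, w != 0 & v w = 1.
Proof. by have [w [h1 h2]] := val_surj hF 1; exists w. Qed.

Lemma pchar_inp : inp 1 p%:R.
Proof. by apply/inpnP; apply: (residue_char hF). Qed.

Lemma inp_pX n : inp n%:Z (p%:R ^+ n).
Proof.
elim: n => [|n IH]; first by rewrite expr0 inp01.
by rewrite exprS -addn1 addnC PoszD inpM // pchar_inp.
Qed.

(** The factor 1 + x + ... + x^(p-1) of x^p - 1 is congruent to p, hence lies in the maximal ideal.
    This makes the principal units a pro-p group. *)
Lemma one_expp n x : 1 <= n -> inp n (x - 1) -> inp (n + 1) (x ^+ p - 1).
Proof.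
move=> n1 hx; rewrite -[X in _ - X](expr1n F p) subrXX inpM //.
have -> : \sum_(i < p) x ^+ (p.-1 - i) * 1 ^+ i =
  p%:R + \sum_(i < p) (x ^+ (p.-1 - i) - 1).
  by rewrite big_split /= sumrN sumr_const card_ord subrKC; apply: eq_bigr => i _; rewrite expr1n mulr1.
rewrite inpD ?pchar_inp // inp_sum // => i _.
elim: (p.-1 - i)%N => [|m IH]; first by rewrite subrr inp0.
by rewrite exprS one_mul //; apply: inp_le hx.
Qed.

Lemma one_exppX e x : inp 1 (x - 1) -> inp e.+1%:Z (x ^+ (p ^ e) - 1).
Proof.
move=> hx; elim: e => [|e IH]; first by rewrite expn0 expr1.
rewrite expnSr exprM -[e.+2]addn1 PoszD; apply: one_expp => //; lia.
Qed.

(** The class of 0 is kept out of [R] because it plays a separate role in the Hecke operator: it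
    yields the term [Pm] in [s_Nop], while the units in [R] yield [Dop]. *)
Definition residues (R : seq F) : Prop :=
  [/\ forall r, r \in R -> vunit r, uniq (0 :: R),
      forall r r' : F, r \in 0 :: R -> r' \in 0 :: R -> inp 1 (r - r') -> r = r' &
      forall x : F, inp 0 x -> exists2 r : F, r \in 0 :: R & inp 1 (x - r)].

Lemma residues_ex : exists R, residues R.
Proof.
have [s [si sc]] := residue_finite hF.
suff [R [h1 h2 h3 h4]] : exists R, [/\ forall r, r \in R -> vunit r, uniq (0 :: R),
      forall r r', r \in 0 :: R -> r' \in 0 :: R -> inp 1 (r - r') -> r = r' &
      forall x, x \in s -> exists2 r, r \in 0 :: R & inp 1 (x - r)].
  exists R; split=> // x /integralP /sc [r /h4[r' rR h]] /inpnP h'.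
  by exists r' => //; apply: inp_trans h' h.
have {si sc} : forall r, r \in s -> inp 0 r by move=> r /si /integralP.
elim: s => [|x s IH] si.
  exists [::]; split=> // r r'; rewrite !inE => /eqP-> /eqP->; by [].
have [|R [h1 h2 h3 h4]] := IH; first by move=> r rs; apply: si; rewrite inE rs orbT.
have [/hasP[r rR hr]|/hasPn nh] := boolP (has (fun r => inp 1 (x - r)) (0 :: R)).
  by exists R; split=> // y; rewrite inE => /orP[/eqP->|/h4//]; exists r.
exists (x :: R).
have n0 : ~~ inp 1 x by have := nh 0 (mem_head _ _); rewrite subr0.
have ux : vunit x by rewrite vunitE n0 si ?mem_head.
have sw r : (r \in [:: 0, x & R]) = (r == x) || (r \in 0 :: R) by rewrite !inE orbCA.
have xR : x \notin 0 :: R.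
  by apply/negP => /nh; rewrite subrr inp0.
split.
- by move=> r; rewrite inE => /orP[/eqP->|/h1].
- move: h2 xR; rewrite /= !inE !negb_or => /andP[-> ->] /andP[xn0 ->].
  by rewrite eq_sym xn0.
- move=> r r'; rewrite !sw => /orP[/eqP->|rR] /orP[/eqP->|r'R] //.
  + by move=> h; have := nh _ r'R; rewrite h.
  + by rewrite inpBC => h; have := nh _ rR; rewrite h.
  + exact: h3.
- move=> y; rewrite inE => /orP[/eqP->|/h4[r rR h]].
    by exists x; rewrite ?subrr ?inp0 // sw eqxx.
  by exists r => //; rewrite sw rR orbT.
Qed.

Section Residues.
Variable R : seq F.
Hypothesis hR : residues R.

Lemma res_inp r : r \in 0 :: R -> inp 0 r.
Proof.
case: hR => h1 _ _ _; rewrite inE => /orP[/eqP->|/h1 /vunit_inp//]; exact: inp0.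
Qed.

(** A map that is injective modulo the maximal ideal permutes the finitely many residue classes, and
    [G] depends only on the class. *)
Lemma residue_reindex (W : nmodType) (G : F -> W) (phi : F -> F) :
  (forall x y, inp 0 x -> inp 0 y -> inp 1 (x - y) -> G x = G y) ->
  (forall x, inp 0 x -> inp 0 (phi x)) ->
  (forall x y, inp 0 x -> inp 0 y -> inp 1 (phi x - phi y) -> inp 1 (x - y)) ->
  \sum_(r <- 0 :: R) G (phi r) = \sum_(r <- 0 :: R) G r.
Proof.
move=> Gp phio phii; case: (hR) => _ uR iR cR.
have [|red redP] := @choice F F (fun x r => inp 0 x -> r \in 0 :: R /\ inp 1 (x - r)).
  move=> x; case: (boolP (inp 0 x)) => [/cR[r rR h]|nx]; first by exists r.
  by exists 0.
have -> : \sum_(r <- 0 :: R) G (phi r) = \sum_(r <- [seq red (phi r) | r <- 0 :: R]) G r.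
  rewrite big_map !big_seq; apply: eq_bigr => r rR.
  have po := phio _ (res_inp rR); have [rR' hr'] := redP _ po.
  by apply: Gp => //; apply: res_inp.
apply: perm_big.
set m := map _ _; have um : uniq m.
  rewrite map_inj_in_uniq // => x y xR yR e.
  have [_ h1] := redP _ (phio _ (res_inp xR)).
  have [_ h2] := redP _ (phio _ (res_inp yR)).
  apply: iR => //; apply: phii; rewrite ?res_inp //.
  by apply: inp_trans h1 _; rewrite e inpBC.
apply: uniq_perm => //; apply: (uniq_min_size um _ _).2 => //; last by rewrite size_map.
by move=> x /mapP[r rR ->]; have [] := redP _ (phio _ (res_inp rR)).
Qed.

(* q + sum R and sum R agree modulo p, by translation. *)
Lemma residue_card_inp : inp 1 (size (0 :: R))%:R.
Proof.
case: (hR) => _ uR iR cR.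
have [|red redP] := @choice F F (fun x r => inp 0 x -> r \in 0 :: R /\ inp 1 (x - r)).
  move=> x; case: (boolP (inp 0 x)) => [/cR[r rR h]|nx]; first by exists r.
  by exists 0.
have redE x y : inp 0 x -> inp 0 y -> inp 1 (x - y) -> red x = red y.
  move=> hx hy hxy; have [r1 r2] := redP x hx; have [s1 s2] := redP y hy.
  apply: iR => //; rewrite inpBC in r2; apply: inp_trans r2 _; exact: inp_trans hxy s2.
have redR r : r \in 0 :: R -> red r = r.
  move=> rR; have [r1 r2] := redP r (res_inp rR).
  by apply/esym; apply: iR.
have := @residue_reindex F red (+%R^~ 1) redE.
move=> /(_ (fun x hx => inpD hx inp01)) e.
have {e} : \sum_(r <- 0 :: R) red (r + 1) = \sum_(r <- 0 :: R) r.
  rewrite e; last by move=> x y _ _; rewrite opprD addrACA subrr addr0.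
  by rewrite !big_seq; apply: eq_bigr => r /redR.
move=> e; have -> : (size (0 :: R))%:R = \sum_(r <- 0 :: R) (r + 1 - red (r + 1)).
  rewrite sumrB big_split /= e [in RHS]addrAC subrr add0r.
  by rewrite big_const_seq count_predT iter_addr_0.
apply: inp_sum => r rR; have [] // := redP (r + 1) _; exact: inpD (res_inp rR) inp01.
Qed.

(** Both p and the number of classes lie in the maximal ideal; were they coprime, a Bezout relation
    would put 1 there. *)
Lemma residue_card_pchar : prime p -> (p %| (size R).+1)%N.
Proof.
move=> pp; apply/negPn; rewrite -prime_coprime //; apply/negP => co.
have [u w e _] := egcdnP (size R).+1 (prime_gt0 pp).
rewrite (eqP co) in e.
have : inp 1 (1 : F); last by rewrite inpE ?oner_neq0 // v1.
have -> : (1 : F) = (u * p)%:R - (w * (size R).+1)%:R.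
  by rewrite e natrD addrAC subrr add0r.
rewrite !natrM inpB // inpMl ?inp_nat //; first exact: pchar_inp.
exact: residue_card_inp.
Qed.

(** Pigeonhole on the residue classes of the powers of x. *)
Lemma vunit_torsion x : vunit x -> exists2 M, (0 < M)%N & inp 1 (x ^+ M - 1).
Proof.
move=> ux; case: (hR) => _ uR iR cR.
have [red redP] : exists red : nat -> F, forall n, red n \in 0 :: R /\ inp 1 (x ^+ n - red n).
  have [|red h] := @choice nat F (fun n r => r \in 0 :: R /\ inp 1 (x ^+ n - r)).
    by move=> n; have [r h1 h2] := cR _ (vunit_inp (vunitX n ux)); exists r.
  by exists red.
have : ~~ uniq [seq red n | n <- iota 0 (size R).+2].
  apply/negP => um; have : (size [seq red n | n <- iota 0 (size R).+2] <= size (0%R :: R))%N.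
    by apply: uniq_leq_size um _ => r /mapP[n _ ->]; case: (redP n).
  by rewrite size_map size_iota /= ltnn.
case/(uniqPn 0) => i [j []]; rewrite size_map size_iota => ij jn.
rewrite !(nth_map 0%N) ?size_iota ?(ltn_trans ij) // !nth_iota ?(ltn_trans ij) // !add0n => e.
exists (j - i)%N; first by rewrite subn_gt0.
have [_ h1] := redP i; have [_ h2] := redP j.
rewrite -(inpMu _ _ (vunitX i ux)) mulrBr mulr1 -exprD subnKC ?(ltnW ij) //.
by apply: inp_trans h2 _; rewrite -e inpBC.
Qed.

Section Uniformizer.
Variable w : F.
Hypotheses (w0 : w != 0) (vw : v w = 1).

Lemma vw_exp n : v (w ^+ n) = n%:Z.
Proof. by elim: n => [|n IH]; rewrite ?v1 // exprS vM ?expf_neq0 // vw IH -add1n PoszD. Qed.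

Lemma vw_expz (n : int) : v (w ^ n) = n.
Proof.
by case: n => n; rewrite ?NegzE -?exprnN ?vV ?expf_neq0 // -?exprnP vw_exp.
Qed.

Lemma inpw (n m : int) x : inp n (x * w ^ m) = inp (n - m) x.
Proof.
have [->|x0] := eqVneq x 0; first by rewrite mul0r !inp0.
by rewrite !inpE ?mulf_neq0 ?expfz_neq0 // vM ?expfz_neq0 // vw_expz lerBlDr.
Qed.

Lemma inpwX n m x : inp n (x * w ^+ m) = inp (n - m%:Z) x.
Proof. exact: (inpw n m%:Z x). Qed.

Lemma reps_ex n : exists l : seq F, (forall r, r \in l -> inp 0 r) /\
  forall x, inp 0 x -> exists2 r, r \in l & inp n%:Z (x - r).
Proof.
elim: n => [|n [l [l1 l2]]].
  exists [:: 0]; split=> [r|x hx]; first by rewrite inE => /eqP->; apply: inp0.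
  by exists 0; rewrite ?mem_head // subr0.
case: (hR) => _ _ _ cR.
exists [seq r + s * w ^+ n | r <- l, s <- 0 :: R]; split.
  move=> r /allpairsP[[a b] [/= al bR ->]].
  apply: inpD; first exact: l1.
  by rewrite inpwX; apply: inp_le (res_inp bR); lia.
move=> x /l2[r rl hr].
have [|s sR hs] := cR ((x - r) * w ^ (- n%:Z)); first by rewrite inpw sub0r opprK.
exists (r + s * w ^+ n); first by apply/allpairsP; exists (r, s).
have -> : x - (r + s * w ^+ n) = ((x - r) * w ^ (- n%:Z) - s) * w ^+ n.
  by rewrite mulrBl -mulrA -exprnN mulVf ?expf_neq0 // mulr1 opprD addrA.
by rewrite inpwX; apply: inp_le hs; lia.
Qed.

(** Compactness of the ring of integers as an induction principle, with [Pd x n] read as a property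
    of the disc x + p^n. A failure on the whole ring propagates to a nested sequence of smaller
    discs, whose centers converge by completeness to a point contradicting the local hypothesis. *)
Lemma disc_induction (Pd : F -> nat -> Prop) :
  (forall x, inp 0 x -> exists n, forall y, inp 0 y -> inp n%:Z (y - x) -> Pd y n) ->
  (forall x n, inp 0 x -> (forall r : F, r \in 0 :: R -> Pd (x + r * w ^+ n) n.+1) -> Pd x n) ->
  Pd 0 0%N.
Proof.
move=> hloc hstep; apply: contrapT => nP.
have [|nxt nxtP] := @choice (F * nat) F (fun z y => inp 0 z.1 /\ ~ Pd z.1 z.2 ->
    [/\ inp 0 y, ~ Pd y z.2.+1 & inp z.2%:Z (y - z.1)]).
  move=> [x n] /=; have [[hx nPx]|h] := EM (inp 0 x /\ ~ Pd x n); last by exists 0.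
  have [r] : exists r, r \in 0 :: R /\ ~ Pd (x + r * w ^+ n) n.+1.
    apply: contrapT => h; apply: nPx; apply: hstep => // r rR.
    by apply: contrapT => h'; apply: h; exists r.
  case=> rR h; exists (x + r * w ^+ n) => _; split=> //.
    by rewrite inpD // inpwX; apply: inp_le (res_inp rR); lia.
  by rewrite [_ - x]addrC addKr inpwX; apply: inp_le (res_inp rR); lia.
pose u := fix u n := if n is m.+1 then nxt (u m, m) else 0.
have uP n : inp 0 (u n) /\ ~ Pd (u n) n.
  elim: n => [|n IH]; first by split; rewrite ?inp0.
  by case: (nxtP (u n, n) IH).
have uD n m : (n <= m)%N -> inp n%:Z (u m - u n).
  move=> nm; rewrite -(subnK nm); elim: (m - n)%N => [|d IH]; first by rewrite subrr inp0.
  apply: inp_trans IH; have [_ _] := nxtP (u (d + n)%N, (d + n)%N) (uP _).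
  by apply: inp_le; rewrite /= lez_nat leq_addl.
have [n|l hl] := complete hF (u := u).
  exists n => m m' hm hm'; apply/inpnP; rewrite (inp_trans (uD _ _ hm)) //.
  by rewrite inpBC uD.
have hl' n : inp n%:Z (u n - l).
  have [N hN] := hl n; have /inpnP h := hN (maxn N n) (leq_maxl _ _).
  by apply: inp_trans h; rewrite inpBC uD ?leq_maxr.
have lo : inp 0 l by have := inpB (proj1 (uP 0%N)) (hl' 0%N); rewrite subKr.
have [n hn] := hloc l lo; have [uo nPu] := uP n.
by apply: nPu; apply: hn.
Qed.
End Uniformizer.
End Residues.
End Valuation.

(** * Matrices and representations *)

Section Matrices.
Variable F : fieldType.
Implicit Types (a b c d x y : F) (g h : 'M[F]_2).

Definition mk a b c d : 'M[F]_2 := \matrix_(i, j)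
  if i == ord0 then (if j == ord0 then a else b) else (if j == ord0 then c else d).

Lemma mkE a b c d : (mk a b c d ord0 ord0 = a) * (mk a b c d ord0 ord_max = b) *
  (mk a b c d ord_max ord0 = c) * (mk a b c d ord_max ord_max = d).
Proof. by rewrite !mxE. Qed.

Lemma ord2P (i : 'I_2) : i = ord0 \/ i = ord_max.
Proof. by case: i => [[|[|]]] // h; [left | right]; apply/val_inj. Qed.

Lemma mkP g h : g ord0 ord0 = h ord0 ord0 -> g ord0 ord_max = h ord0 ord_max ->
  g ord_max ord0 = h ord_max ord0 -> g ord_max ord_max = h ord_max ord_max -> g = h.
Proof.
by move=> ????; apply/matrixP => i j; case: (ord2P i) => ->; case: (ord2P j) => ->.
Qed.

Lemma mk_eta g :
  g = mk (g ord0 ord0) (g ord0 ord_max) (g ord_max ord0) (g ord_max ord_max).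
Proof. by apply: mkP; rewrite mkE. Qed.

Lemma mx_ind2 (Q : 'M[F]_2 -> Prop) : (forall a b c d, Q (mk a b c d)) -> forall g, Q g.
Proof. by move=> h g; rewrite (mk_eta g). Qed.

Lemma mk_mul a b c d a' b' c' d' : mk a b c d *m mk a' b' c' d' =
  mk (a * a' + b * c') (a * b' + b * d') (c * a' + d * c') (c * b' + d * d').
Proof.
by apply: mkP; rewrite mkE mxE (big_ord_recl 1) big_ord1 (_ : lift _ _ = ord_max) ?mkE //;
   apply/val_inj.
Qed.

Lemma mk1 : 1%:M = mk 1 0 0 1.
Proof. by apply: mkP; rewrite mkE mxE. Qed.

Lemma mk_scalar a : a%:M = mk a 0 0 a.
Proof. by apply: mkP; rewrite mkE mxE. Qed.

Lemma det_mk a b c d : \det (mk a b c d) = a * d - b * c.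
Proof.
rewrite (expand_det_row _ ord0) (big_ord_recl 1) big_ord1.
rewrite /cofactor !det_mx11 !mxE /= !expr0 !mul1r expr1 mulN1r mulrN.
by [].
Qed.

Lemma inG_mk a b c d : inG (mk a b c d) = (a * d - b * c != 0).
Proof. by rewrite /inG det_mk. Qed.

Lemma inGM g h : inG g -> inG h -> inG (g *m h).
Proof. by rewrite /inG det_mulmx; apply: mulf_neq0. Qed.

Lemma inG1 : inG (1%:M : 'M[F]_2).
Proof. by rewrite /inG det1 oner_neq0. Qed.

Lemma inP_inG g : inP g -> inG g. Proof. by case. Qed.

Lemma inP_mk a b d : a != 0 -> d != 0 -> inP (mk a b 0 d).
Proof. by move=> a0 d0; split; rewrite ?mkE // inG_mk mulr0 subr0 mulf_neq0. Qed.

Lemma inP_diag g : inP g -> g ord0 ord0 != 0 /\ g ord_max ord_max != 0.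
Proof.
move: g; apply: mx_ind2 => a b c d [h]; rewrite !mkE => c0.
move: h; rewrite inG_mk c0 mulr0 subr0 mulf_eq0 negb_or => /andP[]; by [].
Qed.

Lemma inG_invmx g : inG g -> [/\ inG (invmx g), invmx g *m g = 1%:M & g *m invmx g = 1%:M].
Proof.
move=> hg; have u : g \in unitmx by rewrite unitmxE unitfE.
by rewrite /inG det_inv invr_eq0 mulmxV // mulVmx.
Qed.

Definition Um x := mk 1 x 0 1.
Definition Lm x := mk 1 0 x 1.
Definition Dm a d := mk a 0 0 d.

Lemma inGU x : inG (Um x). Proof. by rewrite inG_mk mulr1 mulr0 subr0 oner_neq0. Qed.
Lemma inGL x : inG (Lm x). Proof. by rewrite inG_mk mulr1 mul0r subr0 oner_neq0. Qed.
Lemma inPU x : inP (Um x). Proof. by apply: inP_mk; rewrite oner_neq0. Qed.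
Lemma inPD a d : a != 0 -> d != 0 -> inP (Dm a d). Proof. exact: inP_mk. Qed.
Lemma inGD a d : a != 0 -> d != 0 -> inG (Dm a d).
Proof. by move=> a0 d0; apply: inP_inG; apply: inPD. Qed.

Lemma UmD x y : Um x *m Um y = Um (x + y).
Proof. by rewrite mk_mul; congr mk; ring. Qed.
Lemma DmM a d a' d' : Dm a d *m Dm a' d' = Dm (a * a') (d * d').
Proof. by rewrite mk_mul; congr mk; ring. Qed.
Lemma DmU a d x : d != 0 -> Dm a d *m Um x = Um (a / d * x) *m Dm a d.
Proof. by move=> d0; rewrite !mk_mul; congr mk; field. Qed.
Lemma Um0 : Um 0 = 1%:M. Proof. by rewrite mk1. Qed.
Lemma Dm1 : Dm 1 1 = 1%:M. Proof. by rewrite mk1. Qed.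

Lemma inP_UD g : inP g -> g = Um (g ord0 ord_max / g ord_max ord_max) *m
  Dm (g ord0 ord0) (g ord_max ord_max).
Proof.
move=> hg; have [a0 d0] := inP_diag hg; case: hg => _ c0.
by rewrite {1}(mk_eta g) c0 mk_mul; congr mk; field.
Qed.
End Matrices.
#[global] Hint Resolve inGU inGL inPU inG1 : core.

(** * Spans of orbits and vectors fixed by subgroups *)

Section Representations.
Variables (F k : fieldType).

(* [is_rep] without the smoothness axiom, so as to apply to all functions on G *)
Definition grep (V : lmodType k) (rho : 'M[F]_2 -> V -> V) : Prop :=
  [/\ forall g, inG g -> lin (rho g), forall x, rho 1%:M x = x &
      forall g h, inG g -> inG h -> forall x, rho (g *m h) x = rho g (rho h x)].

Lemma grep_rt : @grep ('M[F]_2 -> k^o) (@rt F k^o).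
Proof.
split=> // [x|g h _ _ x]; apply: funext => m; rewrite /rt ?mulmx1 ?mulmxA //.
Qed.

Definition prod_act (V W : lmodType k) (rho : 'M[F]_2 -> V -> V) (sig : 'M[F]_2 -> W -> W)
  (g : 'M[F]_2) (z : V * W) : V * W := (rho g z.1, sig g z.2).

Lemma grep_prod (V W : lmodType k) (rho : 'M[F]_2 -> V -> V) (sig : 'M[F]_2 -> W -> W) :
  grep rho -> grep sig -> grep (prod_act rho sig).
Proof.
move=> [h1 h2 h3] [h4 h5 h6]; split=> [g hg a [x x'] [y y']|[x x']|g h hg hh [x x']];
  rewrite /prod_act /=.
- by rewrite h1 // h4.
- by rewrite h2 h5.
- by rewrite h3 // h6.
Qed.

(** A derivation records an element of the group algebra of [H], so membership in a span inside a
    direct sum says that one and the same element acts on all components. *)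
Inductive span (H : 'M[F]_2 -> Prop) (V : lmodType k) (rho : 'M[F]_2 -> V -> V) (x : V) :
  V -> Prop :=
| span0 : span H rho x 0
| spanS a g y : H g -> span H rho x y -> span H rho x (a *: rho g x + y).

Section Span.
Variables (H : 'M[F]_2 -> Prop) (V : lmodType k) (rho : 'M[F]_2 -> V -> V).
Hypotheses (HG : forall g, H g -> inG g) (H1 : H 1%:M)
  (HM : forall g h, H g -> H h -> H (g *m h)) (hr : grep rho).

Lemma span_subspace x : subspace (span H rho x).
Proof.
split; first exact: span0.
  move=> y z hy hz; elim: hy => [|a g y' hg _ IH]; first by rewrite add0r.
  by rewrite -addrA; apply: spanS.
move=> c y; elim=> [|a g y' hg _ IH]; first by rewrite scaler0; apply: span0.
by rewrite scalerDr scalerA; apply: spanS.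
Qed.

Lemma span_act g x : H g -> span H rho x (rho g x).
Proof. by move=> hg; rewrite -[rho g x]addr0 -[rho g x]scale1r; apply: spanS => //; apply: span0. Qed.

Lemma span_self x : span H rho x x.
Proof. by case: hr => _ h _; rewrite -{2}(h x); apply: span_act. Qed.

Lemma span_stable x : stable H rho (span H rho x).
Proof.
case: hr => h1 _ h3 g y hg; elim=> [|a h z hh _ IH].
  by rewrite (lin0 (h1 g (HG hg))); apply: span0.
rewrite (h1 g (HG hg)) -h3; [|exact: HG|exact: HG].
by apply: spanS => //; apply: HM.
Qed.

Lemma span_min (S : V -> Prop) x : subspace S -> stable H rho S -> S x ->
  forall y, span H rho x y -> S y.
Proof.
move=> hS sS Sx y; elim=> [|a g z hg _ Sz]; first exact: sub0.
by apply: subD => //; apply: subZ => //; apply: sS.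
Qed.

Lemma span_zero y : span H rho 0 y -> y = 0.
Proof.
case: hr => h1 _ _; elim=> // a g z hg _ ->.
by rewrite (lin0 (h1 g (HG hg))) scaler0 addr0.
Qed.
End Span.

(** The group algebra element that carries x to y is applied to x' as well. *)
Lemma span_prod_lift H (V W : lmodType k) (rho : 'M[F]_2 -> V -> V) (sig : 'M[F]_2 -> W -> W)
  x x' y : span H rho x y -> exists y', span H (prod_act rho sig) (x, x') (y, y').
Proof.
elim=> [|a g z hg _ [z' IH]]; first by exists 0; apply: span0.
exists (a *: sig g x' + z').
exact: (@spanS H _ (prod_act rho sig) (x, x') a g (z, z')).
Qed.

Lemma span_prod_fst H (V W : lmodType k) (rho : 'M[F]_2 -> V -> V) (sig : 'M[F]_2 -> W -> W)
  z y : span H (prod_act rho sig) z y -> span H rho z.1 y.1.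
Proof. by elim=> [|a g u hg _ IH] /=; [apply: span0 | apply: spanS]. Qed.

Lemma span_prod_snd H (V W : lmodType k) (rho : 'M[F]_2 -> V -> V) (sig : 'M[F]_2 -> W -> W)
  z y : span H (prod_act rho sig) z y -> span H sig z.2 y.2.
Proof. by elim=> [|a g u hg _ IH] /=; [apply: span0 | apply: spanS]. Qed.

Definition fixed (V : lmodType k) (rho : 'M[F]_2 -> V -> V) (H : 'M[F]_2 -> Prop) (x : V) :=
  forall g, H g -> rho g x = x.

Lemma fixed_subspace (V : lmodType k) (rho : 'M[F]_2 -> V -> V) (H : 'M[F]_2 -> Prop) :
  grep rho -> (forall g, H g -> inG g) -> subspace (fixed rho H).
Proof.
move=> [h1 _ _] HG; split=> [g hg|x y hx hy g hg|a x hx g hg].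
- by rewrite (lin0 (h1 g (HG g hg))).
- by rewrite (linD (h1 g (HG g hg))) hx ?hy.
- by rewrite (linZ (h1 g (HG g hg))) hx.
Qed.

Lemma fixed_move (V : lmodType k) (rho : 'M[F]_2 -> V -> V) (H H' : 'M[F]_2 -> Prop) g x :
  grep rho -> inG g -> (forall h, H h -> inG h) ->
  (forall h, H h -> exists h', [/\ H' h', inG h' & h *m g = g *m h']) ->
  fixed rho H' x -> fixed rho H (rho g x).
Proof.
move=> [_ _ h3] hg HG hh hx h Hh; have [h' [H'h' gh' e]] := hh h Hh.
have Gh := HG h Hh; rewrite -h3 // e h3 //; congr (rho g _); exact: hx.
Qed.
End Representations.

(** * The Hecke operator *)

Section HeckeOperator.
Variables (p : nat) (F k : fieldType) (v : F -> int).
Hypothesis hF : nonarch_local_field p v.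
Variable R : seq F.
Hypothesis hR : residues v R.
Variable w : F.
Hypotheses (w0 : w != 0) (vw : v w = 1).

Notation inp := (inp v).
Notation vunit := (vunit v).

Definition tm : 'M[F]_2 := Dm w 1.
Definition Pm : 'M[F]_2 := mk 0 1 w 0.
Definition sm : 'M[F]_2 := mk 0 1 1 0.

Lemma inPt : inP tm. Proof. by apply: inPD; rewrite ?oner_neq0. Qed.
Lemma inGt : inG tm. Proof. exact: inP_inG inPt. Qed.
Lemma inGPm : inG Pm. Proof. by rewrite inG_mk mul0r sub0r mul1r oppr_eq0. Qed.
Lemma inGs : inG sm. Proof. by rewrite inG_mk mul0r sub0r mul1r oppr_eq0 oner_neq0. Qed.
Hint Resolve inPt inGt inGPm inGs : core.

Lemma inpw1 n x : inp n (x * w) = inp (n - 1) x.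
Proof. exact: (inpwX hF w0 vw n 1 x). Qed.

Lemma inpw1l n x : inp n (w * x) = inp (n - 1) x.
Proof. by rewrite mulrC inpw1. Qed.

Lemma inpwV n x : inp n (x / w) = inp (n + 1) x.
Proof. by have := inpw hF w0 vw n (-1) x; rewrite opprK. Qed.

(* The pro-p groups Gam 0 n and Gam 1 n; Gam 0 1 is the pro-p Iwahori subgroup. *)
Definition Gam (b n : int) (g : 'M[F]_2) : Prop :=
  [&& inp 1 (g ord0 ord0 - 1), inp 1 (g ord_max ord_max - 1), inp b (g ord0 ord_max)
    & inp n (g ord_max ord0)].

Lemma GamG b n g : 0 <= b -> 1 <= n -> Gam b n g -> inG g.
Proof.
move=> b0 n1; move: g; apply: mx_ind2 => x y z t; rewrite /Gam !mkE inG_mk.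
case/and4P=> hx ht hy hz; apply: (@vunit_neq0 _ v).
apply: (vunitD hF); first by rewrite (vunitM hF) // (one_vunit hF).
by rewrite (inpN hF) mulrC (inpMr hF) //; [apply: inp_le hz | apply: inp_le hy].
Qed.

Lemma GamU b n x : inp b x -> Gam b n (Um x).
Proof. by move=> hx; rewrite /Gam !mkE subrr !inp0 hx. Qed.

Lemma GamL b n x : inp n x -> Gam b n (Lm x).
Proof. by move=> hx; rewrite /Gam !mkE subrr !inp0 hx. Qed.

Lemma GamD b n a d : inp 1 (a - 1) -> inp 1 (d - 1) -> Gam b n (Dm a d).
Proof. by move=> ha hd; rewrite /Gam !mkE ha hd !inp0. Qed.

Lemma Gam_le b n b' n' g : b' <= b -> n' <= n -> Gam b n g -> Gam b' n' g.
Proof.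
by move=> hb hn /and4P[h1 h2 h3 h4]; apply/and4P; split=> //; [apply: inp_le h3 | apply: inp_le h4].
Qed.

Section Rep.
Variables (V : lmodType k) (rho : 'M[F]_2 -> V -> V).
Hypothesis hr : grep rho.

Lemma rlin g : inG g -> lin (rho g). Proof. by case: hr => h _ _; apply: h. Qed.
Lemma r1 x : rho 1%:M x = x. Proof. by case: hr. Qed.
Lemma rM g h x : inG g -> inG h -> rho (g *m h) x = rho g (rho h x).
Proof. by case: hr => _ _ h3 hg hh; apply: h3. Qed.

Lemma rho_eq0 g x : inG g -> rho g x = 0 -> x = 0.
Proof.
move=> hg e; have [Gi i1 _] := inG_invmx hg.
by rewrite -[x]r1 -i1 rM // e (lin0 (rlin Gi)).
Qed.

Lemma rUU x y z : rho (Um x) (rho (Um y) z) = rho (Um (x + y)) z.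
Proof. by rewrite -rM ?UmD. Qed.

Lemma rDU a d x z : a != 0 -> d != 0 ->
  rho (Dm a d) (rho (Um x) z) = rho (Um (a / d * x)) (rho (Dm a d) z).
Proof. by move=> a0 d0; rewrite -!rM ?DmU //; apply: inGD. Qed.

Lemma rDD a d a' d' z : a != 0 -> d != 0 -> a' != 0 -> d' != 0 ->
  rho (Dm a d) (rho (Dm a' d') z) = rho (Dm (a * a') (d * d')) z.
Proof. by move=> a0 d0 a'0 d'0; rewrite -rM ?DmM //; apply: inGD. Qed.

Lemma rtU x z : rho tm (rho (Um x) z) = rho (Um (w * x)) (rho tm z).
Proof. by rewrite rDU ?oner_neq0 // divr1. Qed.

Lemma rDt a d z : a != 0 -> d != 0 -> rho (Dm a d) (rho tm z) = rho tm (rho (Dm a d) z).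
Proof. by move=> a0 d0; rewrite !rDD ?oner_neq0 // !mulr1 mul1r mulrC. Qed.

Definition fixU (x : V) := forall y, inp 0 y -> rho (Um y) x = x.

Lemma fixed_U b n x y : fixed rho (Gam b n) x -> inp b y -> rho (Um y) x = x.
Proof. by move=> h hy; apply: h; apply: GamU. Qed.

Lemma fixed_fixU n x : fixed rho (Gam 0 n) x -> fixU x.
Proof. by move=> h y; apply: fixed_U h. Qed.

Lemma fixed_le b n b' n' x : b <= b' -> n <= n' ->
  fixed rho (Gam b n) x -> fixed rho (Gam b' n') x.
Proof. by move=> hb hn h g hg; apply: h; apply: Gam_le hg. Qed.

(** Conjugation by t^-1 divides the upper right entry by w and multiplies the lower left one by w: t
    gains one level of lower unipotent invariance and loses one of upper. *)
Lemma fixed_t m n x : 1 <= n -> m <= n + 1 ->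
  fixed rho (Gam 0 m) x -> fixed rho (Gam 1 n) (rho tm x).
Proof.
move=> n1 mn; apply: fixed_move => //; first by move=> h; apply: GamG.
apply: mx_ind2 => a b c d hg; exists (mk a (b / w) (c * w) d); split.
- case/and4P: hg; rewrite !mkE => ha hd hb hc.
  rewrite /Gam !mkE ha hd inpwV hb inpw1; apply: inp_le hc; lia.
- have := GamG _ n1 hg; rewrite !inG_mk => /(_ isT).
  by have -> : a * d - b / w * (c * w) = a * d - b * c by field.
- by rewrite !mk_mul; congr mk; field.
Qed.

(** U(o) normalizes [Gam 1 n]: the new upper right entry stays in the maximal ideal because a and d
    are congruent modulo it. *)
Lemma fixed_moveU n x z : 1 <= n -> inp 0 z ->
  fixed rho (Gam 1 n) x -> fixed rho (Gam 1 n) (rho (Um z) x).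
Proof.
move=> n1 hz; apply: fixed_move => //; first by move=> h; apply: GamG.
apply: mx_ind2 => a b c d hg.
exists (mk (a - z * c) (b + z * (a - d) - z * z * c) c (d + c * z)); split.
- case/and4P: hg; rewrite !mkE => ha hd hb hc.
  have hzc : inp 1 (z * c) by rewrite (inpMl hF) //; apply: inp_le hc.
  have had : inp 1 (a - d) by apply: (inp_trans hF ha); rewrite (inpBC hF).
  rewrite /Gam !mkE; apply/and4P; split=> //.
  + by rewrite addrAC (inpB hF).
  + by rewrite addrAC (inpD hF) // mulrC.
  + apply: (inpB hF); last by rewrite -mulrA; apply: (inpMl hF).
    by apply: (inpD hF) => //; apply: (inpMl hF).
- have := GamG _ n1 hg; rewrite !inG_mk => /(_ isT).
  by have -> : (a - z * c) * (d + c * z) - (b + z * (a - d) - z * z * c) * c = a * d - b * c by ring.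
- by rewrite !mk_mul; congr mk; ring.
Qed.

Lemma fixed_moveD b n x a d : 0 <= b -> 1 <= n -> vunit a -> vunit d ->
  fixed rho (Gam b n) x -> fixed rho (Gam b n) (rho (Dm a d) x).
Proof.
move=> b0 n1 ua ud; have [a0 d0] := (vunit_neq0 ua, vunit_neq0 ud).
apply: fixed_move; first by []; first exact: inGD; first by move=> h; apply: GamG.
apply: mx_ind2 => x' y z t hg; exists (mk x' (d / a * y) (a / d * z) t); split.
- case/and4P: hg; rewrite /Gam !mkE => -> -> hy hz /=.
  have u1 : vunit (d / a) by rewrite (vunitM hF) // (vunitV hF).
  have u2 : vunit (a / d) by rewrite (vunitM hF) // (vunitV hF).
  by rewrite (inpMu hF _ _ u1) hy (inpMu hF _ _ u2).
- have := GamG b0 n1 hg; rewrite !inG_mk.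
  by have -> : x' * t - d / a * y * (a / d * z) = x' * t - y * z by field; rewrite ?a0 ?d0.
- by rewrite !mk_mul; congr mk; field; rewrite ?a0 ?d0.
Qed.

Lemma fixed_UGam n x : 1 <= n -> fixU x -> fixed rho (Gam 1 n) x -> fixed rho (Gam 0 n) x.
Proof.
move=> n1 hU hG; apply: mx_ind2 => a b c d hg.
have Gg := GamG _ n1 hg.
case/and4P: (hg); rewrite !mkE => ha hd hb hc.
have ud := one_vunit hF hd; have d0 := vunit_neq0 ud.
have e : mk a b c d = Um (b / d) *m mk (a - b / d * c) 0 c d.
  by rewrite mk_mul; congr mk; field.
have hg' : Gam 1 n (mk (a - b / d * c) 0 c d).
  rewrite /Gam !mkE hd hc inp0 addrAC (inpB hF) //.
  by rewrite (inpMl hF) ?(inpMur hF) ?(vunitV hF) //; apply: inp_le hc.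
rewrite e rM //; last exact: GamG hg'.
by rewrite hG ?hU // (inpMur hF) ?(vunitV hF).
Qed.

(* The Hecke operator N = sum of u t over u in U(o) / t U(o) t^-1. *)
Definition Nop (x : V) : V := \sum_(r <- 0 :: R) rho (Um r) (rho tm x).

Lemma lin_Nop : lin Nop.
Proof.
move=> a x y; rewrite /Nop scaler_sumr -big_split /=; apply: eq_bigr => r _.
by rewrite !rlin.
Qed.

Lemma Utm_congr x y z : fixU z -> inp 1 (x - y) ->
  rho (Um x) (rho tm z) = rho (Um y) (rho tm z).
Proof.
move=> hz hxy; rewrite -[x](subrKC y) -rUU; congr (rho _ _).
have -> : x - y = w * ((x - y) / w) by field.
by rewrite -rtU hz // inpwV.
Qed.

Lemma Nop_affine (phi : F -> F) z : fixU z ->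
  (forall x, inp 0 x -> inp 0 (phi x)) ->
  (forall x y, inp 0 x -> inp 0 y -> inp 1 (phi x - phi y) -> inp 1 (x - y)) ->
  \sum_(r <- 0 :: R) rho (Um (phi r)) (rho tm z) = Nop z.
Proof.
move=> hz h1 h2; apply: (residue_reindex hF hR (G := fun x => rho (Um x) (rho tm z))) => //.
by move=> x y _ _; apply: Utm_congr.
Qed.

Lemma Nop_fixU z : fixU z -> fixU (Nop z).
Proof.
move=> hz y hy; rewrite /Nop (lin_sum (rlin (inGU _))).
under eq_bigr do rewrite rUU.
apply: Nop_affine => // [x hx|x x' hx hx']; first exact: (inpD hF).
by rewrite opprD addrACA subrr add0r.
Qed.

(** The sum over U(o)/U(p) restores the upper invariance that t has lost. With m = n + 1 this lowers
    the level by one; with m = n = 1 it shows that N preserves the I-fixed vectors. *)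
Lemma Nop_fixed m n z : 1 <= n -> m <= n + 1 -> fixed rho (Gam 0 m) z ->
  fixed rho (Gam 0 n) (Nop z).
Proof.
move=> n1 mn hz; apply: fixed_UGam => //; first exact: Nop_fixU (fixed_fixU hz).
have hG : forall g, Gam 1 n g -> inG g by move=> g; apply: GamG.
apply: (subsum (fixed_subspace hr hG)) => r rR.
by apply: fixed_moveU (res_inp hR rR) _ => //; apply: fixed_t hz.
Qed.

Lemma fixU_D a d z : a != 0 -> d != 0 -> vunit (a / d) -> fixU z ->
  fixU (rho (Dm a d) z).
Proof.
move=> a0 d0 uad hz y hy.
have -> : y = a / d * (d / a * y) by field; rewrite a0.
rewrite -rDU // hz //; have := vunitV hF uad; rewrite invf_div => uda.
by rewrite (inpMu hF).
Qed.

Lemma Nop_D a d z : a != 0 -> d != 0 -> vunit (a / d) -> fixU z ->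
  rho (Dm a d) (Nop z) = Nop (rho (Dm a d) z).
Proof.
move=> a0 d0 uad hz; rewrite /Nop (lin_sum (rlin (inGD a0 d0))).
under eq_bigr do rewrite rDU // rDt //.
apply: (@Nop_affine (fun r => a / d * r)).
- exact: fixU_D.
- by move=> y hy; rewrite (inpMu hF).
- by move=> x y _ _; rewrite -mulrBr (inpMu hF).
Qed.

(* The part of s N coming from the nonzero residues; see [s_Nop]. Unlike s, it lies in the
   group algebra of P. *)
Definition Dop (x : V) : V :=
  \sum_(r <- R) rho (Um r^-1) (rho (Dm (- r^-1) r) (rho tm x)).

Lemma res_unit r : r \in R -> vunit r. Proof. by case: hR => h _ _ _; apply: h. Qed.

Lemma tmE : tm = sm *m Pm. Proof. by rewrite mk_mul; congr mk; ring. Qed.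
Lemma PmPm : Pm *m Pm = Dm w w. Proof. by rewrite mk_mul; congr mk; ring. Qed.

Lemma rt_sP z : rho tm z = rho sm (rho Pm z).
Proof. by rewrite tmE rM. Qed.

Lemma rPP z : rho Pm (rho Pm z) = rho (Dm w w) z.
Proof. by rewrite -rM // PmPm. Qed.

Lemma rtP z : rho tm (rho Pm z) = rho sm (rho (Dm w w) z).
Proof. by rewrite rt_sP rPP. Qed.

Lemma rss z : rho sm (rho sm z) = z.
Proof. by rewrite -rM // mk_mul !(mul0r, mulr0, mul1r, addr0, add0r) -mk1 r1. Qed.

(* Bruhat decomposition of the lower unipotent matrix with entry x^-1, x != 0 *)
Lemma sUs x z : x != 0 -> rho sm (rho (Um x) (rho sm z)) =
  rho (Um x^-1) (rho (Dm (- x^-1) x) (rho sm (rho (Um x^-1) z))).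
Proof.
move=> x0; have hD : inG (Dm (- x^-1) x) by apply: inGD; rewrite ?oppr_eq0 ?invr_eq0.
rewrite -!rM; do ?[by do ?apply: inGM].
by congr (rho _ z); rewrite !mk_mul; congr mk; field.
Qed.

(** The residue 0 contributes s t = Pm. For r nonzero, t = s Pm turns the term into s u(r) s Pm z;
    by the Bruhat decomposition a factor u(1/r) lands on Pm z, which absorbs it, and the remaining s
    Pm is t again. *)
Lemma s_Nop z : fixU (rho Pm z) -> rho sm (Nop z) = rho Pm z + Dop z.
Proof.
move=> hz; rewrite /Nop big_cons Um0 r1 (linD (rlin inGs)) rt_sP rss; congr (_ + _).
rewrite /Dop (lin_sum (rlin inGs)) !big_seq; apply: eq_bigr => r /res_unit ur.
rewrite rt_sP sUs ?(vunit_neq0 ur) // hz //.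
by rewrite (vunit_inp (vunitV hF ur)).
Qed.

Lemma fixed_P z : fixed rho (Gam 0 1) z -> fixed rho (Gam 0 1) (rho Pm z).
Proof.
move=> hz; apply: fixed_move hz => //; first by move=> h; apply: GamG.
apply: mx_ind2 => a b c d hg; exists (mk d (c / w) (b * w) a); split.
- case/and4P: hg; rewrite !mkE => ha hd hb hc.
  by rewrite /Gam !mkE ha hd inpwV inpw1 hc hb.
- have := GamG (lexx 0) (lexx 1) hg; rewrite !inG_mk.
  by have -> : d * a - c / w * (b * w) = a * d - b * c by field.
- by rewrite !mk_mul; congr mk; field.
Qed.
End Rep.
End HeckeOperator.

#[global] Hint Resolve inGt inPt inGPm inGs : core.

(** * Iwasawa decomposition and eigencharacters on I-fixed vectors *)

Section Eigencharacters.
Variables (p : nat) (F k : fieldType) (v : F -> int).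
Hypothesis hF : nonarch_local_field p v.
Variable R : seq F.
Hypothesis hR : residues v R.
Variable w : F.
Hypotheses (w0 : w != 0) (vw : v w = 1).

Notation inp := (inp v).
Notation vunit := (vunit v).
Notation Gam := (Gam v).
Notation Pm := (Pm w).

Lemma vunit_div a d : a != 0 -> d != 0 -> v a = v d -> vunit (a / d).
Proof.
move=> a0 d0 e; by rewrite /(vunit _) mulf_neq0 ?invr_eq0 //= (vf hF) // e subrr eqxx.
Qed.

Lemma vunit_v a : vunit a -> v a = 0. Proof. by case/andP=> _ /eqP. Qed.

(** The two cases are c/d in the maximal ideal and d/c integral, for the bottom row (c, d). The
    second is reduced to the first by right multiplication with the inverse of [Pm], which makes the
    bottom row (d, c/w). *)
Lemma iwasawa g : inG g -> exists b i, [/\ inP b, Gam 0 1 i & g = b *m i \/ g = b *m Pm *m i].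
Proof.
move: g; apply: mx_ind2 => a b c d; rewrite inG_mk => hg.
have low x y z t : x * t - y * z != 0 -> t != 0 -> inp 1 (z / t) ->
    exists b i, [/\ inP b, Gam 0 1 i & mk x y z t = b *m i].
  move=> nz t0 h; exists (mk (x - y * (z / t)) y 0 t), (Lm (z / t)); split.
  - apply: inP_mk => //; apply: contraNneq nz => e.
    have -> : x * t - y * z = (x - y * (z / t)) * t by field.
    by rewrite e mul0r.
  - exact: GamL.
  - by rewrite mk_mul; congr mk; field.
have [/andP[d0 h]|nh] := boolP ((d != 0) && inp 1 (c / d)).
  by have [b' [i [h1 h2 h3]]] := low _ _ _ _ hg d0 h; exists b', i; split=> //; left.
have [c0 hdc] : c != 0 /\ inp 0 (d / c).
  have [d0|d0] := eqVneq d 0.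
    rewrite d0 mul0r inp0; split=> //; apply: contraNneq hg => ->.
    by rewrite d0 !mulr0 subrr.
  move: nh; rewrite d0 /=; have [->|c0] := eqVneq c 0; first by rewrite mul0r inp0.
  rewrite !inpE ?mulf_neq0 ?invr_eq0 // !(vf hF) // => h; split=> //; lia.
have [] := low b (a / w) d (c / w).
- have -> : b * (c / w) - a / w * d = - (a * d - b * c) / w by field.
  by rewrite mulf_neq0 ?oppr_eq0 ?invr_eq0.
- by rewrite mulf_neq0 ?invr_eq0.
- have -> : d / (c / w) = d / c * w by field; rewrite w0 c0.
  by rewrite (inpw1 hF w0 vw).
move=> b' [i [h1 h2 h3]].
(* The witness is the conjugate Pm^-1 i Pm. *)
exists b', (mk (i ord_max ord_max) (i ord_max ord0 / w) (i ord0 ord_max * w) (i ord0 ord0)).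
split=> //.
  case/and4P: h2 => g1 g2 g3 g4; rewrite /(Gam _ _ _) !mkE g1 g2.
  by rewrite (inpw1 hF w0 vw) (inpwV hF w0 vw) g3 g4.
right; rewrite -mulmxA [X in _ *m X]mk_mul.
have -> : mk a b c d = mk b (a / w) d (c / w) *m Pm by rewrite mk_mul; congr mk; field.
rewrite h3 -mulmxA; congr (_ *m _); rewrite {1}(mk_eta i) mk_mul; congr mk; field => //.
Qed.

Section Rep.
Variables (V : lmodType k) (rho : 'M[F]_2 -> V -> V).
Hypothesis hr : grep rho.
Notation Nop := (Nop R w rho).
Notation Dop := (Dop R w rho).

Lemma fixed_iwasawa g x : inG g -> fixed rho (Gam 0 1) x ->
  exists2 b, inP b & rho g x = rho b x \/ rho g x = rho b (rho Pm x).
Proof.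
move=> hg hx; have [b [i [hb hi e]]] := iwasawa hg.
have Gi : inG i by exact: (GamG hF _ _ hi).
have Gb := inP_inG hb; have GP := inGPm w0.
exists b => //; case: e => ->; [left | right].
  by rewrite (rM hr) // hx.
by rewrite (rM hr x (inGM Gb GP) Gi) hx // (rM hr x Gb GP).
Qed.

Section PStable.
Variable S : V -> Prop.
Hypotheses (hS : subspace S) (sS : stable (@inP F) rho S).

Lemma sub_N x : S x -> S (Nop x).
Proof. by move=> hx; apply: subsum => // r _; apply: sS => //; apply: sS => //; apply: inPt. Qed.

Lemma sub_D x : S x -> S (Dop x).
Proof.
move=> hx; apply: subsum => // r /(res_unit hR) /vunit_neq0 r0.
apply: sS => //; apply: sS; first by apply: inPD; rewrite ?oppr_eq0 ?invr_eq0.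
by apply: sS => //; apply: inPt.
Qed.

Lemma sub_span_G x : fixed rho (Gam 0 1) x -> S x -> S (rho Pm x) ->
  forall y, span (@inG F) rho x y -> S y.
Proof.
move=> hx Sx SPx y; elim=> [|a g z hg _ Sz]; first exact: sub0.
apply: subD => //; apply: subZ => //.
by have [b hb [->|->]] := fixed_iwasawa hg hx; apply: sS.
Qed.
End PStable.

Lemma P_of_N0 x : fixed rho (Gam 0 1) x -> Nop x = 0 -> rho Pm x = - Dop x.
Proof.
move=> hx Nx; apply/eqP; rewrite -addr_eq0 -(s_Nop hF hR w0 hr).
  by rewrite Nx (lin0 (rlin hr (inGs _))).
exact: (fixed_fixU (fixed_P hF w0 vw hr hx)).
Qed.

(** The condition v a = v d describes the torus units times the center. The element t is left out
    since it does not preserve I-invariance, so [chi] is meaningful only for such pairs. *)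
Definition eigv (chi : F -> F -> k) (x : V) : Prop := fixed rho (Gam 0 1) x /\
  forall a d, a != 0 -> d != 0 -> v a = v d -> rho (Dm a d) x = chi a d *: x.

Lemma eigv_subspace chi : subspace (eigv chi).
Proof.
have [s0 sD sZ] : subspace (fixed rho (Gam 0 1)).
  by apply: (fixed_subspace hr) => g; apply: (GamG hF).
split.
- by split=> // a d a0 d0 _; rewrite scaler0 (lin0 (rlin hr (inGD a0 d0))).
- move=> x y [hx hx'] [hy hy']; split; first exact: sD.
  by move=> a d a0 d0 e; rewrite (linD (rlin hr (inGD a0 d0))) hx' ?hy' ?scalerDr.
- move=> c x [hx hx']; split; first exact: sZ.
  by move=> a d a0 d0 e; rewrite (linZ (rlin hr (inGD a0 d0))) hx' ?scalerA ?[c * _]mulrC.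
Qed.

Lemma eigv_N chi x : eigv chi x -> eigv chi (Nop x).
Proof.
move=> [hx hx']; split; first by apply: (Nop_fixed hF hR w0 vw hr) hx.
move=> a d a0 d0 e; rewrite (Nop_D hF hR w0 vw hr) ?vunit_div ?hx' //.
  by rewrite (linZ (lin_Nop R w0 hr)).
exact: fixed_fixU hx.
Qed.

Definition swap (chi : F -> F -> k) : F -> F -> k := fun a d => chi d a.

Lemma eigv_P chi x : eigv chi x -> eigv (swap chi) (rho Pm x).
Proof.
move=> [hx hx']; split; first exact: (fixed_P hF w0 vw hr).
move=> a d a0 d0 e; have GD := inGD a0 d0; have GD' := inGD d0 a0; have GP := inGPm w0.
rewrite -(rM hr) //.
have -> : Dm a d *m Pm = Pm *m Dm d a by rewrite !mk_mul; congr mk; ring.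
by rewrite (rM hr) // hx' // (linZ (rlin hr GP)).
Qed.

Hypotheses (pp : prime p) (pk : p \in [pchar k]).

Lemma sum_residues_const (x : V) : \sum_(r <- 0 :: R) x = 0.
Proof.
rewrite big_const_seq count_predT iter_addr_0 -scaler_nat.
have /dvdnP[n e] := residue_card_pchar hF hR pp.
rewrite (_ : size _ = n * p)%N //.
by rewrite natrM (pcharf0 pk) mulr0 scale0r.
Qed.

Definition hecke_const (chi : F -> F -> k) : k := chi w w * \sum_(r <- R) chi (- r^-1) r.

(** As t Pm = s diag(w, w), the left side is, up to a scalar, the sum over U(o)/U(p) of the
    translates of s N x = Pm x + D x. The term Pm x is U(o)-invariant, so it is counted q times and
    vanishes in characteristic p. In each summand of D x the sum over U(o)/U(p) recreates N x, with
    factor chi(-1/r, r). *)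
Lemma NPN chi x : eigv chi x ->
  Nop (rho Pm (Nop x)) = hecke_const chi *: Nop x.
Proof.
move=> ex; case: (ex) => hx hx'.
have hPx := fixed_fixU (fixed_P hF w0 vw hr hx).
have hNx := eigv_N ex.
rewrite {1}/(Nop _); under eq_bigr do rewrite (rtP w0 hr) (proj2 hNx) // (linZ (rlin hr (inGs _))).
rewrite (s_Nop hF hR w0 hr) //.
under eq_bigr do rewrite (linZ (rlin hr (inGU _))).
rewrite -scaler_sumr -scalerA; congr (_ *: _).
under eq_bigr do rewrite (linD (rlin hr (inGU _))).
rewrite big_split /= [X in X + _]big_seq.
under eq_bigr => r rR do rewrite hPx ?(res_inp hR) //.
rewrite -big_seq sum_residues_const add0r.
under eq_bigr do rewrite /(Dop _) (lin_sum (rlin hr (inGU _))).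
rewrite exchange_big /= scaler_suml !big_seq; apply: eq_bigr => r rR.
have ur := res_unit hR rR; have r0 := vunit_neq0 ur.
have nr0 : - r^-1 != 0 by rewrite oppr_eq0 invr_eq0.
have vr : v (- r^-1) = v r by rewrite (vN hF) (vV hF) // (vunit_v ur) oppr0.
under eq_bigr do rewrite (rDt w0 hr) // hx' // (linZ (rlin hr (inGt w0))) (linZ (rlin hr (inGU _))) (linZ (rlin hr (inGU _))) (rUU hr).
rewrite -scaler_sumr; congr (_ *: _); apply: (Nop_affine hF hR w0 vw hr).
- exact: fixed_fixU hx.
- by move=> y hy; rewrite (inpD hF) // (vunit_inp (vunitV hF ur)).
- by move=> x' y _ _; rewrite opprD addrACA subrr addr0.
Qed.

End Rep.

Definition tchar (chi : F -> F -> k) : Prop :=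
  [/\ forall a d a' d', a != 0 -> d != 0 -> v a = v d -> a' != 0 -> d' != 0 -> v a' = v d' ->
        chi (a * a') (d * d') = chi a d * chi a' d',
      forall a d, inp 1 (a - 1) -> inp 1 (d - 1) -> chi a d = 1 &
      forall a d, a != 0 -> d != 0 -> v a = v d -> chi a d != 0].

Lemma scale_inj (V : lmodType k) (x : V) (a b : k) : x != 0 -> a *: x = b *: x -> a = b.
Proof.
move=> x0 /eqP; rewrite -subr_eq0 -scalerBl scaler_eq0 (negPf x0) orbF subr_eq0.
by move/eqP.
Qed.

Lemma eigv_tchar (V : lmodType k) (rho : 'M[F]_2 -> V -> V) chi x :
  grep rho -> eigv rho chi x -> x != 0 -> tchar chi.
Proof.
move=> hr [hx hx'] x0.
have chiM a d a' d' : a != 0 -> d != 0 -> v a = v d -> a' != 0 -> d' != 0 -> v a' = v d' ->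
    chi (a * a') (d * d') = chi a d * chi a' d'.
  move=> a0 d0 e a0' d0' e'; apply: (scale_inj x0).
  rewrite -hx' ?mulf_neq0 ?(vM hF) ?e ?e' // -DmM (rM hr) ?hx' //; try exact: inGD.
  by rewrite (linZ (rlin hr (inGD a0 d0))) hx' // scalerA mulrC.
have chi1 a d : inp 1 (a - 1) -> inp 1 (d - 1) -> chi a d = 1.
  move=> ha hd; have [ua ud] := (one_vunit hF ha, one_vunit hF hd).
  apply: (scale_inj x0); rewrite -hx' ?(vunit_neq0 ua) ?(vunit_neq0 ud) //.
    by rewrite hx ?scale1r //; apply: GamD.
  by rewrite !vunit_v.
split=> // a d a0 d0 e; apply/eqP => c0.
have := chiM a d a^-1 d^-1 a0 d0 e; rewrite !invr_eq0 a0 d0 !(vV hF) // e.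
move=> /(_ isT isT erefl); rewrite c0 mul0r !mulfV // chi1 ?subrr ?inp0 //.
by move/eqP; rewrite oner_eq0.
Qed.

Lemma tchar_swap chi : tchar chi -> tchar (swap chi).
Proof.
by move=> [h1 h2 h3]; split=> *; rewrite /swap; [apply: h1 | apply: h2 | apply: h3].
Qed.

(* Orthogonality of characters: the sum in [hecke_const] vanishes unless chi is trivial on
   the elements diag(u^-1, u). *)
Lemma hecke_const_swap chi : tchar chi -> hecke_const chi != 0 ->
  forall a d, a != 0 -> d != 0 -> v a = v d -> chi a d = chi d a.
Proof.
move=> [chiM chi1 chi0]; rewrite mulf_eq0 negb_or => /andP[_ s0].
have hu u : vunit u -> chi u^-1 u = 1.
  move=> uu; have u0 := vunit_neq0 uu; apply: (mulIf s0); rewrite mul1r.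
  (* Extended by zero to the non-units, so that r -> r u can be treated as a permutation of the
     whole system [0 :: R]. *)
  pose G x := if vunit x then chi (- x^-1) x else 0.
  have vr r : vunit r -> v (- r^-1) = v r.
    by move=> ur; rewrite (vN hF) (vV hF) ?(vunit_neq0 ur) // (vunit_v ur) oppr0.
  have nz r : vunit r -> - r^-1 != 0 by move/vunit_neq0; rewrite oppr_eq0 invr_eq0.
  have GR (h : F -> F) : ~~ vunit (h 0) ->
     \sum_(r <- 0 :: R) G (h r) = \sum_(r <- R) G (h r).
    by move=> h0; rewrite big_cons /G (negPf h0) add0r.
  have u00 : ~~ vunit 0 by rewrite /(vunit _) eqxx.
  have sG : \sum_(r <- R) chi (- r^-1) r = \sum_(r <- 0 :: R) G r.
    rewrite (GR id) // !big_seq; apply: eq_bigr => r rR.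
    by rewrite /G (res_unit hR rR).
  rewrite [in RHS]sG -(residue_reindex hF hR (phi := fun r => r * u)) => [|x y hx hy hxy|x hx|x y _ _].
  - rewrite GR ?mul0r // mulr_sumr !big_seq; apply: eq_bigr => r rR.
    have ur := res_unit hR rR; have r0 := vunit_neq0 ur.
    have u0' : u^-1 != 0 by rewrite invr_eq0.
    rewrite /G (vunitM hF) // [r * u]mulrC invfM -mulrN.
    by rewrite chiM ?nz ?vr // (vV hF) // (vunit_v uu) oppr0.
  - rewrite /G; have [ux|nx] := boolP (vunit x).
      have uy : vunit y by apply: (vunit_congr hF _ ux); rewrite (inpBC hF).
      rewrite uy; have x0 := vunit_neq0 ux; have y0 := vunit_neq0 uy.
      have -> : - y^-1 = - x^-1 * (x / y) by field; rewrite x0 y0.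
      have -> : chi (- x^-1) x = chi (- x^-1) x * chi (x / y) (y / x).
        rewrite [chi (x / y) _]chi1 ?mulr1 //.
          have -> : x / y - 1 = (x - y) / y by field.
          by rewrite (inpMur hF) // (vunitV hF).
        have -> : y / x - 1 = - (x - y) / x by field.
        by rewrite (inpMur hF) ?(vunitV hF) // (inpN hF).
      rewrite -chiM ?nz ?vr ?mulf_neq0 ?invr_eq0 //.
        by congr chi; field; rewrite ?x0 ?y0.
      by rewrite !(vf hF) // !vunit_v.
    case: ifP => // uy; case/negP: nx; exact: (vunit_congr hF hxy uy).
  - by rewrite (inpMr hF) // vunit_inp.
  - by rewrite -mulrBl (inpMur hF).
(* Multiply (a, d) by (u^-1, u) with u = a/d: the result is (d, a). *)
move=> a d a0 d0 e; have uad := vunit_div a0 d0 e; have z0 := vunit_neq0 uad.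
have := chiM a d (a / d)^-1 (a / d) a0 d0 e.
rewrite hu // mulr1 invr_eq0 z0 (vV hF) // (vunit_v uad) oppr0 => /(_ isT isT erefl) <-.
by congr chi; field; rewrite ?a0 ?d0.
Qed.
End Eigencharacters.

(** * Existence of Iwahori eigenvectors *)

Section FixedVectors.
Variables (p : nat) (F : fieldType) (k : closedFieldType) (v : F -> int).
Hypotheses (pp : prime p) (pk : p \in [pchar k]).
Hypothesis hF : nonarch_local_field p v.
Variable R : seq F.
Hypothesis hR : residues v R.
Variable w : F.
Hypotheses (w0 : w != 0) (vw : v w = 1).

Notation inp := (inp v).
Notation vunit := (vunit v).
Notation Gam := (Gam v).
Notation tm := (tm w).

Lemma congr_sub_mk n a b c d : congr_sub v n (mk a b c d) <->
  [&& inp n (a - 1), inp n b, inp n c & inp n (d - 1)].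
Proof.
split=> [h|/and4P[ha hb hc hd] i j].
  have := h ord0 ord0; have := h ord0 ord_max; have := h ord_max ord0.
  have := h ord_max ord_max; rewrite mk1 !mkE !subr0.
  by move=> /inpnP-> /inpnP-> /inpnP-> /inpnP->.
by apply/inpnP; case: (ord2P i) => ->; case: (ord2P j) => ->; rewrite mk1 !mkE ?subr0.
Qed.

Section Rep.
Variables (V : lmodType k) (rho : 'M[F]_2 -> V -> V).
Hypothesis hrho : is_rep v (@inG F) rho.

Lemma is_rep_grep : grep rho.
Proof. by case: hrho => h1 h2 h3 _; split. Qed.
Let hr := is_rep_grep.

Variable S : V -> Prop.
Hypotheses (hS : subspace S) (sS : stable (@inP F) rho S).

Lemma iter_U n x z : iter n (rho (Um x)) z = rho (Um (x *+ n)) z.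
Proof.
elim: n => [|n IH] /=; first by rewrite mulr0n Um0 (r1 hr).
by rewrite IH (rUU hr) mulrS.
Qed.

Lemma iter_D n a d z : a != 0 -> d != 0 ->
  iter n (rho (Dm a d)) z = rho (Dm (a ^+ n) (d ^+ n)) z.
Proof.
move=> a0 d0; elim: n => [|n IH] /=; first by rewrite !expr0 Dm1 (r1 hr).
by rewrite IH (rDD hr) ?expf_neq0 // !exprS.
Qed.

Lemma fixed_large x : exists2 n, (1 <= n)%N & forall m, (n <= m)%N ->
  forall g, congr_sub v m g -> inG g -> rho g x = x.
Proof.
case: hrho => _ _ _ /(_ x) [n [n0 h]]; exists n => // m nm g hg Gg; apply: h => // i j.
by apply/inpnP; apply: inp_le (introT (inpnP _ _ _) (hg i j)).
Qed.

(** Conjugating K_n by diag(w^-n, 1), an element of P, makes it contain U(o) while the lower level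
    becomes 2n. What is still missing is the torus of principal units; modulo 1 + p^n it is a finite
    abelian p-group and therefore fixes a nonzero vector. *)
Lemma fixed_Gam_ex : (exists2 x, S x & x != 0) ->
  exists n, (1 <= n)%N /\ exists2 y, S y & y != 0 /\ fixed rho (Gam 0 n%:Z) y.
Proof.
move=> [x Sx x0]; have [n n0 hn] := fixed_large x; have {}hn := hn n (leqnn n).
pose W := w ^+ n; have W0 : W != 0 by rewrite expf_neq0.
pose C (g : 'M[F]_2) : Prop := [&& inp n%:Z (g ord0 ord0 - 1), inp n%:Z (g ord_max ord_max - 1),
  inp 0 (g ord0 ord_max) & inp (n + n)%:Z (g ord_max ord0)].
have n1 : 1 <= n%:Z by lia.
have CG g : C g -> inG g.
  case/and4P=> h1 h2 h3 h4; apply: (@GamG _ _ _ hF 0 1) => //.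
  by apply/and4P; split=> //; [apply: inp_le h1 | apply: inp_le h2 | apply: inp_le h4; lia].
pose S1 z := S z /\ fixed rho C z.
have hS1 : subspace S1.
  have [s1 s2 s3] := fixed_subspace hr CG.
  split; first by split; [exact: sub0 | exact: s1].
    by move=> u z [Su Cu] [Sz Cz]; split; [exact: subD | exact: s2].
  by move=> a z [Sz Cz]; split; [exact: subZ | exact: s3].
have x1 : S1 (rho (Dm W^-1 1) x).
  have PD : inP (Dm W^-1 1) by apply: inPD; rewrite ?invr_eq0 ?oner_neq0.
  split; first exact: sS.
  apply: (@fixed_move _ _ _ _ C (fun g => congr_sub v n g /\ inG g)) => //.
  - exact: inP_inG.
  - apply: mx_ind2 => a b c d hg; exists (mk a (b * W) (c / W) d).
    have Gg : inG (mk a (b * W) (c / W) d).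
      have := CG _ hg; rewrite !inG_mk.
      by have -> : a * d - b * W * (c / W) = a * d - b * c by field.
    split=> //; last by rewrite !mk_mul; congr mk; field.
    split=> //; case/and4P: hg; rewrite !mkE => h1 h2 h3 h4.
    apply/congr_sub_mk; rewrite h1 h2 andbT /= (inpwX hF w0 vw) subrr h3 /=.
    have := inpw hF w0 vw n%:Z (- n%:Z) c; rewrite -exprnN opprK => ->.
    exact: h4.
  - by move=> g [h1 h2]; apply: hn.
(* Acting as the identity on pairs that are not principal units allows the full list of
   representatives modulo p^n as index set. *)
pose f (ad : F * F) z := if inp 1 (ad.1 - 1) && inp 1 (ad.2 - 1) then rho (Dm ad.1 ad.2) z else z.
have [l [_ l2]] := reps_ex hF hR w0 vw n.
have nz a : inp 1 (a - 1) -> a != 0 by move=> h; apply: (vunit_neq0 (one_vunit hF h)).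
have [|||||y [Sy Cy] [y0 hy]] := @common_fixed_vector k V p _
    [seq (a, d) | a <- l, d <- l] f S1 pk hS1.
- exists (rho (Dm W^-1 1) x) => //; apply: contra_neq x0; apply: (rho_eq0 hr).
  by apply: inGD; rewrite ?invr_eq0 ?oner_neq0.
- move=> [a d] c x' y'; rewrite /f /=; case: ifP => [/andP[ha hd]|_] //.
  by apply: (rlin hr); apply: inGD; apply: nz.
- move=> [a d] z [Sz Cz]; rewrite /f /=; case: ifP => [/andP[ha hd]|_] //.
  split; first by apply: sS => //; apply: inPD; apply: nz.
  have [ua ud] := (one_vunit hF ha, one_vunit hF hd).
  apply: (@fixed_move _ _ _ _ C C) => //; first by apply: inGD; apply: nz.
  apply: mx_ind2 => x' y' z' t hg; exists (mk x' (d / a * y') (a / d * z') t).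
  have Cg : C (mk x' (d / a * y') (a / d * z') t).
    move: hg; rewrite /C !mkE.
    have u1 : vunit (d / a) by rewrite (vunitM hF) // (vunitV hF).
    have u2 : vunit (a / d) by rewrite (vunitM hF) // (vunitV hF).
    by rewrite (inpMu hF _ _ u1) (inpMu hF _ _ u2).
  split=> //; first exact: CG.
  by rewrite !mk_mul; congr mk; field; rewrite ?(nz a) ?(nz d).
- move=> [a d] [a' d'] z _; rewrite /f /=; case: ifP => [/andP[ha hd]|_] //; case: ifP => // /andP[ha' hd'].
  by rewrite !(rDD hr) ?nz // ![a' * _]mulrC ![d' * _]mulrC.
- move=> [a d]; exists n => z [Sz Cz]; case E: (inp 1 (a - 1) && inp 1 (d - 1)); last first.
    by elim: (p ^ n)%N => //= m ->; rewrite /f /= E.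
  have /eq_iter -> : f (a, d) =1 rho (Dm a d) by move=> u; rewrite /f /= E.
  case/andP: E => ha hd; rewrite iter_D ?nz //; apply: Cz; rewrite /C !mkE !inp0 !andbT.
  by apply/andP; split; apply: inp_le (one_exppX hF n _) => //; lia.
exists (n + n)%N; split; first by lia.
exists y => //; split=> //; apply: mx_ind2 => a b c d hg; case/and4P: (hg); rewrite !mkE => ha hd hb hc.
have [ua ud] := (one_vunit hF ha, one_vunit hF hd).
have [a0 d0] := (nz _ ha, nz _ hd).
have [ai al hai] := l2 a (vunit_inp ua); have [di dl hdi] := l2 d (vunit_inp ud).
have oi x' i : inp n%:Z (x' - i) -> inp 1 (x' - 1) -> inp 1 (i - 1).
  by move=> h h'; apply: (inp_trans hF _ h'); rewrite (inpBC hF); apply: inp_le h.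
have [hai1 hdi1] := (oi _ _ hai ha, oi _ _ hdi hd).
have e : mk a b c d = Dm ai di *m mk (a / ai) (b / ai) (c / di) (d / di).
  by rewrite mk_mul; congr mk; field; rewrite ?nz.
have Cg : C (mk (a / ai) (b / ai) (c / di) (d / di)).
  have [uai udi] := (one_vunit hF hai1, one_vunit hF hdi1).
  have q (x' i : F) : i != 0 -> x' / i - 1 = (x' - i) / i by move=> i0; field.
  rewrite /C !mkE !q ?nz // !(inpMur hF) ?(vunitV hF) //.
  by apply/and4P; split.
rewrite e (rM hr _ (inGD (nz _ hai1) (nz _ hdi1)) (CG _ Cg)) Cy //.
have := hy (ai, di); rewrite /f /= hai1 hdi1; apply.
by apply/allpairsP; exists (ai, di).
Qed.

(** Applying t lowers n by one at the cost of U(o)-invariance. The latter is recovered from the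
    elementary abelian p-group U(o)/U(p). Only elements of P are applied, so the vector stays in
    [S]. *)
Lemma fixed_Gam_step n y : 1 <= n -> S y -> y != 0 -> fixed rho (Gam 0 (n + 1)) y ->
  exists2 z, S z & z != 0 /\ fixed rho (Gam 0 n) z.
Proof.
move=> n1 Sy y0 hy; pose S1 z := S z /\ fixed rho (Gam 1 n) z.
have GG g : Gam 1 n g -> inG g by apply: (GamG hF).
have hS1 : subspace S1.
  have [s1 s2 s3] := fixed_subspace hr GG.
  split; first by split; [exact: sub0 | exact: s1].
    by move=> u z [Su Cu] [Sz Cz]; split; [exact: subD | exact: s2].
  by move=> a z [Sz Cz]; split; [exact: subZ | exact: s3].
pose f r z := if inp 0 r then rho (Um r) z else z.
have [|||||z [Sz Cz] [z0 hz]] := @common_fixed_vector k V p _ (0 :: R) f S1 pk hS1.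
- exists (rho tm y).
    split; first by apply: sS => //; apply: inPt.
    exact: (fixed_t hF w0 vw hr n1 _ hy).
  by apply: contra_neq y0; apply: (rho_eq0 hr (inGt w0)).
- by move=> r c x' y'; rewrite /f; case: ifP => // _; apply: (rlin hr).
- move=> r z [Sz Cz]; rewrite /f; case: ifP => // hrr; split; first by apply: sS.
  exact: (fixed_moveU hF hr n1 hrr).
- move=> r s z _; rewrite /f; case: ifP => // _; case: ifP => // _.
  by rewrite !(rUU hr) addrC.
- move=> r; exists 1%N => z [Sz Cz]; case E: (inp 0 r); last first.
    by elim: (p ^ 1)%N => //= m ->; rewrite /f E.
  have /eq_iter -> : f r =1 rho (Um r) by move=> u; rewrite /f E.
  rewrite iter_U expn1; apply: Cz; apply: GamU; rewrite -mulr_natl.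
  by rewrite (inpMr hF) // (pchar_inp hF).
exists z => //; split=> //; apply: (fixed_UGam hF hr n1) => // x hx.
case: hR => _ _ _ cR; have [r rR hxr] := cR x hx.
rewrite -(subrK r x) -(rUU hr); have := hz r; rewrite /f (res_inp hR rR) => ->.
  by apply: Cz; apply: GamU.
by [].
Qed.

Lemma fixed_Iwahori_ex : (exists2 x, S x & x != 0) ->
  exists2 y, S y & y != 0 /\ fixed rho (Gam 0 1) y.
Proof.
move=> /fixed_Gam_ex [n [n0 [y Sy [y0 hy]]]].
elim: n n0 y Sy y0 hy => // n IH _ y Sy y0 hy.
have [e|n1] := posnP n; first by exists y => //; rewrite e in hy.
have [||z Sz [z0 hz]] := @fixed_Gam_step n%:Z y _ Sy y0; [by lia | by rewrite -PoszD addn1|].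
exact: (IH n1 z).
Qed.

(** The torus units act on I-fixed vectors through a finite abelian group that in general is not a
    p-group, so an eigenvector replaces a fixed vector. When v a = v d, diag(a, d) is the scalar d
    times diag(a/d, 1), and the central character takes care of d. *)
Lemma eigv_ex : central_char rho -> (exists2 x, S x & x != 0) ->
  exists chi, exists2 y, S y & y != 0 /\ eigv v rho chi y.
Proof.
move=> [omega hom] /fixed_Iwahori_ex [x Sx [x0 hx]].
pose S1 z := S z /\ fixed rho (Gam 0 1) z.
have GG g : Gam 0 1 g -> inG g by apply: (GamG hF).
have hS1 : subspace S1.
  have [s1 s2 s3] := fixed_subspace hr GG.
  split; first by split; [exact: sub0 | exact: s1].
    by move=> u z [Su Cu] [Sz Cz]; split; [exact: subD | exact: s2].
  by move=> a z [Sz Cz]; split; [exact: subZ | exact: s3].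
pose f (ad : F * F) z := if vunit ad.1 && vunit ad.2 then rho (Dm ad.1 ad.2) z else z.
have [|||||y [Sy hy] [y0 ye]] := @common_eigenvector k V _
    [seq (a, d) | a <- R, d <- R] f S1 hS1.
- by exists x.
- move=> [a d] c x' y'; rewrite /f /=; case: ifP => // /andP[ua ud].
  by apply: (rlin hr); apply: inGD; apply: vunit_neq0; eassumption.
- move=> [a d] z [Sz Cz]; rewrite /f /=; case: ifP => // /andP[ua ud]; split.
    by apply: sS => //; apply: inPD; apply: vunit_neq0; eassumption.
  exact: (fixed_moveD hF hr).
- move=> [a d] [a' d'] z _; rewrite /f /=; case: ifP => // /andP[ua ud]; case: ifP => // /andP[ua' ud'].
  by rewrite !(rDD hr) ?(vunit_neq0 ua) ?(vunit_neq0 ud) ?(vunit_neq0 ua') ?(vunit_neq0 ud') // [a' * _]mulrC [d' * _]mulrC.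
- move=> [a d]; case E: (vunit a && vunit d); last first.
    by exists 1%N => // z _; rewrite /f /= E.
  case/andP: (E) => ua ud.
  have [M M0 hM] := vunit_torsion hF hR ua; have [N N0 hN] := vunit_torsion hF hR ud.
  exists (M * N)%N => [|z [Sz Cz]]; first by rewrite muln_gt0 M0.
  have /eq_iter -> : f (a, d) =1 rho (Dm a d) by move=> u; rewrite /f /= E.
  rewrite iter_D ?(vunit_neq0 ua) ?(vunit_neq0 ud) //; apply: Cz.
  have pw u m : inp 1 (u - 1) -> inp 1 (u ^+ m - 1).
    move=> hu; elim: m => [|m IH]; first by rewrite subrr inp0.
    by rewrite exprS (one_mul hF).
  by apply: GamD; [rewrite exprM | rewrite mulnC exprM]; apply: pw.
have ue a d : vunit a -> vunit d -> exists c, rho (Dm a d) y = c *: y.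
  move=> ua ud; case: (hR) => _ _ _ cR.
  have rr u : vunit u -> exists r, [/\ r \in R, vunit r & inp 1 (u / r - 1)].
    move=> uu; have [r rR h] := cR u (vunit_inp uu); have ur : vunit r.
      by apply: (vunit_congr hF _ uu); rewrite (inpBC hF).
    exists r; split=> //.
      by move: rR; rewrite inE => /orP[/eqP r0|//]; have := vunit_neq0 ur; rewrite r0 eqxx.
    have r0 := vunit_neq0 ur; have -> : u / r - 1 = (u - r) / r by field.
    by rewrite (inpMur hF) // (vunitV hF).
  have [r [rR ur hra]] := rr a ua; have [s [sR us hsd]] := rr d ud.
  have [|c hc] := ye (r, s); first by apply/allpairsP; exists (r, s).
  move: hc; rewrite /f /= ur us /= => hc; exists c.
  have [[[r0 s0] a0] d0] := (vunit_neq0 ur, vunit_neq0 us, vunit_neq0 ua, vunit_neq0 ud).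
  have -> : Dm a d = Dm (r * (a / r)) (s * (d / s)) by congr Dm; field.
  rewrite -(rDD hr) ?mulf_neq0 ?invr_eq0 // (_ : rho (Dm (a / r) _) y = y) //.
  by apply: hy; apply: GamD.
have de a d : exists c, a != 0 -> d != 0 -> v a = v d -> rho (Dm a d) y = c *: y.
  have [|nh] := boolP [&& a != 0, d != 0 & v a == v d]; last first.
    by exists 0 => a0 d0 e; case/negP: nh; rewrite a0 d0 e eqxx.
  case/and3P=> a0 d0 /eqP e; have uad := vunit_div hF a0 d0 e.
  have [c hc] := ue _ _ uad (vunit1 hF); exists (omega d * c) => _ _ _.
  have -> : Dm a d = Dm (d * (a / d)) (d * 1) by congr Dm; field.
  rewrite -(rDD hr) ?oner_neq0 ?(vunit_neq0 uad) // hc (linZ (rlin hr (inGD d0 d0))).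
  by rewrite /Dm -mk_scalar hom // scalerA mulrC.
have [g hg] := choice (fun ad : F * F => de ad.1 ad.2).
exists (fun a d => g (a, d)); exists y => //; split=> //; split=> // a d.
exact: (hg (a, d)).
Qed.
End Rep.
End FixedVectors.

(** * Torsion of irreducible representations over the Hecke operator *)

Section Model.
Variables (p : nat) (F k : fieldType) (v : F -> int).
Hypothesis hF : nonarch_local_field p v.
Variable R : seq F.
Hypothesis hR : residues v R.
Variable w : F.
Hypotheses (w0 : w != 0) (vw : v w = 1).

Notation inp := (inp v).
Notation vunit := (vunit v).
Notation Gam := (Gam v).
Notation W := ('M[F]_2 -> k^o).
Notation rtW := (@rt F k^o).
Let hrt := grep_rt F k.

(* The Iwahori subgroup times the center. *)
Definition Ih (g : 'M[F]_2) : bool :=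
  [&& g ord0 ord0 != 0, g ord_max ord_max != 0, v (g ord0 ord0) == v (g ord_max ord_max),
      inp (v (g ord0 ord0)) (g ord0 ord_max) & inp (v (g ord0 ord0) + 1) (g ord_max ord0)].

Lemma one_add_neq0 x : inp 1 x -> 1 + x != 0.
Proof. by move=> hx; apply: (@vunit_neq0 _ v); apply: (vunitD hF (vunit1 hF)). Qed.

Lemma v_one_add x : inp 1 x -> v (1 + x) = 0.
Proof. by move=> hx; apply: vunit_v; apply: (vunitD hF (vunit1 hF)). Qed.

Lemma inp_div n x a : a != 0 -> inp n (x / a) = inp (n + v a) x.
Proof.
move=> a0; have [->|x0] := eqVneq x 0; first by rewrite mul0r !inp0.
by rewrite !inpE ?mulf_neq0 ?invr_eq0 // (vf hF) // lerBrDr.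
Qed.

Lemma IhP a b c d : Ih (mk a b c d) -> [/\ a != 0, d != 0, v a = v d, inp 0 (b / a) & inp 1 (c / d)].
Proof.
rewrite /Ih !mkE => /and5P[a0 d0 /eqP e hb hc]; split=> //; rewrite inp_div ?add0r //.
by rewrite -e addrC.
Qed.

Lemma Ih_mk a b c d : a != 0 -> d != 0 -> v a = v d -> inp 0 (b / a) -> inp 1 (c / d) ->
  Ih (mk a b c d).
Proof.
move=> a0 d0 e; rewrite !inp_div // add0r => hb hc.
by rewrite /Ih !mkE a0 d0 e eqxx -e hb /= e addrC.
Qed.

Lemma Ih_factor g : Ih g -> exists2 i, Gam 0 1 i &
  g = Dm (g ord0 ord0) (g ord_max ord_max) *m i.
Proof.
move: g; apply: mx_ind2 => a b c d /IhP[a0 d0 e hb hc]; rewrite !mkE.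
exists (mk 1 (b / a) (c / d) 1); first by rewrite /(Gam _ _ _) !mkE subrr inp0 hb hc.
by rewrite mk_mul; congr mk; field.
Qed.

Lemma Ih_inG g : Ih g -> inG g.
Proof.
move=> hg; have [i hi e] := Ih_factor hg; rewrite e; case/and5P: hg => a0 d0 _ _ _.
by apply: inGM; [apply: inGD | apply: (GamG hF _ _ hi)].
Qed.

Lemma IhD a d : a != 0 -> d != 0 -> v a = v d -> Ih (Dm a d).
Proof. by move=> a0 d0 e; apply: Ih_mk; rewrite ?mul0r ?inp0. Qed.

Lemma Gam_Ih g : Gam 0 1 g -> Ih g.
Proof.
move: g; apply: mx_ind2 => a b c d /and4P[]; rewrite !mkE => ha hd hb hc.
have [ua ud] := (one_vunit hF ha, one_vunit hF hd).
apply: Ih_mk; rewrite ?(vunit_neq0 ua) ?(vunit_neq0 ud) ?vunit_v //.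
  by rewrite (inpMur hF) // (vunitV hF).
by rewrite (inpMur hF) // (vunitV hF).
Qed.

Lemma Gam_inG g : Gam 0 1 g -> inG g. Proof. by move/Gam_Ih/Ih_inG. Qed.

Section Char.
Variable chi : F -> F -> k.
Hypothesis hchi : tchar v chi.

Definition chiI (g : 'M[F]_2) : k := chi (g ord0 ord0) (g ord_max ord_max).

Lemma Ih_mul g h : Ih g -> Ih h -> Ih (g *m h) /\ chiI (g *m h) = chiI g * chiI h.
Proof.
move: g; apply: mx_ind2 => a b c d; move: h; apply: mx_ind2 => a' b' c' d'.
move=> /IhP[a0 d0 e hb hc] /IhP[a0' d0' e' hb' hc'].
(* The diagonal entries of the product are a a' (1 + x) and d d' (1 + y), with x and y in the
   maximal ideal. *)
pose x := b / a * (d' / a') * (c' / d'); pose y := c / d * (a' / d') * (b' / a').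
have uad : vunit (d' / a') by rewrite (vunit_div hF).
have uda : vunit (a' / d') by rewrite (vunit_div hF).
have hx : inp 1 x by rewrite (inpMl hF) // (inpMur hF).
have hy : inp 1 y by rewrite (inpMr hF) // (inpMur hF).
have ea : a * a' + b * c' = a * a' * (1 + x) by rewrite /x; field; rewrite a0 d0' a0'.
have ed : c * b' + d * d' = d * d' * (1 + y) by rewrite /y; field; rewrite d0 d0' a0'.
have [ux uy] := (one_add_neq0 hx, one_add_neq0 hy).
have vad : v (a * a') = v (d * d') by rewrite !(vM hF) // e e'.
rewrite mk_mul /chiI !mkE ea ed; split.
  apply: Ih_mk; rewrite ?mulf_neq0 //.
  - by rewrite !(vM hF) ?mulf_neq0 // ?v_one_add // e e'.
  - have -> : (a * b' + b * d') / (a * a' * (1 + x)) = (b' / a' + b / a * (d' / a')) / (1 + x).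
      by field; rewrite ux a0 a0'.
    rewrite (inpMur hF) ?(vunitV hF) ?(vunitD hF) ?(vunit1 hF) //.
    by rewrite (inpD hF) // (inpMur hF).
  - have -> : (c * a' + d * c') / (d * d' * (1 + y)) = (c / d * (a' / d') + c' / d') / (1 + y).
      by field; rewrite uy d0 d0'.
    rewrite (inpMur hF) ?(vunitV hF) ?(vunitD hF) ?(vunit1 hF) //.
    by rewrite (inpD hF) // (inpMur hF).
case: hchi => chiM chi1 _.
rewrite chiM ?mulf_neq0 ?v_one_add // chiM // [chi (1 + x) _]chi1 ?mulr1 //.
  by rewrite addrAC subrr add0r.
by rewrite addrAC subrr add0r.
Qed.

Lemma Ih_inv g : Ih g -> exists2 h, Ih h & g *m h = 1%:M /\ h *m g = 1%:M.
Proof.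
move=> hg; have := Ih_inG hg; move: g hg; apply: mx_ind2 => a b c d.
rewrite inG_mk => /IhP[a0 d0 e hb hc] D0.
exists (mk (d / (a * d - b * c)) (- b / (a * d - b * c))
    (- c / (a * d - b * c)) (a / (a * d - b * c))); last first.
  by rewrite !mk_mul mk1; split; congr mk; field.
have vD : v (a * d - b * c) = v a + v d.
  have -> : a * d - b * c = a * d * (1 + - (b / a * (c / d))) by field; rewrite a0 d0.
  have hx : inp 1 (- (b / a * (c / d))) by rewrite (inpN hF) (inpMl hF).
  by rewrite (vM hF) ?mulf_neq0 ?one_add_neq0 // v_one_add // addr0 (vM hF).
apply: Ih_mk; rewrite ?mulf_neq0 ?invr_eq0 //.
- by rewrite !(vf hF) // e.
- have -> : - b / (a * d - b * c) / (d / (a * d - b * c)) = - (b / a * (a / d)).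
    by field; rewrite a0 d0.
  by rewrite (inpN hF) (inpMur hF) // (vunit_div hF).
- have -> : - c / (a * d - b * c) / (a / (a * d - b * c)) = - (c / d * (d / a)).
    by field; rewrite a0 d0.
  by rewrite (inpN hF) (inpMur hF) // (vunit_div hF).
Qed.

Definition eps : W := fun h => if Ih h then chiI h else 0.

Lemma eps_mulr h i : Ih i -> eps (h *m i) = chiI i * eps h.
Proof.
move=> hi; rewrite /eps; case: ifP => [hhi|nh].
  have [j hj [e1 e2]] := Ih_inv hi.
  have hh : Ih h by rewrite -[h]mulmx1 -e1 mulmxA; apply: (Ih_mul hhi hj).1.
  by rewrite hh (Ih_mul hh hi).2 mulrC.
case: ifP => [hh|_]; last by rewrite mulr0.
by rewrite (Ih_mul hh hi).1 in nh.
Qed.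

Lemma eps_mull h i : Ih i -> eps (i *m h) = chiI i * eps h.
Proof.
move=> hi; rewrite /eps; case: ifP => [hhi|nh].
  have [j hj [e1 e2]] := Ih_inv hi.
  have hh : Ih h by rewrite -[h]mul1mx -e2 -mulmxA; apply: (Ih_mul hj hhi).1.
  by rewrite hh (Ih_mul hi hh).2.
case: ifP => [hh|_]; last by rewrite mulr0.
by rewrite (Ih_mul hi hh).1 in nh.
Qed.

Lemma eps_eigv : eigv v rtW chi eps.
Proof.
split=> [g hg|a d a0 d0 e]; apply: funext => h.
  rewrite /rt eps_mulr; last exact: Gam_Ih.
  case: hchi => _ chi1 _; case/and4P: hg => h1 h2 _ _.
  by rewrite /chiI chi1 ?mul1r.
by rewrite /rt eps_mulr; [rewrite /chiI !mkE | exact: IhD].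
Qed.

Lemma eigv_Ih (V : lmodType k) (rho : 'M[F]_2 -> V -> V) x g :
  grep rho -> eigv v rho chi x -> Ih g -> rho g x = chiI g *: x.
Proof.
move=> hr [hx hx'] hg; have [i hi e] := Ih_factor hg; case/and5P: hg => a0 d0 /eqP ev _ _.
by rewrite [in LHS]e (rM hr _ (inGD a0 d0) (Gam_inG hi)) hx ?hx'.
Qed.

(* The function [eps] generates the compact induction of chi: its translates by distinct
   cosets of [Ih] have disjoint supports, so every linear relation between them holds for
   any vector on which [Ih] acts by chi. *)
Section Universal.
Variables (V : lmodType k) (rho : 'M[F]_2 -> V -> V).
Hypothesis hr : grep rho.
Variable x : V.
Hypothesis hx : eigv v rho chi x.

Lemma eps_universal_seq (l : seq (k * 'M[F]_2)) : (forall ag, ag \in l -> inG ag.2) ->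
  \sum_(ag <- l) ag.1 *: rtW ag.2 eps = 0 -> \sum_(ag <- l) ag.1 *: rho ag.2 x = 0.
Proof.
move: {2}(size l) (leqnn (size l)) => n.
elim: n l => [|n IH] [|[a0 g0] l] //= sl hl; rewrite ?big_nil //.
have G0 : inG g0 by apply: (hl (a0, g0)); rewrite mem_head.
have [Gi i1 i2] := inG_invmx G0.
pose q (ag : k * 'M[F]_2) := Ih (invmx g0 *m ag.2).
set L := _ :: l => e.
have qL (U : lmodType k) (sig : 'M[F]_2 -> U -> U) u : grep sig -> eigv v sig chi u ->
    \sum_(ag <- L) ag.1 *: sig ag.2 u =
    (\sum_(ag <- L | q ag) ag.1 * chiI (invmx g0 *m ag.2)) *: sig g0 u +
    \sum_(ag <- [seq ag <- L | ~~ q ag]) ag.1 *: sig ag.2 u.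
  move=> hs hu; rewrite (bigID q) big_filter; congr (_ + _).
  rewrite scaler_suml; apply: eq_bigr => ag hq.
  rewrite -[ag.2]mul1mx -i2 -mulmxA (rM hs) ?(eigv_Ih hs hu hq) //; last exact: Ih_inG.
  by rewrite (linZ (rlin hs G0)) scalerA mulmxA i2 mul1mx.
(* Evaluating the relation at g0^-1 isolates the terms whose group element lies in the coset of
   g0. *)
have c0 : \sum_(ag <- L | q ag) ag.1 * chiI (invmx g0 *m ag.2) = 0.
  have e' : \sum_(ag <- L) ag.1 * eps (invmx g0 *m ag.2) = 0.
    by have := congr1 (fun f : W => f (invmx g0)) e; rewrite fct_sumE.
  move: e'; rewrite (bigID q) /= addrC big1; last first.
    by move=> ag /negPf hq; rewrite /eps -/(q ag) hq mulr0.
  by rewrite add0r => h; apply: etrans h; apply: eq_bigr => ag hq; rewrite /eps -/(q ag) hq.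
rewrite (qL _ _ _ hr hx) c0 scale0r add0r.
have := qL _ _ _ hrt eps_eigv; rewrite c0 scale0r add0r e => /esym; apply: IH.
  rewrite size_filter -ltnS; apply: leq_trans sl; rewrite ltnS /L /= /q /= i1.
  have -> : Ih 1%:M by rewrite -Dm1; apply: IhD; rewrite ?oner_neq0.
  exact: count_size.
by move=> ag; rewrite mem_filter => /andP[_ /hl].
Qed.

Lemma span_seq (U : lmodType k) (sig : 'M[F]_2 -> U -> U) u z : span (@inG F) sig u z ->
  exists2 l : seq (k * 'M[F]_2), forall ag, ag \in l -> inG ag.2 &
    z = \sum_(ag <- l) ag.1 *: sig ag.2 u.
Proof.
elim=> [|a g y hg _ [l hl ->]]; first by exists [::]; rewrite ?big_nil.
exists ((a, g) :: l); last by rewrite big_cons.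
by move=> ag; rewrite inE => /orP[/eqP->|/hl].
Qed.

Lemma eps_universal z : span (@inG F) (prod_act rho rtW) (x, eps) z -> z.2 = 0 -> z.1 = 0.
Proof.
case/span_seq => l hl ->.
have l1 : lin (fun u : V * W => u.1) by [].
have l2 : lin (fun u : V * W => u.2) by [].
rewrite (lin_sum l1) (lin_sum l2) /=; exact: eps_universal_seq.
Qed.
End Universal.
End Char.
End Model.

(** * Values of Hecke translates in the compact induction *)

Section ModelValues.
Variables (p : nat) (F k : fieldType) (v : F -> int).
Hypothesis hF : nonarch_local_field p v.
Variable R : seq F.
Hypothesis hR : residues v R.
Variable w : F.
Hypotheses (w0 : w != 0) (vw : v w = 1).
Variable chi : F -> F -> k.
Hypothesis hchi : tchar v chi.

Notation inp := (inp v).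
Notation vunit := (vunit v).
Notation tm := (tm w).
Notation Pm := (Pm w).
Notation W := ('M[F]_2 -> k^o).
Notation rtW := (@rt F k^o).
Notation NW := (Nop R w rtW).
Notation Ih := (Ih v).
Notation eps := (eps v chi : W).
Notation chiI := (chiI chi).
Let hrt := grep_rt F k.

Definition tneg (n : nat) : 'M[F]_2 := Dm (w ^+ n)^-1 1.

Lemma wX0 n : w ^+ n != 0. Proof. exact: expf_neq0. Qed.
Lemma wV0 n : (w ^+ n)^-1 != 0. Proof. by rewrite invr_eq0 wX0. Qed.
Lemma v_wV n : v (w ^+ n)^-1 = - n%:Z.
Proof. by rewrite (vV hF) ?wX0 // (vw_exp hF w0 vw). Qed.

(* U(o)-invariant functions satisfying this support condition are determined by their values at
   t^-n and Pm t^-n. *)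
Definition supp_o (y : W) : Prop := forall h, y h != 0 -> exists i n x,
  [/\ Ih i, inp 0 x & h = i *m tneg n *m Um x \/ h = i *m Pm *m tneg n *m Um x].

Definition Eset (y : W) : Prop :=
  [/\ forall i h, Ih i -> y (i *m h) = chiI i * y h, fixU v rtW y & supp_o y].

Lemma supp_o_subspace : subspace supp_o.
Proof.
split; first by move=> h /eqP [].
  move=> y z hy hz h; have [e|/hy//] := eqVneq (y h) 0.
  by rewrite addrfctE e add0r => /hz.
move=> a y hy h; rewrite scalrfctE => ne; apply: hy; apply: contraNneq ne => ->.
by rewrite scaler0.
Qed.

Lemma Eset_subspace : subspace Eset.
Proof.
have [s1 s2 s3] := supp_o_subspace.
have hU : subspace (fixU v rtW).
  have [f1 f2 f3] : subspace (fixed rtW (fun g => exists2 x, inp 0 x & g = Um x)).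
    by apply: fixed_subspace => // g [x _ ->].
  split=> [y hy|y z hy hz u hu|a y hy u hu].
  - by apply: f1; exists y.
  - by apply: f2; [move=> g [x hx ->]; apply: hy | move=> g [x hx ->]; apply: hz | exists u].
  - by apply: f3; [move=> g [x hx ->]; apply: hy | exists u].
case: hU => u1 u2 u3.
split; first by split=> // i h _; rewrite mulr0.
  move=> y z [y1 y2 y3] [z1 z2 z3]; split; [|exact: u2|exact: s2].
  by move=> i h hi; rewrite !addrfctE y1 // z1 // mulrDr.
move=> a y [y1 y2 y3]; split; [|exact: u3|exact: s3].
by move=> i h hi; rewrite !scalrfctE y1 // /GRing.scale /= mulrCA.
Qed.

Lemma supp_o_U y r : inp 0 r -> supp_o y -> supp_o (rtW (Um r) y).
Proof.
move=> hr hy h; rewrite /rt => /hy [i [n [x [hi hx e]]]].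
have eh : h = h *m Um r *m Um (- r) by rewrite -mulmxA UmD subrr Um0 mulmx1.
exists i, n, (x - r); split=> //; first exact: (inpB hF).
by case: e => e; [left | right]; rewrite eh e -mulmxA UmD.
Qed.

Lemma Eset_zero y : Eset y -> (forall n, y (tneg n) = 0) ->
  (forall n, y (Pm *m tneg n) = 0) -> y = 0.
Proof.
move=> [y1 y2 y3] h1 h2; apply: funext => h; apply/eqP; apply/negPn/negP => nz.
have [i [n [x [hi hx e]]]] := y3 h nz; case/eqP: nz.
have U z : y (z *m Um x) = y z by have := congr1 (fun f : W => f z) (y2 x hx).
by case: e => ->; rewrite U -?mulmxA y1 // ?h1 ?h2 mulr0.
Qed.

Lemma NW_val y h : NW y h = \sum_(r <- 0 :: R) y (h *m Um r *m tm).
Proof. by rewrite /Nop fct_sumE; apply: eq_bigr => r _; rewrite /rt. Qed.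

Lemma tneg_UtE n r : tneg n *m Um r *m tm = mk ((w ^+ n)^-1 * w) ((w ^+ n)^-1 * r) 0 1.
Proof. by rewrite !mk_mul; congr mk; ring. Qed.

Lemma Ptneg_UtE n r : Pm *m tneg n *m Um r *m tm =
  mk 0 1 ((w ^+ n)^-1 * w * w) ((w ^+ n)^-1 * r * w).
Proof. by rewrite !mk_mul; congr mk; ring. Qed.

Lemma i_tnegU i m x : i *m tneg m *m Um x =
  mk (i ord0 ord0 * (w ^+ m)^-1) (i ord0 ord0 * (w ^+ m)^-1 * x + i ord0 ord_max)
     (i ord_max ord0 * (w ^+ m)^-1) (i ord_max ord0 * (w ^+ m)^-1 * x + i ord_max ord_max).
Proof. by rewrite {1}(mk_eta i) !mk_mul; congr mk; ring. Qed.

Lemma i_PtnegU i m x : i *m Pm *m tneg m *m Um x =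
  mk (i ord0 ord_max * w * (w ^+ m)^-1) (i ord0 ord_max * w * (w ^+ m)^-1 * x + i ord0 ord0)
     (i ord_max ord_max * w * (w ^+ m)^-1) (i ord_max ord_max * w * (w ^+ m)^-1 * x + i ord_max ord0).
Proof. by rewrite {1}(mk_eta i) !mk_mul; congr mk; ring. Qed.

Lemma mk_inj a b c d a' b' c' d' : mk a b c d = mk a' b' c' d' :> 'M[F]_2 ->
  [/\ a = a', b = b', c = c' & d = d'].
Proof.
move=> e; have f i j := congr1 (fun g : 'M[F]_2 => g i j) e.
by have := f ord0 ord0; have := f ord0 ord_max; have := f ord_max ord0;
   have := f ord_max ord_max; rewrite !mkE.
Qed.

(** If such a point were in the support, comparing valuations of the entries would give exponent m =
    n - 1, impossible for n = 0, and comparing the remaining entries would write r as w x + c w^n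
    with x and c integral, so r would not be a unit. *)
Lemma supp_o_vanish y n r : supp_o y -> n = 0%N \/ vunit r ->
  y (tneg n *m Um r *m tm) = 0 /\ y (Pm *m tneg n *m Um r *m tm) = 0.
Proof.
move=> y3 nr; rewrite tneg_UtE Ptneg_UtE.
have wm m : w / w ^+ m != 0 by rewrite mulf_neq0 ?wV0.
have wm' m : w * w / w ^+ m != 0 by rewrite !mulf_neq0 ?wV0.
have key n' m x c : 1 - n'%:Z = - m%:Z -> inp 0 x -> inp 0 c -> r = w * x + c * w ^+ n' ->
    n' = 0%N \/ vunit r -> False.
  move=> e hx hc er [n0|]; first by rewrite n0 in e; lia.
  rewrite vunitE => /andP[_ /negP]; apply; rewrite er (inpD hF) //.
    by rewrite (inpw1l hF w0 vw).
  by rewrite (inpwX hF w0 vw); apply: inp_le hc; lia.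
split; apply/eqP; apply/negPn/negP => /y3 [i [m [x [hi hx]]]].
  rewrite i_tnegU i_PtnegU; case/and5P: hi => a0 d0 /eqP vad hb hc.
  case=> /mk_inj [e1 e2 e3 e4].
    have i10 : i ord_max ord0 = 0.
      by move/esym/eqP: e3; rewrite mulf_eq0 (negPf (wV0 _)) orbF => /eqP.
    move: e4; rewrite i10 !mul0r add0r => i11.
    have va : v (i ord0 ord0) = 0 by rewrite vad -i11 (v1 hF).
    apply: (@key n m x (i ord0 ord_max)) => //.
    + have := congr1 v e1; rewrite !(vM hF) ?wV0 // !v_wV va vw; lia.
    + by rewrite va in hb.
    + rewrite -e1 in e2; have := wX0 n => nz.
      have -> : r = (w ^+ n)^-1 * r * w ^+ n by field.
      by rewrite e2; field.
  by move/eqP: e3; rewrite eq_sym !mulf_eq0 (negPf d0) (negPf w0) (negPf (wV0 _)).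
rewrite i_tnegU i_PtnegU; case/and5P: hi => a0 d0 /eqP vad hb hc.
case=> /mk_inj [e1 e2 e3 e4].
  by move/eqP: e1; rewrite eq_sym !mulf_eq0 (negPf a0) (negPf (wV0 _)).
have i01 : i ord0 ord_max = 0.
  by move/esym/eqP: e1; rewrite !mulf_eq0 (negPf (wV0 _)) (negPf w0) !orbF => /eqP.
move: e2; rewrite i01 !mul0r add0r => i00.
have va : v (i ord0 ord0) = 0 by rewrite -i00 (v1 hF).
apply: (@key n m x (i ord_max ord0 / w)) => //.
+ have := congr1 v e3; rewrite !(vM hF) ?mulf_neq0 ?wV0 // !v_wV -vad va vw; lia.
+ by rewrite (inpwV hF w0 vw); rewrite va in hc.
+ rewrite -e3 in e4; have := wX0 n => nz.
  have -> : r = (w ^+ n)^-1 * r * w * w ^+ n / w by field; rewrite w0 nz.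
  by rewrite e4; field; rewrite w0 nz.
Qed.

Definition Hn (b : bool) (n : nat) : 'M[F]_2 := if b then Pm *m tneg n else tneg n.

Lemma NW_val0 b y : supp_o y -> NW y (Hn b 0) = 0.
Proof.
move=> y3; rewrite NW_val big1 // => r _.
by have [h1 h2] := @supp_o_vanish y 0 r y3 (or_introl erefl); case: b.
Qed.

Lemma NW_valS b y n : supp_o y -> NW y (Hn b n.+1) = y (Hn b n).
Proof.
move=> y3; rewrite NW_val big_cons big_seq big1 ?addr0.
  rewrite Um0 mulmx1; congr y; have := wX0 n => nz.
  have e : tneg n.+1 *m tm = tneg n.
    by rewrite mk_mul; congr mk; rewrite ?exprS; field; rewrite ?w0 ?nz.
  by case: b; rewrite /Hn -?mulmxA e.
move=> r /(res_unit hR) ur.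
by have [h1 h2] := @supp_o_vanish y n.+1 r y3 (or_intror ur); case: b.
Qed.

Lemma Eset_N y : Eset y -> Eset (NW y).
Proof.
move=> [y1 y2 y3]; split.
- move=> i h hi; rewrite !NW_val mulr_sumr; apply: eq_bigr => r _.
  by rewrite -!mulmxA y1.
- exact: (Nop_fixU hF hR w0 vw hrt).
move=> h; rewrite NW_val => nz.
have [r rR hr] : exists2 r, r \in 0 :: R & y (h *m Um r *m tm) != 0.
  apply: contrapT => nh; case/eqP: nz; rewrite big_seq big1 // => r rR.
  by apply/eqP; apply/negPn/negP => h'; apply: nh; exists r.
(* From t^-n u(x) = t^-(n+1) u(w x - r) u(r) t: undoing u(r) t moves the point one step further
   out. *)
have [i [n [x [hi hx e]]]] := y3 _ hr; exists i, n.+1, (w * x - r).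
have nz' := wX0 n.
have e1 : tneg n *m Um x = tneg n.+1 *m Um (w * x - r) *m (Um r *m tm).
  by rewrite !mk_mul; congr mk; rewrite ?exprS; field; rewrite ?w0 ?nz'.
have G : inG (Um r *m tm) by apply: inGM => //; apply: inGt.
have [_ _ g2] := inG_invmx G.
have eh : h = h *m Um r *m tm *m invmx (Um r *m tm) by rewrite -[h *m _ *m _]mulmxA -mulmxA g2 mulmx1.
move: (Um r *m tm) e1 g2 eh => X e1 g2 eh.
split=> //.
  rewrite (inpB hF) ?(res_inp hR rR) // (inpw1l hF w0 vw); apply: inp_le hx; lia.
case: e => e; [left | right]; rewrite eh e.
  by rewrite -[i *m _ *m _]mulmxA e1 -!mulmxA g2 mulmx1.
by rewrite -[i *m _ *m _ *m _]mulmxA e1 -!mulmxA g2 mulmx1.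
Qed.

Lemma Eset_pact P y : Eset y -> Eset (pact NW P y).
Proof. by move=> hy; apply: (pact_sub Eset_subspace) => //; apply: Eset_N. Qed.

Lemma pact_val b y P n : Eset y -> (forall m, y (Hn b m.+1) = 0) ->
  pact NW P y (Hn b n) = P`_n * y (Hn b 0).
Proof.
move=> hy y0.
have it m j : iter m NW y (Hn b j) = if j == m then y (Hn b 0) else 0.
  elim: m j => [|m IH] [|j] //=.
  - by rewrite NW_val0 //; case: (iter_sub Eset_N m hy).
  - by rewrite NW_valS ?IH //; case: (iter_sub Eset_N m hy).
rewrite /pact fct_sumE.
under eq_bigr do rewrite scalrfctE it /GRing.scale /=.
have [ltn|gen] := ltnP n (size P).
  rewrite (bigD1 (Ordinal ltn)) //= eqxx big1 ?addr0 // => i ne.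
  by move: ne; rewrite -(inj_eq val_inj) /= eq_sym => /negPf ->; rewrite mulr0.
rewrite nth_default // mul0r big1 // => i _.
by rewrite gtn_eqF ?mulr0 // (leq_trans (ltn_ord i)).
Qed.

Lemma eps_Hn b n : eps (Hn b n) = if ~~ b && (n == 0%N) then 1 else 0.
Proof.
have := wX0 n => nz; rewrite /(eps _); case: b => /=.
  have -> : Pm *m tneg n = mk 0 1 (w / w ^+ n) 0 by rewrite mk_mul; congr mk; ring.
  by rewrite /(Ih _) !mkE eqxx.
rewrite /(Ih _) /chiI !mkE wV0 oner_neq0 v_wV (v1 hF) !inp0 /= !andbT.
case: n nz => [|n] nz; rewrite ?eqxx.
  by rewrite expr0 invr1; case: hchi => _ -> //; rewrite subrr inp0.
by case: eqP => //; lia.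
Qed.

Lemma IhZ g a : a != 0 -> Ih g -> Ih (Dm a a *m g) /\ Ih (g *m Dm a a).
Proof.
move=> a0 hg; have hD : Ih (Dm a a) by apply: (IhD hF).
split; [exact: (Ih_mul hF hchi hD hg).1 | exact: (Ih_mul hF hchi hg hD).1].
Qed.

Lemma Eset_eps : Eset eps /\ Eset (rtW Pm eps).
Proof.
have fU := fixed_fixU (proj1 (eps_eigv hF hchi)).
split; split.
- by move=> i h hi; apply: (eps_mull hF hchi).
- exact: fU.
- move=> h; rewrite /eps; case: ifP => [hh _|_]; last by rewrite eqxx.
  exists h, 0%N, 0; split=> //; first exact: inp0.
  by left; rewrite /tneg expr0 invr1 Dm1 Um0 !mulmx1.
- by move=> i h hi; rewrite /rt -mulmxA (eps_mull hF hchi).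
- apply: fixed_fixU; exact: (fixed_P hF w0 vw hrt (proj1 (eps_eigv hF hchi))).
move=> h; rewrite /rt /(eps _); case: ifP => [hh _|_]; last by rewrite eqxx.
have wi : w^-1 != 0 by rewrite invr_eq0.
exists (h *m Pm *m Dm w^-1 w^-1), 0%N, 0; split; [exact: (IhZ wi hh).2|exact: inp0|].
right; rewrite /tneg expr0 invr1 Dm1 Um0 !mulmx1 -!mulmxA.
have -> : Pm *m (Dm w^-1 w^-1 *m Pm) = 1%:M.
  by rewrite !mk_mul mk1; congr mk; field.
by rewrite mulmx1.
Qed.

Lemma Peps_Hn b n : rtW Pm eps (Hn b n) = if b && (n == 0%N) then chi w w else 0.
Proof.
have := wX0 n => nz; rewrite /rt /(eps _); case: b => /=; last first.
  have -> : tneg n *m Pm = mk 0 (w ^+ n)^-1 w 0 by rewrite mk_mul; congr mk; ring.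
  by rewrite /(Ih _) !mkE eqxx.
have -> : Pm *m tneg n *m Pm = mk w 0 0 (w / w ^+ n) by rewrite !mk_mul; congr mk; ring.
rewrite /(Ih _) /chiI !mkE mulf_neq0 ?wV0 // w0 (vf hF) ?wX0 // (vw_exp hF w0 vw) vw !inp0 /= !andbT.
case: n nz => [|n] nz; first by rewrite subr0 eqxx expr0 divr1.
by case: eqP => //; lia.
Qed.

Lemma span_eps_left y i h : span (@inG F) rtW eps y -> Ih i -> y (i *m h) = chiI i * y h.
Proof.
move=> hy hi; elim: hy => [|a g z _ _ IH]; first by rewrite mulr0.
by rewrite !addrfctE !scalrfctE IH /rt -mulmxA (eps_mull hF hchi) // mulrDr [in RHS]mulrCA.
Qed.

(** Membership in [Ih] forces diagonal entries of equal valuation, which determines n from the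
    entries of g; the bounds come from these two equations. *)
Lemma span_eps_bounded y : span (@inG F) rtW eps y ->
  exists B, forall b n, (B <= n)%N -> y (Hn b n) = 0.
Proof.
elim=> [|a g z hg _ [B IH]]; first by exists 0%N.
move: g hg; apply: mx_ind2 => a' b' c' d' _.
exists (maxn B (maxn (absz (v a' - v d')%R).+1 (absz (1 + v b' - v c')%R).+1)) => b n.
rewrite !geq_max => /and3P[nB n1 n2].
rewrite addrfctE scalrfctE IH // addr0 /rt /(eps _); case: ifP => [|_]; last by rewrite scaler0.
have := wX0 n => nz; case: b => /=.
  have -> : Pm *m tneg n *m mk a' b' c' d' = mk c' d' (w / w ^+ n * a') (w / w ^+ n * b').
    by rewrite !mk_mul; congr mk; ring.
  rewrite /(Ih _) !mkE mulf_eq0 negb_or => /and5P[c0 /andP[_ b0] /eqP].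
  rewrite (vM hF) ?(vf hF) ?mulf_neq0 ?wV0 // (vw_exp hF w0 vw) vw; lia.
have -> : tneg n *m mk a' b' c' d' = mk ((w ^+ n)^-1 * a') ((w ^+ n)^-1 * b') c' d'.
  by rewrite mk_mul; congr mk; ring.
rewrite /(Ih _) !mkE mulf_eq0 negb_or => /and5P[/andP[_ a0] d0 /eqP].
rewrite (vM hF) ?wV0 // v_wV; lia.
Qed.
End ModelValues.

(** * A principal series vector fixed by the Hecke operator *)

Section AuxiliaryFunction.
Variables (p : nat) (F k : fieldType) (v : F -> int).
Hypothesis hF : nonarch_local_field p v.
Variable R : seq F.
Hypothesis hR : residues v R.
Variable w : F.
Hypotheses (w0 : w != 0) (vw : v w = 1).

Notation inp := (inp v).
Notation vunit := (vunit v).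
Notation tm := (tm w).
Notation W := ('M[F]_2 -> k^o).
Notation rtW := (@rt F k^o).
Notation NW := (Nop R w rtW).
Notation Ih := (Ih v).

Lemma subr_double_addr (m n l : int) : m + (n + n) - (l + n + (l + n)) = m - (l + l).
Proof. by lia. Qed.

Lemma Nop_prod (V V' : lmodType k) (rho : 'M[F]_2 -> V -> V) (sig : 'M[F]_2 -> V' -> V') z :
  Nop R w (prod_act rho sig) z = (Nop R w rho z.1, Nop R w sig z.2).
Proof.
have l1 : lin (fun u : V * V' => u.1) by [].
have l2 : lin (fun u : V * V' => u.2) by [].
by apply: injective_projections; rewrite /Nop ?(lin_sum l1) ?(lin_sum l2).
Qed.

Lemma eigv_prod (V V' : lmodType k) (rho : 'M[F]_2 -> V -> V) (sig : 'M[F]_2 -> V' -> V')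
  chi x y : eigv v rho chi x -> eigv v sig chi y -> eigv v (prod_act rho sig) chi (x, y).
Proof.
move=> [h1 h2] [h3 h4]; split=> [g hg|a d a0 d0 e]; rewrite /prod_act /=.
  by rewrite h1 // h3.
by rewrite h2 // h4.
Qed.

Lemma pact_proj (V V' : lmodType k) (f : V -> V) (g : V' -> V') (pi : V -> V') P x :
  lin pi -> (forall z, pi (f z) = g (pi z)) -> pi (pact f P x) = pact g P (pi x).
Proof.
move=> lpi h; rewrite /pact (lin_sum lpi); apply: eq_bigr => i _.
by rewrite (linZ lpi); congr (_ *: _); elim: (i : nat) => //= n IH; rewrite h IH.
Qed.

Section Char.
Variable chi : F -> F -> k.
Hypothesis hchi : tchar v chi.

(* The function supported on P s U(o) in a principal series whose inducing character
   extends chi and takes the value 1 at diag(1, w). *)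
Definition fprin : W := fun h =>
  if [&& \det h != 0, h ord_max ord0 != 0 & inp 0 (h ord_max ord_max / h ord_max ord0)] then
    chi (h ord_max ord0 * w ^ (v (\det h) - (v (h ord_max ord0) + v (h ord_max ord0))))
      (- \det h / h ord_max ord0)
  else 0.

Lemma fprinE a b c d : fprin (mk a b c d) =
  if [&& a * d - b * c != 0, c != 0 & inp 0 (d / c)] then
    chi (c * w ^ (v (a * d - b * c) - (v c + v c))) (- (a * d - b * c) / c) else 0.
Proof. by rewrite /fprin det_mk !mkE. Qed.

(** The exponent of w in [fprin] is the one that equalizes the valuations of the two arguments,
    since only there is chi known to be multiplicative. *)
Lemma v_cw c D : c != 0 -> D != 0 -> v (c * w ^ (v D - (v c + v c))) = v (- D / c).
Proof.
move=> c0 D0; rewrite (vM hF) ?expfz_neq0 // (vw_expz hF w0 vw) (vf hF) ?oppr_eq0 //.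
by rewrite (vN hF); lia.
Qed.

Lemma fprin_neq0 : fprin != 0.
Proof.
apply/eqP => /(congr1 (fun f : W => f (sm F))); rewrite /= fprinE.
rewrite mul0r sub0r mulr1 oppr_eq0 oner_neq0 mul0r inp0 /= => /eqP; apply/negP.
case: hchi => _ _ h; apply: h; rewrite ?v_cw ?mulf_neq0 ?expfz_neq0 ?oppr_eq0 ?invr_eq0 ?oner_neq0 //.
Qed.

Lemma fprin_mul_Ih h i : Ih i -> \det h != 0 -> fprin (h *m i) = chiI chi i * fprin h.
Proof.
case: hchi => chiM chi1 chi0.
move: i; apply: mx_ind2 => a' b' c' d' hi; have Gi := Ih_inG hF hi.
move: h; apply: mx_ind2 => a b c d; rewrite det_mk => D0.
move: Gi; rewrite inG_mk => D0'; case: (IhP hF hi) => a0' d0' e hb hc.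
rewrite mk_mul !fprinE /chiI !mkE.
have -> : (a * a' + b * c') * (c * b' + d * d') - (a * b' + b * d') * (c * a' + d * c') =
  (a * d - b * c) * (a' * d' - b' * c') by ring.
rewrite mulf_neq0 // D0 /=.
have uad : vunit (d' / a') by rewrite (vunit_div hF).
have uda : vunit (a' / d') by rewrite (vunit_div hF).
have [hs|ns] := boolP ((c != 0) && inp 0 (d / c)).
  case/andP: hs => c0 hdc.
  pose x := d / c * (d' / a') * (c' / d').
  have hx : inp 1 x by rewrite (inpMl hF) // (inpMur hF).
  have ux := one_add_neq0 hF hx; have vx := v_one_add hF hx.
  pose y := - (b' / a' * (c' / d')).
  have hy : inp 1 y by rewrite (inpN hF) (inpMl hF).
  have uy := one_add_neq0 hF hy; have vy := v_one_add hF hy.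
  have ec : c * a' + d * c' = c * a' * (1 + x) by rewrite /x; field; rewrite c0 d0' a0'.
  have ed : a' * d' - b' * c' = a' * d' * (1 + y) by rewrite /y; field; rewrite d0' a0'.
  rewrite ec ed !mulf_neq0 //=.
  have -> : (c * b' + d * d') / (c * a' * (1 + x)) = (b' / a' + d / c * (d' / a')) / (1 + x).
    by field; rewrite ux c0 a0'.
  rewrite (inpMur hF) ?(vunitV hF) ?(vunitD hF) ?(vunit1 hF) //.
  have -> : inp 0 (b' / a' + d / c * (d' / a')) by apply: (inpD hF) => //; rewrite (inpMur hF).
  set D := a * d - b * c in D0 *.
  rewrite !(vM hF) ?mulf_neq0 // vx vy !addr0 -e.
  rewrite subr_double_addr.
  set n := v D - (v c + v c).
  have -> : c * a' * (1 + x) * w ^ n = (a' * (1 + x)) * (c * w ^ n) by ring.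
  have -> : - (D * (a' * d' * (1 + y))) / (c * a' * (1 + x)) = (d' * ((1 + y) / (1 + x))) * (- D / c).
    by field; rewrite ux c0 a0'.
  have u0 : (1 + y) / (1 + x) != 0 by rewrite mulf_neq0 ?invr_eq0.
  have v0 : v ((1 + y) / (1 + x)) = 0 by rewrite (vf hF) // vx vy.
  have vax : v (a' * (1 + x)) = v (d' * ((1 + y) / (1 + x))) by rewrite (vM hF a0' ux) (vM hF d0' u0) vx v0 e.
  rewrite (chiM _ _ _ _ _ _ vax _ _ (v_cw c0 D0)) ?mulf_neq0 ?expfz_neq0 ?oppr_eq0 ?invr_eq0 //.
  congr (_ * _); rewrite chiM ?vx ?v0 // [chi (1 + x) _]chi1 ?mulr1 //.
    by rewrite addrAC subrr add0r.
  have -> : (1 + y) / (1 + x) - 1 = (y - x) / (1 + x) by field.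
  by rewrite (inpMur hF) ?(vunitV hF) ?(vunitD hF) ?(vunit1 hF) // (inpB hF).
(* Off P s U(o) the bottom row has c/d in the maximal ideal, a condition preserved by right
   multiplication with [Ih]; so the product cannot enter the support. *)
rewrite mulr0; case: ifP => // /andP[c0' hdc']; exfalso; move: ns; rewrite negb_and negbK.
case/orP => [/eqP c0|nd].
  move: c0' hdc' D0; rewrite c0 mul0r mulr0 subr0 add0r => dc0 + /[!mulf_eq0] /norP[a0 d0].
  have c0' : c' != 0 by apply: contraNneq dc0 => ->; rewrite mulr0.
  have -> : (0 * b' + d * d') / (d * c') = (c' / d')^-1 by field; rewrite c0' d0 d0'.
  by rewrite (inp1_inv hF) // mulf_neq0 ?invr_eq0.
have [c0|c0] := eqVneq c 0; first by rewrite c0 invr0 mulr0 inp0 in nd.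
have d0 : d != 0 by apply: contraNneq nd => ->; rewrite mul0r inp0.
have hcd : inp 1 (c / d) by rewrite -[c / d]invrK invf_div (inp_invN hF) // mulf_neq0 ?invr_eq0.
pose y := c / d * (a' / d') * (b' / a').
have hy : inp 1 y by rewrite (inpMr hF) // (inpMur hF).
have uy := one_add_neq0 hF hy; have vy := v_one_add hF hy.
have ed : c * b' + d * d' = d * d' * (1 + y) by rewrite /y; field; rewrite d0 d0' a0'.
have nz : c * b' + d * d' != 0 by rewrite ed !mulf_neq0.
have : inp 1 ((c * a' + d * c') / (c * b' + d * d')).
  rewrite ed.
  have -> : (c * a' + d * c') / (d * d' * (1 + y)) = (c / d * (a' / d') + c' / d') / (1 + y).
    by field; rewrite uy d0 d0'.
  rewrite (inpMur hF) ?(vunitV hF) ?(vunitD hF) ?(vunit1 hF) //.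
  by rewrite (inpD hF) // (inpMur hF).
by move=> h; move: hdc'; rewrite -invf_div (inp1_inv hF) // mulf_neq0 ?invr_eq0.
Qed.

Lemma fprin_eigv : eigv v rtW chi fprin.
Proof.
case: (hchi) => _ chi1 _.
have out h : \det h = 0 -> fprin h = 0 by move=> e; rewrite /fprin e eqxx.
split=> [g hg|a d a0 d0 e]; apply: funext => h; rewrite /rt.
  have [e|D0] := eqVneq (\det h) 0; first by rewrite !out // det_mulmx e mul0r.
  rewrite fprin_mul_Ih //; last exact: (Gam_Ih hF).
  by case/and4P: hg => h1 h2 _ _; rewrite /chiI chi1 ?mul1r.
have [e'|D0] := eqVneq (\det h) 0.
  by rewrite scalrfctE !out ?scaler0 // det_mulmx e' mul0r.
rewrite fprin_mul_Ih //; last exact: (IhD hF).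
by rewrite /chiI !mkE.
Qed.

(** If d/c is integral, exactly one residue contributes, the class of - d/c; otherwise none does. In
    the surviving term the extra factor w is offset by the exponent, which drops by one. *)
Lemma fprin_N : NW fprin = fprin.
Proof.
apply: funext => h; rewrite NW_val; case: (hR) => _ uR iR cR.
have tE a b c d r : mk a b c d *m Um r *m tm = mk (a * w) (a * r + b) (c * w) (c * r + d).
  by rewrite !mk_mul; congr mk; ring.
move: h; apply: mx_ind2 => a b c d.
under eq_bigr do rewrite tE fprinE.
have E r : a * w * (c * r + d) - (a * r + b) * (c * w) = (a * d - b * c) * w by ring.
under eq_bigr do rewrite E !mulf_eq0 (negPf w0) !orbF.
rewrite fprinE; have [D0|D0] := eqVneq (a * d - b * c) 0; first by rewrite big1.
have [c0|c0] := eqVneq c 0; first by rewrite big1.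
rewrite /=; set D := a * d - b * c in D0 *.
have sup r : inp 0 ((c * r + d) / (c * w)) = inp 1 (- (d / c) - r).
  have -> : (c * r + d) / (c * w) = - (- (d / c) - r) / w by field; rewrite c0 w0.
  by rewrite (inpwV hF w0 vw) (inpN hF).
have val : chi (c * w * w ^ (v (D * w) - (v (c * w) + v (c * w)))) (- (D * w) / (c * w)) =
    chi (c * w ^ (v D - (v c + v c))) (- D / c).
  congr chi; last by field; rewrite c0 w0.
  rewrite !(vM hF) // vw -mulrA; congr (_ * _).
  rewrite -{1}(expr1z w) -expfzDr //; congr (_ ^ _); lia.
under eq_bigr do rewrite sup val.
case: ifP => hdc; last first.
  rewrite big_seq big1 // => r rR; case: ifP => // h; case/negP: hdc.
  by rewrite -(inpN hF) -(subrK r (- (d / c))) (inpD hF) ?(res_inp hR rR) // (inp1_0 h).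
have [|r0 r0R hr0] := cR (- (d / c)); first by rewrite (inpN hF).
rewrite (bigD1_seq r0) //= big1_seq ?addr0; first by rewrite ifT.
move=> r /andP[ne rR]; rewrite ifF //; apply: contraNF ne => h; apply/eqP; apply: iR => //.
by apply: (inp_trans hF (y := - (d / c))) => //; rewrite (inpBC hF).
Qed.
End Char.
End AuxiliaryFunction.

(** * Translates in the compact induction and the function [beta] *)

Section CompactInduction.
Variables (p : nat) (F : fieldType) (k : closedFieldType) (v : F -> int).
Hypothesis hF : nonarch_local_field p v.
Variable R : seq F.
Hypothesis hR : residues v R.
Variable w : F.
Hypotheses (w0 : w != 0) (vw : v w = 1).

Notation inp := (inp v).
Notation tm := (tm w).
Notation Pm := (Pm w).
Notation W := ('M[F]_2 -> k^o).
Notation rtW := (@rt F k^o).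
Notation NW := (Nop R w rtW).
Notation Ih := (Ih v).
Notation supp_o := (supp_o v w).
Let hrt := grep_rt F k.

Variable chi : F -> F -> k.
Hypothesis hchi : tchar v chi.

(** In the Iwasawa decomposition the torus part is t^n times an element with entries of equal
    valuation, and the latter acts by a scalar. So translates reduce to unipotent translates of t^n
    x and t^n Pm x. *)
Lemma span_disc (V : lmodType k) (rho : 'M[F]_2 -> V -> V) x g :
  grep rho -> eigv v rho chi x -> inG g -> exists c y (n : int) (b : bool),
  rho g x = c *: rho (Um y) (rho (Dm (w ^ n) 1) (if b then rho Pm x else x)).
Proof.
move=> hr hx hg; have [b hb e] := fixed_iwasawa hF w0 vw hr hg (proj1 hx).
have [a0 d0] := inP_diag hb.
set a := b ord0 ord0 in a0; set d := b ord_max ord_max in d0.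
have H x' chi' : eigv v rho chi' x' -> exists c y (n : int),
    rho b x' = c *: rho (Um y) (rho (Dm (w ^ n) 1) x').
  move=> [_ hx']; pose n := v a - v d; have wn := expfz_neq0 n w0.
  exists (chi' (a / w ^ n) d), (b ord0 ord_max / d), n.
  have GD : inG (Dm (w ^ n) 1) by apply: inGD; rewrite ?oner_neq0.
  rewrite {1}(inP_UD hb) (rM hr) //; last exact: inGD.
  rewrite -(linZ (rlin hr (inGU _))) -(linZ (rlin hr GD)) -/a -/d; congr (rho _ _).
  rewrite -hx' ?mulf_neq0 ?invr_eq0 //; last first.
    by rewrite (vf hF) // (vw_expz hF w0 vw) /n opprB addrC subrK.
  by rewrite (rDD hr) ?oner_neq0 ?mulf_neq0 ?invr_eq0 // mul1r mulrC divfK.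
case: e => ->.
  by have [c [y [n e]]] := H _ _ hx; exists c, y, n, false.
have [c [y [n e]]] := H _ _ (eigv_P hF w0 vw hr hx); by exists c, y, n, true.
Qed.

Lemma span_U_fixed (V : lmodType k) (rho : 'M[F]_2 -> V -> V) x z :
  grep rho -> eigv v rho chi x -> span (@inG F) rho x z ->
  exists M : nat, forall y, inp M%:Z y -> rho (Um y) z = z.
Proof.
move=> hr hx; elim=> [|a g u hg _ [M IH]].
  by exists 0%N => y _; rewrite (lin0 (rlin hr (inGU _))).
have [c [y [n [b ->]]]] := span_disc hr hx hg.
exists (maxn M `|n|%N) => t ht; have wn := expfz_neq0 n w0.
have nt : inp 0 (t / w ^ n).
  rewrite invr_expz (inpw hF w0 vw) opprK add0r; apply: inp_le ht; lia.
rewrite (linD (rlin hr (inGU _))) IH; last by apply: inp_le ht; lia.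
rewrite !(linZ (rlin hr (inGU _))) (rUU hr) [t + y]addrC -(rUU hr); congr (_ + _); congr (_ *: _); congr (_ *: _); congr (rho _ _).
rewrite (_ : t = w ^ n / 1 * (t / w ^ n)); last by rewrite divr1 mulrC divfK.
rewrite -(rDU hr) ?oner_neq0 //; congr (rho _ _).
case: b; last exact: (fixed_fixU (proj1 hx)).
exact: (fixed_fixU (fixed_P hF w0 vw hr (proj1 hx))).
Qed.

(** A high power of t makes every exponent nonnegative and every unipotent translation integral in
    the finitely many terms of z. *)
Lemma span_eps_supp z : span (@inG F) rtW (eps v chi) z ->
  exists m0 : nat, forall m : nat, (m0 <= m)%N -> supp_o (rtW (Dm (w ^+ m) 1) z).
Proof.
have [s0 sD sZ] := supp_o_subspace k v w.
elim=> [|a g u hg _ [m0 IH]]; first by exists 0%N => m _.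
have [c [y [n [b ->]]]] := span_disc hrt (eps_eigv hF hchi) hg.
exists (maxn m0 (maxn (absz n) (absz (v y)))) => m; rewrite !geq_max => /and3P[m1 m2 m3].
have wm := wX0 w0 m; have wn := expfz_neq0 n w0.
apply: sD; last exact: IH.
apply: (sZ a); apply: (sZ c) => h; rewrite /rt.
have [l el] : exists l : nat, n + m%:Z = l%:Z by exists (absz (n + m%:Z)); lia.
have wl := wX0 w0 l; have ewl : w ^ n * w ^+ m = w ^+ l by rewrite exprnP -expfzDr // el.
have hy : inp 0 (- (w ^+ m * y)).
  rewrite (inpN hF) mulrC (inpwX hF w0 vw).
  have [->|y0] := eqVneq y 0; first exact: inp0.
  by rewrite inpE //; lia.
have e1 : Dm (w ^+ m) 1 *m Um y *m Dm (w ^ n) 1 *m (tneg w l *m Um (- (w ^+ m * y))) = 1%:M.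
  rewrite !mk_mul mk1 -ewl; congr mk; field; rewrite ?wm ?wn //.
have {}e1 : h = h *m (Dm (w ^+ m) 1 *m Um y *m Dm (w ^ n) 1) *m tneg w l *m Um (- (w ^+ m * y)).
  by rewrite -!mulmxA [X in h *m X](_ : _ = 1%:M) ?mulmx1 // -e1 -!mulmxA.
have {}e1 : h = h *m Dm (w ^+ m) 1 *m Um y *m Dm (w ^ n) 1 *m tneg w l *m Um (- (w ^+ m * y)).
  by rewrite {1}e1 !mulmxA.
case: b; rewrite /eps; case: ifP => [hi _|_]; rewrite ?eqxx //.
  have wi : w^-1 != 0 by rewrite invr_eq0.
  exists (h *m Dm (w ^+ m) 1 *m Um y *m Dm (w ^ n) 1 *m Pm *m Dm w^-1 w^-1), l, (- (w ^+ m * y)).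
  split=> //; first exact: (IhZ hF hchi wi hi).2.
  right; rewrite {1}e1; move: (h *m _ *m _ *m Dm (w ^ n) 1) => Z.
  have e2 : Pm *m (Dm w^-1 w^-1 *m Pm) = 1%:M by rewrite !mk_mul mk1; congr mk; field.
  by rewrite (_ : Z *m Pm *m Dm w^-1 w^-1 *m Pm = Z) // -!mulmxA e2 mulmx1.
by exists (h *m Dm (w ^+ m) 1 *m Um y *m Dm (w ^ n) 1), l, (- (w ^+ m * y)); split=> //; left.
Qed.

Hypotheses (pp : prime p) (pk : p \in [pchar k]).

Notation eps' := (eps v (swap chi) : W).
(** By [NPN], N kills this combination. It gives an eigenvector for chi inside the compact induction
    of the swapped character that N annihilates, whereas powers of N on its translate by [Pm] remain
    linearly independent. *)
Definition beta : W := rtW Pm (NW eps') - hecke_const R w (swap chi) *: eps'.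

Lemma beta_N : NW beta = 0.
Proof.
have lN := lin_Nop R w0 hrt.
rewrite /beta (linB lN) (linZ lN) (NPN hF hR w0 vw hrt pp pk (chi := swap chi)) ?subrr //.
exact: (eps_eigv hF (tchar_swap hchi)).
Qed.

(** The two terms belong a priori to chi and to its swap. The second is present only if the Hecke
    constant is nonzero, and then [hecke_const_swap] identifies the two characters. *)
Lemma beta_eigv : eigv v rtW chi beta.
Proof.
have hs := tchar_swap hchi; have e' := eps_eigv hF hs.
apply: (subB (eigv_subspace hF hrt chi)).
  exact: (eigv_P hF w0 vw hrt (eigv_N hF hR w0 vw hrt e')).
have [->|nz] := eqVneq (hecke_const R w (swap chi)) 0.
  by rewrite scale0r; apply: (sub0 (eigv_subspace hF hrt chi)).
apply: (subZ (eigv_subspace hF hrt chi)); case: e' => h1 h2; split=> // a d a0 d0 e.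
by rewrite h2 // (hecke_const_swap hF hR hs nz).
Qed.

Lemma pact_beta P : pact NW P beta = P`_0 *: beta.
Proof.
have lN := lin_Nop R w0 hrt.
have it n : iter n.+1 NW beta = 0.
  by elim: n => [|n IH]; [exact: beta_N | rewrite iterS IH (lin0 lN)].
rewrite (pactE _ _ (leqnSn (size P))).
by rewrite big_ord_recl big1 ?addr0 // => i _; rewrite /= -iterS it scaler0.
Qed.

Lemma beta_tneg n : beta (Hn w false n.+1) = 0.
Proof.
have -> : beta (Hn w false n.+1) = NW eps' (tneg w n.+1 *m Pm) -
   hecke_const R w (swap chi) * eps' (Hn w false n.+1) by [].
rewrite (eps_Hn hF w0 vw (tchar_swap hchi)) mulr0 subr0 NW_val big1 // => r _.
have -> : tneg w n.+1 *m Pm *m Um r *m tm = mk 0 (w ^+ n.+1)^-1 (w * w) (w * r).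
  by rewrite !mk_mul; congr mk; ring.
by rewrite /eps /(Ih _) !mkE eqxx.
Qed.

(* Evaluate at t^-(n+1): [beta] and its images under N vanish there, and the coefficient of
   N^n (Pm beta) can be read off. *)
Lemma beta_relation (f1 f2 : {poly k}) :
  pact NW f1 beta + pact NW f2 (rtW Pm beta) = 0 -> f2 = 0.
Proof.
have lN := lin_Nop R w0 hrt; have lP := rlin hrt (inGPm w0).
have hs := tchar_swap hchi; have e' := eps_eigv hF hs.
have [E1 E2] := Eset_eps hF w0 vw hs.
rewrite pact_beta => h.
have Pb : rtW Pm beta = swap chi w w *: NW eps' - hecke_const R w (swap chi) *: rtW Pm eps'.
  rewrite /beta (linB lP) (linZ lP) (rPP w0 hrt).
  by rewrite (proj2 (eigv_N hF hR w0 vw hrt e')).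
have lf := lin_pact lN f2.
apply/polyP => n; rewrite coef0.
have := congr1 (fun f : W => f (Hn w false n.+1)) h.
have NE : pact NW f2 (NW eps') = NW (pact NW f2 eps').
  by rewrite (pact_commute _ lN) // => i; rewrite -iterSr.
rewrite Pb (linB lf) !(linZ lf) NE.
have -> (a c d : k) (x y z : W) g : (a *: x + (c *: y - d *: z)) g = a * x g + (c * y g - d * z g) by [].
rewrite beta_tneg mulr0 add0r (NW_valS hF hR w0 vw); last by case: (Eset_pact hF hR w0 vw f2 E1).
rewrite (pact_val hF hR w0 vw _ _ E1) => [|m]; last by rewrite (eps_Hn hF w0 vw hs).
rewrite (pact_val hF hR w0 vw _ _ E2) => [|m]; last by rewrite (Peps_Hn hF w0 vw).
rewrite (eps_Hn hF w0 vw hs) (Peps_Hn hF w0 vw) /= !mulr0 subr0 mulr1.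
move=> /eqP; rewrite mulf_eq0 => /orP[/eqP c0|/eqP//].
by case: hs => _ _ /(_ w w w0 w0 erefl); rewrite c0 eqxx.
Qed.
End CompactInduction.

(** * Polynomial relations for N in irreducible representations *)

Section HeckeTorsion.
Variables (p : nat) (F : fieldType) (k : closedFieldType) (v : F -> int).
Hypotheses (pp : prime p) (pk : p \in [pchar k]).
Hypothesis hF : nonarch_local_field p v.
Variable R : seq F.
Hypothesis hR : residues v R.
Variable w : F.
Hypotheses (w0 : w != 0) (vw : v w = 1).

Notation inp := (inp v).
Notation Pm := (Pm w).
Notation W := ('M[F]_2 -> k^o).
Notation rtW := (@rt F k^o).
Notation NW := (Nop R w rtW).
Let hrt := grep_rt F k.

Variables (V : lmodType k) (rho : 'M[F]_2 -> V -> V).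
Hypothesis hr : grep rho.
Hypothesis irr : forall x, x != 0 -> forall y, span (@inG F) rho x y.

(* Relations are tested simultaneously on x, on a principal series vector fixed by N, on
   [beta] and on [eps], by working in a direct sum. As V is irreducible, N x = r0 (N^2 x - N x)
   with r0 in the group algebra. Then r = N - r0 (N^2 - N) kills x and [beta], but not the
   principal series vector, so r does not kill [eps]. Moving r eps by a power of t and taking a
   vector fixed by the p-group U(o)/U(p^M) yields f1(N) eps + f2(N) Pm eps, not zero; [beta] forces
   f2 = 0, hence f1(N) x = 0. *)
Theorem hecke_torsion chi x : eigv v rho chi x -> x != 0 ->
  exists2 P : {poly k}, P != 0 & pact (Nop R w rho) P x = 0.
Proof.
move=> hx x0; have hchi := eigv_tchar hF hr hx x0.
pose be := beta v R w chi; pose fI := fprin v w chi; pose e := eps v chi : W.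
pose act1 := prod_act rho (prod_act rtW rtW); pose act := prod_act act1 rtW.
have h2 := grep_prod hrt hrt; have h1 : grep act1 := grep_prod hr h2.
have h0 : grep act := grep_prod h1 hrt.
pose X1 : V * (W * W) := (x, (fI, be)); pose X : V * (W * W) * W := (X1, e).
have hX1 : eigv v act1 chi X1.
  apply: eigv_prod => //; apply: eigv_prod; first exact: (fprin_eigv hF w0 vw hchi).
  exact: (beta_eigv hF hR w0 vw hchi).
have hX : eigv v act chi X by apply: eigv_prod => //; exact: (eps_eigv hF hchi).
have G1 := @inG1 F; have GM := @inGM F; have Gid (g : 'M[F]_2) : inG g -> inG g by [].
have subP (U : lmodType k) (sig : 'M[F]_2 -> U -> U) u : grep sig ->
    stable (@inP F) sig (span (@inG F) sig u).
  by move=> hs g y hg; apply: (span_stable Gid GM hs); exact: inP_inG.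
pose N := Nop R w rho; pose NA := Nop R w act.
have lN : lin N := lin_Nop R w0 hr; have lNA : lin NA := lin_Nop R w0 h0.
have lNW : lin NW := lin_Nop R w0 hrt.
have NAE z : NA z = ((N z.1.1, (NW z.1.2.1, NW z.1.2.2)), NW z.2).
  by rewrite /NA /act Nop_prod /act1 Nop_prod Nop_prod.
pose y1 := N (N x) - N x.
have [y10|y1n] := eqVneq y1 0.
  exists ('X^1 * ('X - 1%:P)); first by rewrite mulf_neq0 ?polyXsubC_eq0 ?monic_neq0 ?monicXn.
  by rewrite (pactXC lN) pactXn scale1r.
pose Z := NA X; pose U := NA Z - Z.
(* Irreducibility provides r0 with N x = r0 y1; [Z'] and [Z''] are the results of the same r0 on the
   other components of [U]. *)
have [Z' hZ'] := span_prod_lift (prod_act rtW rtW) U.1.2 (irr y1n (N x)).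
have {hZ'} [Z'' hZ] := span_prod_lift rtW U.2 hZ'.
have UE : U = ((y1, U.1.2), U.2).
  by rewrite /U /Z !NAE.
rewrite -/act1 -/act -UE in hZ.
(* This is r X for r = N - r0 (N^2 - N). *)
pose D := Z - ((N x, Z'), Z'').
have SX := span_subspace (@inG F) act X.
have spN u : span (@inG F) act X u -> span (@inG F) act X (NA u).
  by apply: (sub_N R w0 SX); apply: subP.
have spZ : span (@inG F) act X Z by apply: spN; exact: (span_self G1 h0).
have spU : span (@inG F) act X U by apply: (subB SX) => //; apply: spN.
have spD : span (@inG F) act X D.
  apply: (subB SX) => //; apply: (span_min SX _ spU) hZ.
  exact: (span_stable Gid GM h0).
have D1 : D.1.1 = 0 by rewrite /D /Z NAE /= subrr.
have zero2 (u : W * W) : U.1.2 = 0 -> span (@inG F) (prod_act rtW rtW) U.1.2 u -> u = 0.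
  by move=> -> /(span_zero Gid h2).
(* N fixes [fI] and kills [be], so N^2 - N vanishes on both components and r0 is applied to 0. *)
have hZ' : Z' = 0.
  apply: zero2; last exact: (span_prod_snd (span_prod_fst hZ)).
  rewrite /U /Z !NAE /=; apply: injective_projections => /=.
    by rewrite /fI !(fprin_N hF hR w0 vw) subrr.
  by rewrite (beta_N hF hR w0 vw hchi pp pk) (lin0 lNW) subrr.
have D12 : D.1.2 = (fI, 0).
  rewrite /D /Z NAE hZ' /= subr0 /fI (fprin_N hF hR w0 vw).
  by rewrite (beta_N hF hR w0 vw hchi pp pk).
have univ := eps_universal hF hchi h1 hX1.
have D2 : D.2 != 0.
  apply/eqP => /(univ _ spD) => e1; have := D12; rewrite e1 => /(congr1 fst) /= /esym/eqP.
  exact/negP/(fprin_neq0 hF w0 vw hchi).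
have [m hm] := span_eps_supp hF w0 vw hchi (span_prod_snd spD).
have {hm} hm := hm m (leqnn m).
set Tm := Dm (w ^+ m) 1 in hm.
have GT : inG Tm by apply: inGD; rewrite ?expf_neq0 ?oner_neq0.
have spY : span (@inG F) act X (act Tm D) by apply: (span_stable Gid GM h0).
have [M hM] := span_U_fixed hF w0 vw h0 hX spY.
(* The principal series component has served to make [D] nonzero on [eps] and is now left free; the
   components of x and [be] must stay zero. *)
pose S1 (u : V * (W * W) * W) := [/\ span (@inG F) act X u, u.1.1 = 0, u.1.2.2 = 0,
  supp_o v w u.2 & forall t, inp M%:Z t -> act (Um t) u = u].
have [so0 soD soZ] := supp_o_subspace k v w.
have hS1 : subspace S1.
  split; first by split=> //; [exact: sub0 | move=> t _; exact: (lin0 (rlin h0 (inGU _)))].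
    move=> u z [u1 u2 u3 u4 u5] [z1 z2 z3 z4 z5]; split; first exact: subD.
    - by rewrite /= u2 z2 addr0.
    - by rewrite /= u3 z3 addr0.
    - exact: soD.
    - by move=> t ht; rewrite (linD (rlin h0 (inGU _))) u5 ?z5.
  move=> a u [u1 u2 u3 u4 u5]; split; first exact: subZ.
  - by rewrite /= u2 scaler0.
  - by rewrite /= u3 scaler0.
  - exact: soZ.
  - by move=> t ht; rewrite (linZ (rlin h0 (inGU _))) u5.
pose f r u := if inp 0 r then act (Um r) u else u.
have [l [l1 l2]] := reps_ex hF hR w0 vw M.
have [|||||y [y1' y2 y3 y4 y5] [yn yf]] := @common_fixed_vector _ _ p _ l f S1 pk hS1.
- exists (act Tm D).
    split=> //; first by rewrite -[LHS]/(rho Tm D.1.1) D1 (lin0 (rlin hr GT)).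
    by rewrite -[LHS]/(rtW Tm D.1.2.2) D12 (lin0 (rlin hrt GT)).
  by apply: contra_neq D2 => /(rho_eq0 h0 GT) ->.
- by move=> r c x' y'; rewrite /f; case: ifP => [_|_ //]; exact: (rlin h0 (inGU r)).
- move=> r u [u1 u2 u3 u4 u5]; rewrite /f; case: ifP => [hr0|_]; last by split.
  split.
  + exact: (span_stable Gid GM h0).
  + by rewrite /= u2 (lin0 (rlin hr (inGU _))).
  + by rewrite /= u3 (lin0 (rlin hrt (inGU _))).
  + exact: (supp_o_U hF).
  + by move=> t ht; rewrite (rUU h0) addrC -(rUU h0) u5.
- move=> r s u _; rewrite /f; case: ifP => [_|_]; case: ifP => [_|_] //.
  by rewrite !(rUU h0) addrC.
- move=> r; exists M => u [_ _ _ _ u5]; case E: (inp 0 r); last first.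
    by elim: (p ^ M)%N => //= j ->; rewrite /f E.
  have /eq_iter -> : f r =1 act (Um r) by move=> u'; rewrite /f E.
  have it j z : iter j (act (Um r)) z = act (Um (r *+ j)) z.
    elim: j => [|j IH] /=; first by rewrite mulr0n Um0 (r1 h0).
    by rewrite IH (rUU h0) mulrS.
  rewrite it; apply: u5; rewrite -mulr_natl natrX (inpMr hF) //; exact: (inp_pX hF).
have yU t : inp 0 t -> act (Um t) y = y.
  move=> ht; have [r rl htr] := l2 t ht; rewrite -(subrK r t) -(rUU h0).
  by have := yf r rl; rewrite /f l1 // => ->; apply: y5.
have y2n : y.2 != 0.
  apply: contra_neq yn => e2; have e1 := univ _ y1' e2.
  by rewrite [y]surjective_pairing e1 e2.
have sp2 := span_prod_snd y1'.
have E2 : Eset v w chi y.2.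
  split=> //; first by move=> i h hi; apply: (span_eps_left hF hchi).
  by move=> t ht; have := congr1 snd (yU t ht).
have [B hB] := span_eps_bounded hF w0 vw sp2.
have c0 : chi w w != 0 by case: hchi => _ _; apply.
(* The coefficients are the values at the points [Hn], normalized by the value 1 of [eps] at 1 and
   the value chi(w, w) of its translate at [Pm]. *)
pose f1 : {poly k} := \poly_(n < B) y.2 (Hn w false n); pose f2 : {poly k} := \poly_(n < B) (y.2 (Hn w true n) / chi w w).
pose L := pact NA f1 X + pact NA f2 (act Pm X).
have GP := inGPm w0.
have spL : span (@inG F) act X L.
  apply: (subD SX); apply: (pact_sub SX) => //; first exact: (span_self G1 h0).
  exact: span_act.
have l11 : lin (fun u : V * (W * W) * W => u.1.1) by [].
have l122 : lin (fun u : V * (W * W) * W => u.1.2.2) by [].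
have l2' : lin (fun u : V * (W * W) * W => u.2) by [].
have N11 z : (NA z).1.1 = N z.1.1 by rewrite NAE.
have N122 z : (NA z).1.2.2 = NW z.1.2.2 by rewrite NAE.
have N2 z : (NA z).2 = NW z.2 by rewrite NAE.
have [Ee EP] := Eset_eps hF w0 vw hchi.
have D'2 : (y - L).2 = 0.
  have -> : (y - L).2 = y.2 - (pact NW f1 e + pact NW f2 (rtW Pm e)).
    by rewrite /= (pact_proj _ _ l2' N2) (pact_proj _ _ l2' N2).
  apply: (@Eset_zero _ _ v w chi).
  - have sE := Eset_subspace v w chi.
    apply: (subB sE) => //; apply: (subD sE); exact: (Eset_pact hF hR w0 vw).
  - move=> n; have -> (a b c : W) h : (a - (b + c)) h = a h - (b h + c h) by [].
    rewrite (pact_val hF hR w0 vw (b := false) _ _ Ee) => [|j]; last by rewrite (eps_Hn hF w0 vw hchi).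
    rewrite (pact_val hF hR w0 vw (b := false) _ _ EP) => [|j]; last by rewrite (Peps_Hn hF w0 vw).
    rewrite (eps_Hn hF w0 vw hchi) (Peps_Hn hF w0 vw) /= mulr0 addr0 mulr1 coef_poly.
    by case: ltnP => nB; rewrite ?subrr // subr0; apply: (hB false).
  - move=> n; have -> (a b c : W) h : (a - (b + c)) h = a h - (b h + c h) by [].
    rewrite (pact_val hF hR w0 vw (b := true) _ _ Ee) => [|j]; last by rewrite (eps_Hn hF w0 vw hchi).
    rewrite (pact_val hF hR w0 vw (b := true) _ _ EP) => [|j]; last by rewrite (Peps_Hn hF w0 vw).
    rewrite (eps_Hn hF w0 vw hchi) (Peps_Hn hF w0 vw) /= mulr0 add0r coef_poly.
    by case: ltnP => nB; rewrite ?divfK // ?subrr // mul0r subr0; apply: (hB true).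
(* Agreement on [eps] implies agreement on all other components: the one on [be] gives the relation
   for [beta_relation], the one on x the relation sought. *)
have D'1 := univ _ (subB SX y1' spL) D'2.
have F2 : f2 = 0.
  apply: (beta_relation hF hR w0 vw hchi pp pk (f1 := f1)).
  have := congr1 (fun u => u.2.2) D'1; rewrite /= y3 sub0r => /eqP; rewrite oppr_eq0 => /eqP.
  by rewrite (pact_proj _ _ l122 N122) (pact_proj _ _ l122 N122).
exists f1.
  apply: contra_neq y2n => e1; move: D'2; rewrite /L e1 F2 /= /pact size_poly0 !big_ord0 /=.
  by rewrite addr0 subr0.
have := congr1 (fun u => u.1) D'1; rewrite /= y2 sub0r => /eqP; rewrite oppr_eq0 => /eqP.
rewrite (pact_proj _ _ l11 N11) (pact_proj _ _ l11 N11) F2.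
by rewrite [X in _ + X](_ : _ = 0) ?addr0 // /pact size_poly0 big_ord0.
Qed.
End HeckeTorsion.

(** * Irreducibility of the functions vanishing at 1 *)

Section PrincipalSeries.
Variables (p : nat) (F : fieldType) (k : closedFieldType) (v : F -> int).
Hypothesis hF : nonarch_local_field p v.

Notation inp := (inp v).
Notation vunit := (vunit v).
Notation W := ('M[F]_2 -> k^o).
Notation rtW := (@rt F k^o).
Let hrt := grep_rt F k.

Lemma entries_bound (g : 'M[F]_2) : exists C : nat, forall i j, inp (- C%:Z) (g i j).
Proof.
move: g; apply: mx_ind2 => a b c d.
exists (absz (v a) + absz (v b) + absz (v c) + absz (v d))%N => i j.
by case: (ord2P i) => ->; case: (ord2P j) => ->; rewrite mkE; apply/orP; right; lia.
Qed.

(** The entries of g and of its inverse have denominators bounded by w^C and w^C', which costs C +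
    C' levels. *)
Lemma conj_congr (g : 'M[F]_2) n : inG g -> exists m, (n <= m)%N /\
  forall g', congr_sub v m g' -> congr_sub v n (invmx g *m g' *m g).
Proof.
move=> hg; have [_ i1 i2] := inG_invmx hg.
have [C hC] := entries_bound g; have [C' hC'] := entries_bound (invmx g).
exists (n + C + C')%N; split; first by lia.
move=> g' hg' i j; apply/inpnP.
have sub (X Y : 'M[F]_2) s t : (X - Y) s t = X s t - Y s t by rewrite !mxE.
have -> : (invmx g *m g' *m g) i j - (1%:M : 'M[F]_2) i j =
    (invmx g *m (g' - 1%:M) *m g) i j.
  by rewrite mulmxBr mulmxBl mulmx1 i1 sub.
rewrite mxE; apply: (inp_sum hF) => l _; rewrite mxE mulr_suml; apply: (inp_sum hF) => l' _.
have /inpnP h := hg' l' l.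
have := inpM hF (inpM hF (hC' i l') h) (hC l j); rewrite -sub.
apply: inp_le; lia.
Qed.

Section Char.
Variable chi : F -> F -> k.
Hypothesis hchi : smooth_charT v chi.

Lemma chi_neq0 a d : a != 0 -> d != 0 -> chi a d != 0.
Proof. by case: hchi => h _ _; apply: h. Qed.
Lemma chi_mul a d a' d' : a != 0 -> d != 0 -> a' != 0 -> d' != 0 ->
  chi (a * a') (d * d') = chi a d * chi a' d'.
Proof. by case: hchi => _ h _; apply: h. Qed.
Lemma chi_one : chi 1 1 = 1.
Proof.
have o0 := oner_neq0 F; have := chi_mul o0 o0 o0 o0; rewrite !mulr1 => e.
by apply: (mulIf (chi_neq0 o0 o0)); rewrite mul1r -e.
Qed.

Lemma congr_sub_le m n g : (n <= m)%N -> congr_sub v m g -> congr_sub v n g.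
Proof.
move=> nm h i j; apply/inpnP; have /inpnP h' := h i j; apply: inp_le h'; lia.
Qed.

Lemma congr_inG n g : (0 < n)%N -> congr_sub v n g -> inG g.
Proof.
move=> n0 h; apply: (@GamG _ _ _ hF 0 1) => //.
have := congr_sub_le n0 h; rewrite {1}(mk_eta g) => /(congr_sub_mk) /and4P[h1 h2 h3 h4].
by rewrite /Gam h1 h4 h3 (inp1_0 h2).
Qed.

Lemma inInd_subspace : subspace (inInd v chi : W -> Prop).
Proof.
split.
- split=> // [b h _ _|h _]; first by rewrite mulr0.
  by exists 1%N.
- move=> f g [f1 f2 f3] [g1 g2 g3]; split=> [h nh|b h hb hh|h hh].
  + by rewrite addrfctE f1 // g1 // addr0.
  + by rewrite !addrfctE f2 // g2 // mulrDr.
  + have [n [n0 hn]] := f3 h hh; have [m [m0 hm]] := g3 h hh.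
    exists (maxn n m); split; first by rewrite leq_max n0.
    move=> x hx; rewrite !addrfctE hn ?hm //; apply: congr_sub_le hx; rewrite leq_max leqnn ?orbT //.
- move=> a f [f1 f2 f3]; split=> [h nh|b h hb hh|h hh].
  + by rewrite scalrfctE f1 // scaler0.
  + by rewrite !scalrfctE f2 // /GRing.scale /= mulrCA.
  + have [n [n0 hn]] := f3 h hh; exists n; split=> // x hx.
    by rewrite !scalrfctE hn.
Qed.

Lemma inG_mulr (g h : 'M[F]_2) : inG g -> inG (h *m g) -> inG h.
Proof. by rewrite /inG det_mulmx mulf_eq0 negb_or => _ /andP[]. Qed.

Lemma inInd_rt g f : inG g -> inInd v chi f -> inInd v chi (rt g f).
Proof.
move=> hg [f1 f2 f3]; split=> [h nh|b h hb hh|h hh]; rewrite /rt.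
- by apply: f1 => h'; apply: nh; apply: inG_mulr h'.
- by rewrite -mulmxA f2 //; apply: inGM.
have [n [n0 hn]] := f3 _ (inGM hh hg); have [m [nm hm]] := conj_congr n hg.
exists m; split; first exact: leq_trans nm.
move=> x hx; rewrite -(hn _ (hm _ hx)); congr f.
by have [_ _ i2] := inG_invmx hg; rewrite -!mulmxA [g *m _]mulmxA i2 mul1mx.
Qed.

(** The restriction of f to the open cell, as a function on F; P acts on it by affine substitutions
    of x, up to scalars. *)
Definition gf (f : 'M[F]_2 -> k) (x : F) : k := f (sm F *m Um x).

Lemma bruhat a b c d : c != 0 ->
  mk a b c d = mk (- (a * d - b * c) / c) a 0 c *m (sm F *m Um (d / c)).
Proof. by move=> c0; rewrite !mk_mul; congr mk; field. Qed.

Lemma inGsU x : inG (sm F *m Um x). Proof. by apply: inGM => //; apply: inGs. Qed.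

Lemma gf_bruhat f a b c d : inInd v chi f -> c != 0 -> a * d - b * c != 0 ->
  f (mk a b c d) = chi (- (a * d - b * c) / c) c * gf f (d / c).
Proof.
move=> [_ f2 _] c0 D0; rewrite (bruhat _ _ _ c0) f2 ?mkE //; last exact: inGsU.
by apply: inP_mk; rewrite // mulf_neq0 ?oppr_eq0 ?invr_eq0.
Qed.

Lemma inInd_ext f f' : inInd v chi f -> inInd v chi f' -> f 1%:M = f' 1%:M ->
  (forall x, gf f x = gf f' x) -> f = f'.
Proof.
move=> hf hf' e1 e2; apply: funext; apply: mx_ind2 => a b c d.
have [D0|D0] := eqVneq (a * d - b * c) 0.
  have nG : ~ inG (mk a b c d) by rewrite inG_mk D0 eqxx.
  by case: hf hf' => h _ _ [h' _ _]; rewrite h // h'.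
have [c0|c0] := eqVneq c 0; last by rewrite !gf_bruhat // e2.
have hP : inP (mk a b c d) by split; rewrite ?mkE // inG_mk.
case: hf hf' => _ h _ [_ h' _]; rewrite -[mk a b c d]mulmx1.
by rewrite (h _ _ hP (@inG1 F)) (h' _ _ hP (@inG1 F)) e1.
Qed.

(** For large x, s u(x) is an element of P times the lower unipotent with entry 1/x, which is close
    to 1. Vanishing at 1 thus becomes compact support in x. *)
Lemma gf_bounded f : inInd v chi f -> f 1%:M = 0 ->
  exists m : nat, forall x, ~~ inp (- m%:Z) x -> gf f x = 0.
Proof.
move=> hf f0; have [_ h2 /(_ _ (@inG1 F)) [n [n0 hn]]] := hf.
exists n => x nx; have x0 : x != 0 by apply: contraNneq nx => ->; apply: inp0.
have -> : gf f x = f (mk (- x^-1) 1 0 x *m Lm x^-1).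
  by rewrite /gf !mk_mul; congr (f _); congr mk; field.
rewrite h2 ?mkE //; last by apply: inP_mk; rewrite // oppr_eq0 invr_eq0.
rewrite -[Lm _]mul1mx hn ?f0 ?mulr0 //; apply/congr_sub_mk; rewrite subrr !inp0 /=.
by move: nx; rewrite andbT !inpE ?invr_eq0 // (vV hF) //; lia.
Qed.

Lemma gf_locconst f x : inInd v chi f ->
  exists2 n : nat, (0 < n)%N & forall y, inp n%:Z y -> gf f (x + y) = gf f x.
Proof.
move=> [_ _ /(_ _ (inGsU x)) [n [n0 hn]]]; exists n => // y hy.
rewrite /gf -UmD mulmxA hn //; apply/congr_sub_mk.
by rewrite subrr !inp0 hy.
Qed.

Variable R : seq F.
Hypothesis hR : residues v R.
(** The uniformizer turns local constancy on the ring of integers into uniform local constancy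
    through [disc_induction]. *)
Variable w : F.
Hypotheses (w0 : w != 0) (vw : v w = 1).

Lemma gf_level f : inInd v chi f -> (forall x, ~~ inp 0 x -> gf f x = 0) ->
  exists n : nat, forall x y, inp n%:Z y -> gf f (x + y) = gf f x.
Proof.
move=> hf hs; pose Pd x n := exists N : nat, forall z y, inp n%:Z (z - x) -> inp N%:Z y ->
  gf f (z + y) = gf f z.
have [N hN] : Pd 0 0%N.
  apply: (disc_induction hF hR w0 vw (Pd := Pd)) => [x hx|x n hx hh].
    have [n n0 hn] := gf_locconst x hf; exists n => y _ hyx; exists n => z t hz ht.
    have hzx := inp_trans hF hz hyx.
    rewrite -[in RHS](subrKC x z) hn // -(hn _ (inpD hF hzx ht)); congr gf; ring.
  have {hh} : exists N : nat, forall r, r \in 0 :: R -> forall z y,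
      inp n.+1%:Z (z - (x + r * w ^+ n)) -> inp N%:Z y -> gf f (z + y) = gf f z.
    elim: (0 :: R) hh => [|r l IH] hh; first by exists 0%N.
    have [|N hN] := IH; first by move=> s sl; apply: hh; rewrite inE sl orbT.
    have [M hM] := hh r (mem_head _ _); exists (maxn N M) => s.
    rewrite inE => /orP[/eqP-> z y hz hy|sl z y hz hy].
      by apply: hM => //; apply: inp_le hy; lia.
    by apply: (hN s) => //; apply: inp_le hy; lia.
  case=> N hN; exists N => z y hz hy; case: hR => _ _ _ cR.
  have [|r rR hr] := cR ((z - x) * w ^ (- n%:Z)).
    by rewrite (inpw hF w0 vw) sub0r opprK.
  apply: (hN r) => //.
  have -> : z - (x + r * w ^+ n) = ((z - x) * w ^ (- n%:Z) - r) * w ^+ n.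
    by rewrite mulrBl -mulrA -exprnN mulVf ?expf_neq0 // mulr1 opprD addrA.
  by rewrite (inpwX hF w0 vw); apply: inp_le hr; lia.
exists N => x y hy; have [hx|nx] := boolP (inp 0 x); first by apply: hN => //; rewrite subr0.
rewrite !hs // -[x](addrK y); apply: contra nx => h; rewrite -[x](addrK y) (inpB hF) //.
  by rewrite addrK in h.
by apply: inp_le hy.
Qed.

Lemma gf_U y f x : gf (rt (Um y) f) x = gf f (x + y).
Proof. by rewrite /gf /rt -mulmxA UmD. Qed.

Lemma gf_D a f x : inInd v chi f -> a != 0 -> gf (rt (Dm a 1) f) x = chi 1 a * gf f (x / a).
Proof.
move=> hf a0; have o0 := oner_neq0 F.
have -> : gf (rt (Dm a 1) f) x = f (mk 0 1 a x).
  by rewrite /gf /rt !mk_mul; congr (f _); congr mk; ring.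
rewrite gf_bruhat //; last by rewrite mul0r sub0r mul1r oppr_eq0.
by congr (chi _ _ * _); field.
Qed.

(* The function of Ind supported on P s U(o) and equal to 1 on s U(o). *)
Definition cellfun : W := fun h =>
  if [&& \det h != 0, h ord_max ord0 != 0 & inp 0 (h ord_max ord_max / h ord_max ord0)] then
    chi (- \det h / h ord_max ord0) (h ord_max ord0) else 0.

Lemma cellfunE a b c d : cellfun (mk a b c d) =
  if [&& a * d - b * c != 0, c != 0 & inp 0 (d / c)] then chi (- (a * d - b * c) / c) c else 0.
Proof. by rewrite /cellfun det_mk !mkE. Qed.

Lemma cellfun_one : cellfun 1%:M = 0.
Proof. by rewrite mk1 cellfunE eqxx andbF. Qed.

Lemma cellfun_Ind : inInd v chi cellfun.
Proof.
case: hchi => chi0 chiM [n [n0 chi1]]; split.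
- move=> h; rewrite /inG /cellfun; case: eqP => [_ _ //|_ []//].
- move=> b h hb hh; have [a0 d0] := inP_diag hb; move: (hb) hh => [Gb b0]; move: b Gb b0 a0 d0 hb.
  apply: mx_ind2 => a b c d Gb; rewrite !mkE => c0 a0 d0 hb; move: h; apply: mx_ind2 => a' b' c' d'.
  rewrite inG_mk => D0; rewrite c0 mk_mul !cellfunE !mul0r !add0r.
  have -> : (a * a' + b * c') * (d * d') - (a * b' + b * d') * (d * c') = a * d * (a' * d' - b' * c') by ring.
  rewrite (mulf_neq0 (mulf_neq0 a0 d0) D0) D0 mulf_eq0 (negPf d0) /=.
  have [c0'|c0'] := eqVneq c' 0; first by rewrite mulr0.
  have -> : d * d' / (d * c') = d' / c' by field; rewrite d0 c0'.
  case: ifP => _; last by rewrite mulr0.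
  rewrite -chiM ?mulf_neq0 ?oppr_eq0 ?invr_eq0 //; congr chi; by field; rewrite d0 c0'.
move=> h hh; exists n; split=> // g hg.
have Gg := congr_inG n0 hg; move: h hh; apply: mx_ind2 => a b c d; rewrite inG_mk => D0.
move: g hg Gg; apply: mx_ind2 => a' b' c' d' /congr_sub_mk /and4P[ha hb hc hd]; rewrite inG_mk => D0'.
have n1 : 1 <= n%:Z by rewrite lez_nat.
have n0' : 0 <= n%:Z by [].
rewrite mk_mul !cellfunE.
have -> : (a * a' + b * c') * (c * b' + d * d') - (a * b' + b * d') * (c * a' + d * c') =
  (a * d - b * c) * (a' * d' - b' * c') by ring.
rewrite mulf_neq0 // D0 /=; set D := a * d - b * c in D0 *; set D' := a' * d' - b' * c' in D0' *.
have hD' : inp n%:Z (D' - 1).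
  have -> : D' - 1 = (a' * d' - 1) - b' * c' by rewrite /D'; ring.
  apply: (inpB hF); first by rewrite (one_mul hF).
  by rewrite (inpMr hF) //; exact: inp_le n0' hc.
have [hs|ns] := boolP ((c != 0) && inp 0 (d / c)).
  case/andP: hs => c0 hdc; pose u := a' + d / c * c'.
  have hu : inp n%:Z (u - 1) by rewrite /u addrAC (inpD hF) // (inpMl hF).
  have uu : vunit u by rewrite (one_vunit hF) //; exact: inp_le n1 hu.
  have u0 := vunit_neq0 uu.
  have ec : c * a' + d * c' = c * u by rewrite /u; field.
  rewrite ec mulf_neq0 //=.
  have -> : (c * b' + d * d') / (c * u) = (b' + d / c * d') / u by field; rewrite c0 u0.
  rewrite (inpMur hF) ?(vunitV hF) //.
  have -> : inp 0 (b' + d / c * d').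
    apply: (inpD hF); first exact: inp_le n0' hb.
    rewrite (inpMr hF) //; apply: vunit_inp; rewrite (one_vunit hF) //; exact: inp_le n1 hd.
  have -> : - (D * D') / (c * u) = (- D / c) * (D' / u) by field; rewrite c0 u0.
  rewrite chiM ?mulf_neq0 ?oppr_eq0 ?invr_eq0 //.
  by rewrite [chi (D' / u) u]chi1 ?mulr1 //; apply/inpnP; rewrite ?(one_mul hF) ?(one_inv hF).
(* Off the support c/d lies in the maximal ideal, and right multiplication by a congruence subgroup
   preserves this. *)
case: ifP => // /andP[c0' hdc']; exfalso.
have [hcd d0] : inp 1 (c / d) /\ d != 0.
  move: ns; have [e|c0] := eqVneq c 0 => /= ns.
    by rewrite e mul0r inp0; split=> //; apply: contraNneq D0 => d0; rewrite /D e d0 !mulr0 subrr.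
  have d0 : d != 0 by apply: contraNneq ns => ->; rewrite mul0r inp0.
  by split=> //; rewrite -[c / d]invrK invf_div (inp_invN hF) // mulf_neq0 ?invr_eq0.
pose u := d' + c / d * b'.
have hb0 := inp_le n0' hb.
have uu : vunit u.
  have ud : vunit d' by rewrite (one_vunit hF) //; exact: inp_le n1 hd.
  by rewrite /u (vunitD hF) // (inpMr hF).
have u0 := vunit_neq0 uu; have ed : c * b' + d * d' = d * u by rewrite /u; field.
have ua : vunit a' by rewrite (one_vunit hF) //; exact: inp_le n1 ha.
have h1 : inp 1 ((c * a' + d * c') / (c * b' + d * d')).
  rewrite ed; have -> : (c * a' + d * c') / (d * u) = (c / d * a' + c') / u by field; rewrite d0 u0.
  by rewrite (inpMur hF) ?(vunitV hF) //; apply: (inpD hF); [rewrite (inpMur hF) | exact: inp_le n1 hc].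
by move: hdc'; rewrite -invf_div (inp1_inv hF) // mulf_neq0 ?invr_eq0 // ed mulf_neq0.
Qed.

Lemma cellfun_gf x : gf cellfun x = if inp 0 x then 1 else 0.
Proof.
have e : sm F *m Um x = mk 0 1 1 x by rewrite mk_mul; congr mk; ring.
rewrite /gf e cellfunE mul0r mul1r sub0r oppr_eq0 oner_neq0 /= !divr1 opprK.
by rewrite chi_one.
Qed.
End Char.

Lemma inInd_mul chi (f g : 'M[F]_2 -> k) : inInd v chi f -> inInd v (chi1 F k) g ->
  inInd v chi (fun h => g h * f h).
Proof.
move=> [f1 f2 f3] [g1 g2 g3]; split=> [h nh|b h hb hh|h hh].
- by rewrite f1 // mulr0.
- by rewrite f2 // g2 // /chi1 mul1r mulrCA.
have [n [n0 hn]] := f3 h hh; have [m [m0 hm]] := g3 h hh.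
exists (maxn n m); split; first by rewrite leq_max n0.
by move=> x hx; rewrite hn ?hm //; apply: congr_sub_le hx; rewrite leq_max leqnn ?orbT.
Qed.

Lemma smooth_chi1 : smooth_charT v (chi1 F k).
Proof.
split; rewrite /chi1 => *; rewrite ?oner_neq0 ?mulr1 //; by exists 1%N.
Qed.

Section Irreducible.
Variable chi : F -> F -> k.
Hypothesis hchi : smooth_charT v chi.
Notation cell := (cellfun chi).

Definition kap (f : W) : Prop := inInd v chi f /\ f 1%:M = 0.

Lemma kap_subspace : subspace kap.
Proof.
have [s0 sD sZ] := inInd_subspace chi; split=> [|f g [hf f0] [hg g0]|a f [hf f0]].
- by split.
- by split; [exact: sD | rewrite addrfctE f0 g0 addr0].
- by split; [exact: sZ | rewrite scalrfctE f0 scaler0].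
Qed.

Lemma rt_P_one b f : inP b -> inInd v chi f ->
  rt b f 1%:M = chi (b ord0 ord0) (b ord_max ord_max) * f 1%:M.
Proof. by move=> hb [_ h _]; rewrite /rt mul1mx -[b in LHS]mulmx1 h //; apply: inG1. Qed.

Lemma kap_rt b f : inP b -> kap f -> kap (rtW b f).
Proof.
move=> hb [hf f0]; split; first exact: (inInd_rt (inP_inG hb)).
by rewrite rt_P_one // f0 mulr0.
Qed.

Lemma kap_ext f g : kap f -> kap g -> (forall x, gf f x = gf g x) -> f = g.
Proof. by move=> [hf f0] [hg g0]; apply: (inInd_ext hf hg); rewrite f0 g0. Qed.

Lemma kap_cellfun : kap cell.
Proof. by split; [exact: cellfun_Ind | exact: cellfun_one]. Qed.

Lemma inPDw a : a != 0 -> inP (Dm a 1 : 'M[F]_2).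
Proof. by move=> a0; apply: inPD; rewrite ?oner_neq0. Qed.

Hypotheses (pk : p \in [pchar k]).
Variable R : seq F.
Hypothesis hR : residues v R.
Variable w : F.
Hypotheses (w0 : w != 0) (vw : v w = 1).

(** On the open cell these are the locally constant functions of compact support on F. A nonzero
    member of [S] is contracted by the torus into the ring of integers; the finite p-group o/p^n
    then fixes a nonzero vector, which is constant on o and so a multiple of [cell]. Conversely the
    affine translates of [cell] span everything. *)
Theorem kap_irreducible (S : W -> Prop) : subspace S -> (forall f, S f -> kap f) ->
  (forall b f, inP b -> S f -> S (rtW b f)) -> (exists2 f, S f & f != 0) ->
  forall f, kap f -> S f.
Proof.
move=> hS Sk Sst [f Sf f0].
have o0 := oner_neq0 F.
have supp_ex g : kap g -> exists2 a, a != 0 & forall x, ~~ inp 0 x -> gf (rt (Dm a 1) g) x = 0.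
  move=> [hg g0]; have [m hm] := gf_bounded hg g0; exists (w ^+ m); first exact: (wX0 w0).
  move=> x nx; rewrite (gf_D _ hg (wX0 w0 m)) hm ?mulr0 //; apply: contra nx.
  by rewrite exprnN (inpw hF w0 vw) opprK addNr.
have const g : kap g -> (forall x, ~~ inp 0 x -> gf g x = 0) ->
    (forall x, inp 0 x -> gf g x = gf g 0) -> g = gf g 0 *: cell.
  move=> hg hs hc; apply: kap_ext => //; first exact: (subZ kap_subspace _ kap_cellfun).
  move=> x; have -> : gf (gf g 0 *: cell) x = gf g 0 * gf cell x by [].
  rewrite cellfun_gf //; case: ifP => [/hc ->|/negbT /hs ->]; by rewrite ?mulr1 ?mulr0.
have Scell : S cell.
  have kf := Sk f Sf; have [a a0 hs] := supp_ex f kf.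
  pose g := rtW (Dm a 1) f; have Sg : S g by apply: Sst => //; apply: inPDw.
  have kg := Sk g Sg; have [n hn] := gf_level hR w0 vw (proj1 kg) hs.
  pose S1 (y : W) := [/\ S y, forall x, ~~ inp 0 x -> gf y x = 0 &
    forall z, inp n%:Z z -> rtW (Um z) y = y].
  have hS1 : subspace S1.
    split; first by split=> //; exact: sub0.
      move=> y z [y1 y2 y3] [z1 z2 z3]; split; first exact: subD.
        by move=> x nx; have -> : gf (y + z) x = gf y x + gf z x by []; rewrite y2 ?z2 ?addr0.
      by move=> t ht; rewrite (linD (rlin hrt (inGU _))) y3 ?z3.
    move=> c y [y1 y2 y3]; split; first exact: subZ.
      by move=> x nx; have -> : gf (c *: y) x = c * gf y x by []; rewrite y2 ?mulr0.
    by move=> t ht; rewrite (linZ (rlin hrt (inGU _))) y3.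
  pose act r y := if inp 0 r then rtW (Um r) y else y.
  have [l [l1 l2]] := reps_ex hF hR w0 vw n.
  have [|||||y [y1 y2 y3] [yn yf]] := @common_fixed_vector k W p _ l act S1 pk hS1.
  - exists g.
      split=> // z hz; apply: kap_ext => //; first by apply: kap_rt.
      by move=> x; rewrite gf_U hn.
    by apply: contra_neq f0; apply: (rho_eq0 hrt); apply: inP_inG; apply: inPDw.
  - by move=> r c y z; rewrite /act; case: ifP => [_|_ //]; exact: (rlin hrt (inGU r)).
  - move=> r y [y1 y2 y3]; rewrite /act; case: ifP => [hr|_]; last by split.
    split; first exact: Sst.
      by move=> x nx; rewrite gf_U y2 //; apply: contra nx => h; rewrite -[x](addrK r) (inpB hF).
    by move=> t ht; rewrite (rUU hrt) addrC -(rUU hrt) (y3 t ht).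
  - move=> r s y _; rewrite /act; case: ifP => _; case: ifP => _ //.
    by rewrite !(rUU hrt) addrC.
  - move=> r; exists n => y [_ _ y3]; case E: (inp 0 r); last first.
      by elim: (p ^ n)%N => //= j ->; rewrite /act E.
    have /eq_iter -> : act r =1 rtW (Um r) by move=> u'; rewrite /act E.
    have it j z : iter j (rtW (Um r)) z = rtW (Um (r *+ j)) z.
      elim: j => [|j IH] /=; first by rewrite mulr0n Um0 (r1 hrt).
      by rewrite IH (rUU hrt) mulrS.
    rewrite it; apply: y3; rewrite -mulr_natl natrX (inpMr hF) //; exact: (inp_pX hF).
  have yU t : inp 0 t -> rtW (Um t) y = y.
    move=> ht; have [r rl htr] := l2 t ht; rewrite -(subrK r t) -(rUU hrt).
    by have := yf r rl; rewrite /act l1 // => ->; apply: y3.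
  have yc : y = gf y 0 *: cell.
    by apply: const => [|//|x hx]; [exact: Sk | rewrite -{2}(yU x hx) gf_U add0r].
  have c0 : gf y 0 != 0 by apply: contra_neq yn => e; rewrite yc e scale0r.
  have -> : cell = (gf y 0)^-1 *: y by rewrite {2}yc scalerA mulVf ?scale1r.
  exact: subZ.
(* Induction on the level: restricting to a class r + p and rescaling it to o lowers the level by
   one. *)
have level n : forall g, kap g -> (forall x, ~~ inp 0 x -> gf g x = 0) ->
    (forall x y, inp n%:Z y -> gf g (x + y) = gf g x) -> S g.
  elim: n => [|n IH] g kg hs hn.
    rewrite (const g kg hs) => [|x hx]; first exact: subZ.
    by rewrite -[x]add0r hn.
  (* Multiplying by an indicator taken from Ind 1 cuts the support without changing the character
     chi. *)
  pose cut r : W := fun h => cellfun (chi1 F k) h * rt (Dm w^-1 1) (rt (Um r) g) h.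
  have wV : w^-1 != 0 by rewrite invr_eq0.
  have cutk r : kap (cut r).
    split; last by rewrite /cut cellfun_one mul0r.
    apply: inInd_mul; last exact: (cellfun_Ind smooth_chi1).
    by apply: inInd_rt; [apply: inP_inG; apply: inPDw | apply: inInd_rt => //; case: kg].
  have cutE r x : gf (cut r) x = if inp 0 x then chi 1 w^-1 * gf g (r + w * x) else 0.
    have -> : gf (cut r) x = gf (cellfun (chi1 F k)) x * gf (rt (Dm w^-1 1) (rt (Um r) g)) x by [].
    rewrite (cellfun_gf smooth_chi1); case: ifP => _; rewrite ?mul0r // mul1r.
    rewrite (gf_D _ (inInd_rt (inGU r) (proj1 kg)) wV).
    by rewrite gf_U invrK mulrC [x * w]mulrC [_ + r]addrC mulrC.
  have Scut r : S (cut r).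
    apply: IH => // [x /negPf nx|x y hy]; rewrite !cutE ?nx //.
    have -> : inp 0 (x + y) = inp 0 x by rewrite (inpDl hF) //; apply: inp_le hy; lia.
    case: ifP => // _; rewrite mulrDr addrA (hn _ (w * y)) //.
    by rewrite (inpw1l hF w0 vw); apply: inp_le hy; lia.
  pose back r := rtW (Um (- r)) (rtW (Dm w 1) (cut r)).
  have -> : g = \sum_(r <- 0 :: R) back r.
    have kb r : kap (back r) by apply: kap_rt => //; apply: kap_rt; [apply: inPDw | ].
    apply: kap_ext => //; first by apply: (subsum kap_subspace).
    move=> x; have -> : gf (\sum_(r <- 0 :: R) back r) x = \sum_(r <- 0 :: R) gf (back r) x.
      by rewrite /gf fct_sumE.
    have bE r : gf (back r) x = if inp 1 (x - r) then gf g x else 0.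
      rewrite gf_U (gf_D _ (proj1 (cutk r)) w0).
      rewrite cutE (inpwV hF w0 vw); case: ifP => _; last by rewrite mulr0.
      rewrite mulrA -(chi_mul hchi) ?mulr1 ?mulfV ?(chi_one hchi) ?oner_neq0 // mul1r.
      by congr gf; field.
    under eq_bigr do rewrite bE.
    case: (hR) => _ uR iR cR.
    have [hx|nx] := boolP (inp 0 x).
      have [r0 r0R hr0] := cR x hx.
      rewrite (bigD1_seq r0) //= hr0 big1_seq ?addr0 // => r /andP[ne rR].
      rewrite ifF //; apply: contraNF ne => h; apply/eqP; apply: iR => //.
      by apply: (inp_trans hF (y := x)) => //; rewrite (inpBC hF).
    rewrite hs // big_seq big1 // => r rR; rewrite ifF //; apply: contraNF nx => h.
    by rewrite -(subrK r x) (inpD hF) ?(res_inp hR rR) // (inp1_0 h).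
  by apply: (subsum hS) => r _; apply: (Sst) => //; apply: (Sst) => //; apply: inPDw.
move=> g kg; have [a a0 hs] := supp_ex g kg.
have ka : kap (rtW (Dm a 1) g) by apply: kap_rt => //; apply: inPDw.
have [n hn] := gf_level hR w0 vw (proj1 ka) hs.
have Sa := level n _ ka hs hn.
have -> : g = rtW (Dm a^-1 1) (rtW (Dm a 1) g).
  by rewrite (rDD hrt) ?invr_eq0 // mulVf // mulr1 Dm1 (r1 hrt).
by apply: Sst => //; apply: inPDw; rewrite invr_eq0.
Qed.
End Irreducible.
End PrincipalSeries.

(** * Raising invariance along P-linear maps *)

Section Descent.
Variables (p : nat) (F : fieldType) (k : closedFieldType) (v : F -> int).
Hypothesis hF : nonarch_local_field p v.
Variable R : seq F.
Hypothesis hR : residues v R.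
Variable w : F.
Hypotheses (w0 : w != 0) (vw : v w = 1).
Notation inp := (inp v).
Notation vunit := (vunit v).
Notation Gam := (Gam v).
Variables (V : lmodType k) (rho : 'M[F]_2 -> V -> V).
Hypothesis hr : grep rho.
Notation Nop := (Nop R w rho).
Notation Dop := (Dop R w rho).
Notation fixU := (fixU v rho).

Definition fixD (x : V) := forall a d, inp 1 (a - 1) -> inp 1 (d - 1) -> rho (Dm a d) x = x.

Lemma fixed_fixD n x : fixed rho (Gam 0 n) x -> fixD x.
Proof. by move=> h a d ha hd; apply: h; apply: GamD. Qed.

Lemma fixed_UDL n x : 1 <= n -> fixU x -> fixD x ->
  (forall y, inp n y -> rho (Lm y) x = x) -> fixed rho (Gam 0 n) x.
Proof.
move=> n1 hU hD hL; apply: mx_ind2 => a b c d /and4P[]; rewrite !mkE => ha hd hb hc.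
have ud := one_vunit hF hd; have d0 := vunit_neq0 ud.
have ub : inp 0 (b / d) by rewrite (inpMur hF) ?(vunitV hF).
have ha' : inp 1 (a - b / d * c - 1).
  by rewrite addrAC (inpB hF) // (inpMl hF) //; apply: inp_le hc.
have GD : inG (Dm (a - b / d * c) d) by apply: inGD; rewrite // (vunit_neq0 (one_vunit hF ha')).
have -> : mk a b c d = Um (b / d) *m (Dm (a - b / d * c) d *m Lm (c / d)).
  by rewrite !mk_mul; congr mk; field.
rewrite (rM hr _ (inGU _) (inGM GD (inGL _))) (rM hr _ GD (inGL _)).
by rewrite hL ?hD ?hU // (inpMur hF) ?(vunitV hF).
Qed.

(** Torus units and U(o) normalize [Gam 1 n], so only t matters. D gains a level but loses
    U(o)-invariance, which [descent_fixed] supplies separately. *)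
Lemma Dop_fixed n z : 1 <= n -> fixed rho (Gam 0 (n + 1)) z -> fixed rho (Gam 1 n) (Dop z).
Proof.
move=> n1 hz; have hG : forall g, Gam 1 n g -> inG g by move=> g; apply: (GamG hF).
apply: (subsum (fixed_subspace hr hG)) => r /(res_unit hR) ur.
have uV := vunitV hF ur.
apply: (fixed_moveU hF hr n1 (vunit_inp uV)).
have uNV : vunit (- r^-1) by rewrite (vunitN hF).
apply: (fixed_moveD hF hr ler01 n1 uNV ur).
exact: (fixed_t hF w0 vw hr n1 (lexx _) hz).
Qed.

Hypothesis hrho : is_rep v (@inG F) rho.

Lemma fixed_Gam_large x : fixU x -> fixD x -> exists n : nat, fixed rho (Gam 0 n.+1%:Z) x.
Proof.
move=> hU hD; have [[//|n] _ hn] := fixed_large hrho x; exists n.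
apply: fixed_UDL => // y hy; apply: (hn n.+1) => //.
by apply/congr_sub_mk; rewrite subrr !inp0 hy.
Qed.

(** Smoothness gives lower unipotent invariance at some depth. Each application of N improves it by
    one level, and x is recovered as c^-1 N x. *)
Lemma Nop_eigen_fixed c x : c != 0 -> Nop x = c *: x -> fixU x -> fixD x ->
  fixed rho (Gam 0 1) x.
Proof.
move=> c0 Nx hU hD; have [n] := fixed_Gam_large hU hD; elim: n => // n IH hn; apply: IH.
have n1 : 1 <= n.+1%:Z by [].
have e : n.+2%:Z <= n.+1%:Z + 1 by rewrite -PoszD addn1.
have := Nop_fixed hF hR w0 vw hr n1 e hn; rewrite Nx => h g hg.
have Gg : inG g by apply: (GamG hF) hg.
have := h g hg; rewrite (linZ (rlin hr Gg)) => /(congr1 (fun z => c^-1 *: z)).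
by rewrite !scalerA mulVf // !scale1r.
Qed.

(* Simultaneous descent: the two relations express x and y through each other by operators that
   improve the level by one. *)
Lemma descent_fixed (x y : V) (G : V -> V) :
  fixU x -> fixD x -> fixU y -> fixD y -> y = - Dop x ->
  (forall n : int, 1 <= n -> fixed rho (Gam 0 (n + 1)) y -> fixed rho (Gam 1 n) (G y)) -> x = G y ->
  fixed rho (Gam 0 1) x.
Proof.
move=> xU xD yU yD ey hG ex.
have [m hm] := fixed_Gam_large xU xD; have [n hn] := fixed_Gam_large yU yD.
have [N [hx hy]] : exists N : nat, fixed rho (Gam 0 N.+1%:Z) x /\ fixed rho (Gam 0 N.+1%:Z) y.
  exists (maxn m n); split; [apply: fixed_le hm | apply: fixed_le hn] => //; rewrite lez_nat ltnS.
    exact: leq_maxl.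
  exact: leq_maxr.
elim: N hx hy => // N IH hx hy.
have n1 : 1 <= N.+1%:Z by [].
have e : N.+2%:Z = N.+1%:Z + 1 by rewrite -PoszD addn1.
rewrite e in hx hy; apply: IH; apply: (fixed_UGam hF hr n1) => //.
  by rewrite ex; apply: hG.
rewrite ey; have hG1 : forall g, Gam 1 N.+1%:Z g -> inG g by move=> g; apply: (GamG hF).
exact: (subN (fixed_subspace hr hG1) (Dop_fixed n1 hx)).
Qed.
End Descent.

(** * Eigenlines of P modulo a stable subspace *)

Section Lines.
Variables (p : nat) (F : fieldType) (k : closedFieldType) (v : F -> int).
Hypothesis hF : nonarch_local_field p v.
Variable w : F.
Hypotheses (w0 : w != 0) (vw : v w = 1).
Notation inp := (inp v).
Notation tm := (tm w).
Variables (V : lmodType k) (rho : 'M[F]_2 -> V -> V).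
Hypothesis hrho : is_rep v (@inG F) rho.
Let hr : grep rho := is_rep_grep hrho.

Section Modulo.
Variable S : V -> Prop.
Hypotheses (hS : subspace S) (sS : stable (@inP F) rho S).

(** Applied with [S] a proper P-stable subspace when restricting V, and with [S] zero when studying
    a line in V'. *)
Definition eigmod (g : 'M[F]_2) (e : V) := exists2 c : k, c != 0 & S (rho g e - c *: e).

Lemma eigmodM g h e : inP g -> inP h -> eigmod g e -> eigmod h e -> eigmod (g *m h) e.
Proof.
move=> hg hh [c c0 Sc] [d d0 Sd]; have [Gg Gh] := (inP_inG hg, inP_inG hh).
exists (c * d); first exact: mulf_neq0.
rewrite (rM hr _ Gg Gh).
have -> : rho g (rho h e) - (c * d) *: e = rho g (rho h e - d *: e) + d *: (rho g e - c *: e).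
  rewrite (linB (rlin hr Gg)) (linZ (rlin hr Gg)) scalerBr scalerA [d * c]mulrC.
  by rewrite addrA subrK.
by apply: (subD hS); [apply: sS | apply: (subZ hS)].
Qed.

Lemma eigmodV g h e : inP g -> inP h -> h *m g = 1%:M -> eigmod g e -> eigmod h e.
Proof.
move=> hg hh hg1 [c c0 Sc]; have [Gg Gh] := (inP_inG hg, inP_inG hh).
exists c^-1; first by rewrite invr_eq0.
have := subZ hS (- c^-1) (sS hh Sc).
rewrite (linB (rlin hr Gh)) (linZ (rlin hr Gh)) -(rM hr _ Gh Gg) hg1 (r1 hr).
by rewrite scaleNr scalerBr scalerA mulVf // scale1r opprB.
Qed.

Variable e : V.
Hypotheses (eU : forall y, inp 0 y -> S (rho (Um y) e - e)) (et : eigmod tm e)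
  (eD : forall a d, a != 0 -> d != 0 -> v a = v d -> eigmod (Dm a d) e).

Lemma eigmod1 : eigmod 1%:M e.
Proof. by exists 1; rewrite ?oner_neq0 // (r1 hr) scale1r subrr; apply: (sub0 hS). Qed.

Lemma eigmod_tX n : eigmod (Dm (w ^+ n) 1) e.
Proof.
elim: n => [|n IH]; first by rewrite expr0 Dm1; apply: eigmod1.
have -> : Dm (w ^+ n.+1) 1 = tm *m Dm (w ^+ n) 1 by rewrite DmM mulr1 exprS.
by apply: eigmodM => //; [apply: inPt | apply: inPD; rewrite ?oner_neq0 ?expf_neq0].
Qed.

Lemma eigmod_Dm a d : a != 0 -> d != 0 -> eigmod (Dm a d) e.
Proof.
have o0 := oner_neq0 F.
have tz (i : int) : eigmod (Dm (w ^ i) 1) e.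
  have [n [->|->]] : exists n : nat, i = n%:Z \/ i = - n%:Z.
  - by case: i => n; [exists n; left | exists n.+1; right].
  - exact: eigmod_tX.
  - have wn : w ^+ n != 0 by rewrite expf_neq0.
    apply: (eigmodV (g := Dm (w ^+ n) 1)); rewrite ?(inPD, expfz_neq0) //; try exact: inPD.
    + by apply: inPD; rewrite ?expfz_neq0.
    + by rewrite DmM mulr1 -exprnN mulVf // Dm1.
    + exact: eigmod_tX.
move=> a0 d0; pose i := v a - v d; have wi : w ^ i != 0 by rewrite expfz_neq0.
have -> : Dm a d = Dm (w ^ i) 1 *m Dm (a / w ^ i) d.
  by rewrite DmM mul1r mulrCA mulfV // mulr1.
have ai : a / w ^ i != 0 by rewrite mulf_neq0 ?invr_eq0.
apply: eigmodM => //; [exact: inPD | exact: inPD | apply: eD => //].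
by rewrite (vf hF) // (vw_expz hF w0 vw) /i opprB addrC subrK.
Qed.

(** A power t^n brings x into the ring of integers and multiplies e by a nonzero scalar modulo [S];
    invariance under U(o) is then transported back by t^-n. *)
Lemma Um_mod x : S (rho (Um x) e - e).
Proof.
have o0 := oner_neq0 F.
have [n hn] : exists n : nat, inp 0 (w ^+ n * x).
  exists (absz (v x)); have [->|x0] := eqVneq x 0; first by rewrite mulr0 inp0.
  by rewrite mulrC (inpwX hF w0 vw) inpE //; move: (v x) => m; clear; lia.
have wn : w ^+ n != 0 by rewrite expf_neq0.
have [c c0 Sc] := eigmod_tX n.
have hP : inP (Dm (w ^+ n) 1 : 'M[F]_2) by apply: inPD.
have hPV : inP (Dm (w ^- n) 1 : 'M[F]_2) by apply: inPD; rewrite ?invr_eq0.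
pose s := rho (Dm (w ^+ n) 1) e - c *: e.
have e1 : rho (Dm (w ^+ n) 1) (rho (Um x) e - e) =
    c *: (rho (Um (w ^+ n * x)) e - e) + (rho (Um (w ^+ n * x)) s - s).
  rewrite (linB (rlin hr (inP_inG hP))) (rDU hr) // divr1.
  rewrite -[rho (Dm (w ^+ n) 1) e](subrK (c *: e)) -/s.
  rewrite (linD (rlin hr (inGU _))) (linZ (rlin hr (inGU _))) scalerBr.
  by rewrite opprD addrACA addrC addrA.
have : S (rho (Dm (w ^+ n) 1) (rho (Um x) e - e)).
  rewrite e1; apply: (subD hS); first by apply: (subZ hS); apply: eU.
  by apply: (subB hS) => //; apply: sS => //; apply: inPU.
move/(sS hPV); rewrite -(rM hr _ (inP_inG hPV) (inP_inG hP)) DmM mulVf // mulr1 Dm1.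
by rewrite (r1 hr).
Qed.
End Modulo.

Lemma smooth_Lm x : exists n : nat, forall y, inp n%:Z y -> rho (Lm y) x = x.
Proof.
case: hrho => _ _ _ /(_ x) [n [n0 hn]]; exists n => y hy; apply: hn => //.
by apply/congr_sub_mk; rewrite subrr !inp0 hy.
Qed.

(* A line on which P acts through a character is G-stable: smoothness makes a small lower unipotent
   group act trivially, and conjugating by the torus makes all of it act trivially. *)
Lemma line_det (e : V) : (forall x, rho (Um x) e = e) ->
  (forall a d, a != 0 -> d != 0 -> exists2 c : k, c != 0 & rho (Dm a d) e = c *: e) ->
  forall g, inG g -> rho g e = rho (Dm (\det g) 1) e.
Proof.
move=> hU hD; have o0 := oner_neq0 F; have m0 : (-1 : F) != 0 by rewrite oppr_eq0.
have hL x : rho (Lm x) e = e.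
  have [n hn] := smooth_Lm e; have [->|x0] := eqVneq x 0.
    by have -> : Lm 0 = 1%:M :> 'M[F]_2; [rewrite mk1 | apply: (r1 hr)].
  pose a := w ^ (v x - n%:Z); have a0 : a != 0 by rewrite expfz_neq0.
  have ax : inp n%:Z (x / a).
    by rewrite inpE ?mulf_neq0 ?invr_eq0 // (vf hF) // (vw_expz hF w0 vw); lia.
  have [c c0 ec] := hD a 1 a0 o0; have GD := inGD a0 o0.
  have : rho (Lm x) (rho (Dm a^-1 1) e) = rho (Dm a^-1 1) e.
    have GV : inG (Dm a^-1 1 : 'M[F]_2) by apply: inGD; rewrite ?invr_eq0.
    rewrite -(rM hr _ (inGL _) GV).
    have -> : Lm x *m Dm a^-1 1 = Dm a^-1 1 *m Lm (x / a) by rewrite !mk_mul; congr mk; ring.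
    by rewrite (rM hr _ GV (inGL _)) hn.
  have [c' c'0 ->] := hD a^-1 1 (invr_neq0 a0) o0.
  rewrite (linZ (rlin hr (inGL _))) => /(congr1 (fun z => c'^-1 *: z)).
  by rewrite !scalerA mulVf // !scale1r.
have hs : rho (sm F) e = rho (Dm (-1) 1) e.
  have GD := inGD m0 o0.
  (* Expresses s through unipotents, so that on e it acts like a torus element. *)
  have -> : sm F = Dm (-1) 1 *m (Um (-1) *m (Lm 1 *m Um (-1))).
    by rewrite !mk_mul; congr mk; ring.
  rewrite (rM hr _ GD) ?(rM hr _ (inGU _)) ?(rM hr _ (inGL _)) ?hU ?hL ?hU //.
    by apply: inGM.
  by apply: inGM => //; apply: inGM.
have hswap a d : a != 0 -> d != 0 -> rho (Dm a d) e = rho (Dm d a) e.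
  move=> a0 d0; have Gad := inGD a0 d0; have Gda := inGD d0 a0; have Gs := inGs F.
  have [c c0 ec] := hD (-1) 1 m0 o0; have [d' d'0 ed] := hD d a d0 a0.
  have : rho (sm F) (rho (Dm d a) e) = rho (Dm a d) (rho (sm F) e).
    rewrite -!(rM hr) //; congr (rho _ e); rewrite !mk_mul; congr mk; ring.
  rewrite hs ec ed !(linZ (rlin hr _)) // hs ec => /(congr1 (fun z => c^-1 *: z)).
  by rewrite !scalerA mulrAC mulVf // mul1r scale1r => <-.
have hdet a d : a != 0 -> d != 0 -> rho (Dm a d) e = rho (Dm (a * d) 1) e.
  move=> a0 d0; have -> : Dm a d = Dm a 1 *m Dm 1 d by rewrite DmM mulr1 mul1r.
  have -> : Dm (a * d) 1 = Dm a 1 *m Dm d 1 by rewrite DmM mulr1.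
  rewrite (rM hr e (inGD a0 o0) (inGD o0 d0)) (rM hr e (inGD a0 o0) (inGD d0 o0)).
  by congr (rho _ _); apply: hswap.
apply: mx_ind2 => a b c d; rewrite inG_mk det_mk => D0.
have [c0|c0] := eqVneq c 0.
  rewrite c0 mulr0 subr0 in D0 *; have [a0 d0] : a != 0 /\ d != 0.
    by move: D0; rewrite mulf_eq0 negb_or => /andP.
  have -> : mk a b 0 d = Um (b / d) *m Dm a d by rewrite mk_mul; congr mk; field.
  have [c' _ ec] := hD a d a0 d0.
  by rewrite (rM hr _ (inGU _) (inGD a0 d0)) -(hdet a d) // ec (linZ (rlin hr (inGU _))) hU.
have nz : - ((a * d - b * c) / c) != 0 by rewrite oppr_eq0 mulf_neq0 ?invr_eq0.
have GD := inGD nz c0.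
have -> : mk a b c d = Um (a / c) *m (Dm (- ((a * d - b * c) / c)) c *m (sm F *m Um (d / c))).
  by rewrite !mk_mul; congr mk; field.
rewrite (rM hr _ (inGU _)); last by do ?apply: inGM => //; apply: inGs.
rewrite (rM hr _ GD); last by apply: inGM => //; apply: inGs.
rewrite (rM hr _ (inGs F) (inGU _)) hU hs.
have E : a * d - b * c = - ((a * d - b * c) / c) * (c * -1) by field.
rewrite -(rM hr _ GD (inGD m0 o0)) DmM mulr1 hdet ?mulf_neq0 //.
have -> : - ((a * d - b * c) / c) * -1 * c = a * d - b * c by field.
by have [c' _ ->] := hD _ _ D0 o0; rewrite (linZ (rlin hr (inGU _))) hU.
Qed.
End Lines.

(** * Maps that are linear on a subspace only *)

Section LinearOn.
Variables (k : fieldType) (V W : lmodType k) (S : V -> Prop) (f : V -> W).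
Hypotheses (hS : subspace S)
  (lf : forall a x y, S x -> S y -> f (a *: x + y) = a *: f x + f y).

Lemma linonD x y : S x -> S y -> f (x + y) = f x + f y.
Proof. by move=> hx hy; rewrite -[x in LHS]scale1r lf // scale1r. Qed.

Lemma linon0 : f 0 = 0.
Proof. by have S0 := sub0 hS; apply: (addrI (f 0)); rewrite -linonD // !addr0. Qed.

Lemma linonZ a x : S x -> f (a *: x) = a *: f x.
Proof. by move=> hx; rewrite -[a *: x]addr0 lf ?linon0 ?addr0 //; apply: (sub0 hS). Qed.

Lemma linonB x y : S x -> S y -> f (x - y) = f x - f y.
Proof.
by move=> hx hy; rewrite (linonD hx (subN hS hy)) -[- y]scaleN1r linonZ // scaleN1r.
Qed.

Lemma linon_sum (I : eqType) (r : seq I) (G : I -> V) : (forall i, i \in r -> S (G i)) ->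
  f (\sum_(i <- r) G i) = \sum_(i <- r) f (G i).
Proof.
elim: r => [|i r IH] h; first by rewrite !big_nil linon0.
have hi : S (G i) by apply: h; rewrite mem_head.
have hr' j : j \in r -> S (G j) by move=> jr; apply: h; rewrite inE jr orbT.
by rewrite !big_cons linonD ?IH //; apply: (subsum hS).
Qed.
End LinearOn.

(** * Extension from Sp to the principal series *)

Section TrivialCharacter.
Variables (p : nat) (F : fieldType) (k : closedFieldType) (v : F -> int).
Hypothesis hF : nonarch_local_field p v.
Notation inp := (inp v).
Notation W := ('M[F]_2 -> k^o).
Notation rtW := (@rt F k^o).
Notation c1 := (chi1 F k).
Notation e2 := (cellfun v c1).
Let hrt := grep_rt F k.

Definition one : W := fun h => if \det h != 0 then 1 else 0.

Lemma oneE h : inG h -> one h = 1.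
Proof. by rewrite /inG /one => ->. Qed.

Lemma one_rt g : inG g -> rtW g one = one.
Proof. by rewrite /inG => hg; apply: funext => h; rewrite /rt /one det_mulmx mulf_eq0 (negPf hg) orbF. Qed.

Lemma one_Ind : inInd v c1 one.
Proof.
split=> [h|b h [hb _] hh|h hh].
- by rewrite /inG /one; case: eqP => // _ [].
- by rewrite !oneE ?mul1r //; apply: inGM.
- exists 1%N; split=> // g hg; rewrite !oneE //; apply: inGM => //.
  exact: (congr_inG hF _ hg).
Qed.

Lemma e2E a b c d :
  e2 (mk a b c d) = if [&& a * d - b * c != 0, c != 0 & inp 0 (d / c)] then 1 else 0.
Proof. by rewrite cellfunE. Qed.

Lemma kap_e2 : kap v c1 e2.
Proof. by apply: (kap_cellfun hF); apply: smooth_chi1. Qed.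

Lemma e2_fixU : fixU v rtW e2.
Proof.
move=> y hy; apply: (kap_ext (kap_rt hF (inPU y) kap_e2) kap_e2) => x.
by rewrite gf_U !(cellfun_gf (smooth_chi1 _ _)) (inpDl hF).
Qed.

Lemma e2_D a d : a != 0 -> d != 0 -> v a = v d -> rtW (Dm a d) e2 = e2.
Proof.
move=> a0 d0 e; apply: (kap_ext (kap_rt hF (inPD a0 d0) kap_e2) kap_e2) => x.
transitivity (e2 (mk 0 d a (x * d))).
  by rewrite /gf /rt !mk_mul; congr (e2 _); congr mk; ring.
rewrite e2E (cellfun_gf (smooth_chi1 _ _)) mul0r sub0r oppr_eq0 mulf_neq0 // a0 /= -mulrA.
by rewrite (inpMur hF) //; apply: (vunit_div hF).
Qed.

Section Hecke.
Variable R : seq F.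
Hypothesis hR : residues v R.
Variable w : F.
Hypotheses (w0 : w != 0) (vw : v w = 1).
Notation tm := (tm w).
Notation Pm := (Pm w).

(** On the projective line of bottom rows the two indicators are those of the complementary
    conditions d/c integral and c/d in the maximal ideal. *)
Lemma e2_P : e2 + rtW Pm e2 = one.
Proof.
apply: funext; apply: mx_ind2 => a b c d.
have -> : (e2 + rtW Pm e2) (mk a b c d) = e2 (mk a b c d) + e2 (mk (b * w) a (d * w) c).
  by rewrite addrfctE /rt mk_mul; congr (_ + e2 _); congr mk; ring.
rewrite !e2E /one det_mk.
have -> : b * w * c - a * (d * w) = - w * (a * d - b * c) by ring.
rewrite mulf_eq0 oppr_eq0 (negPf w0) mulf_eq0 (negPf w0) orbF /=.
case: eqVneq => [_|D0] /=; first by rewrite addr0.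
have [c0|c0] := eqVneq c 0.
  rewrite c0 mul0r inp0 add0r andbT ifT //; apply: contraNneq D0 => ->.
  by rewrite c0 !mulr0 subrr.
have [d0|d0] := eqVneq d 0; first by rewrite d0 mul0r inp0 addr0.
have -> : c / (d * w) = c / d / w by rewrite invfM mulrA.
rewrite /=.
rewrite (inpwV hF w0 vw) !inpE ?mulf_neq0 ?invr_eq0 // !(vf hF) //.
case: (lerP 0 (v d - v c)) => h; first by rewrite ifF ?addr0 //; apply/negbTE; rewrite -ltNge; lia.
by rewrite ifT ?add0r //; lia.
Qed.

Lemma e2_N : Nop R w rtW e2 = e2.
Proof.
have o0 := oner_neq0 F; have hk := kap_subspace v c1.
have kt : kap v c1 (rtW tm e2) by apply: (kap_rt hF (inPt w0) kap_e2).
have kr r : kap v c1 (rtW (Um r) (rtW tm e2)) by apply: (kap_rt hF (inPU r) kt).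
apply: (kap_ext _ kap_e2); first exact: (subsum hk).
move=> x; rewrite (cellfun_gf (smooth_chi1 _ _)).
transitivity (\sum_(r <- 0 :: R) gf (rtW (Um r) (rtW tm e2)) x).
  by rewrite /gf /Nop fct_sumE.
have E r : gf (rtW (Um r) (rtW tm e2)) x = if inp 1 (- x - r) then 1 else 0.
  rewrite gf_U -opprD (inpN hF) -[1]add0r -(inpwV hF w0 vw) -(cellfun_gf (smooth_chi1 k v)).
  by rewrite -[RHS]mul1r; exact: (gf_D (x + r) (proj1 kap_e2) w0).
under eq_bigr do rewrite E.
case: (hR) => _ uR iR cR; have [hx|nx] := boolP (inp 0 x).
  have [|r0 r0R hr0] := cR (- x); first by rewrite (inpN hF).
  rewrite (bigD1_seq r0) //= hr0 big1_seq ?addr0 // => r /andP[ne rR].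
  rewrite ifF //; apply: contraNF ne => h; apply/eqP; apply: iR => //.
  by apply: (inp_trans hF (y := - x)) => //; rewrite (inpBC hF).
rewrite big_seq big1 // => r rR; rewrite ifF //; apply: contraNF nx => h.
rewrite -(inpN hF) -(subrK r (- x)); apply: (inpD hF); first exact: inp1_0.
exact: (res_inp hR rR).
Qed.

Lemma e2_fixed : fixed rtW (Gam v 0 1) e2.
Proof.
apply: (fixed_UDL hF hrt) => //; first exact: e2_fixU.
  move=> a d ha hd; have ua := one_vunit hF ha; have ud := one_vunit hF hd.
  by apply: e2_D; rewrite ?(vunit_neq0 ua) ?(vunit_neq0 ud) // !vunit_v.
move=> y hy; have -> : e2 = one - rtW Pm e2 by rewrite -e2_P addrK.
rewrite (linB (rlin hrt (inGL _))) one_rt //; congr (_ - _).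
have GP := inGPm w0; rewrite -(rM hrt _ (inGL _) GP).
have -> : Lm y *m Pm = Pm *m Um (y / w) by rewrite !mk_mul; congr mk; field.
by rewrite (rM hrt _ GP (inGU _)) e2_fixU // (inpwV hF w0 vw).
Qed.

(** Obtained from s N = Pm + D and s e2 = 1 - t e2. Both sides stay inside the functions vanishing
    at 1, so a map defined only there can transport the identity. *)
Lemma e2_Dop : Dop R w rtW e2 = e2 - rtW tm e2.
Proof.
have h : fixU v rtW (rtW Pm e2) by apply: fixed_fixU (fixed_P hF w0 vw hrt e2_fixed).
have := s_Nop hF hR w0 hrt h; rewrite e2_N.
have -> : rtW (sm F) e2 = one - rtW tm e2.
  have /(congr1 (rtW (sm F))) := e2_P.
  rewrite (linD (rlin hrt (inGs F))) -(rt_sP w0 hrt) (one_rt (inGs F)) => <-.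
  by rewrite addrK.
by move=> E; apply: (addrI (rtW Pm e2)); rewrite -E -e2_P addrA [rtW Pm e2 + _]addrC.
Qed.
End Hecke.
End TrivialCharacter.

(** * Existence and uniqueness of the extension *)

Section Steinberg.
Variables (p : nat) (F : fieldType) (k : closedFieldType) (v : F -> int).
Hypothesis pk : p \in [pchar k].
Hypothesis hF : nonarch_local_field p v.
Variable R : seq F.
Hypothesis hR : residues v R.
Variable w : F.
Hypotheses (w0 : w != 0) (vw : v w = 1).
Notation inp := (inp v).
Notation tm := (tm w).
Notation Pm := (Pm w).
Notation W := ('M[F]_2 -> k^o).
Notation rtW := (@rt F k^o).
Notation c1 := (chi1 F k).
Notation e2 := (cellfun v c1).
Notation one := (@one F k).
Let hrt := grep_rt F k.
Variables (V : lmodType k) (rho : 'M[F]_2 -> V -> V).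
Hypothesis hrho : is_rep v (@inG F) rho.
Let hr : grep rho := is_rep_grep hrho.
Let indS := inInd_subspace v c1 : subspace (inInd v c1 : W -> Prop).
Let kapS : subspace (kap v c1) := kap_subspace v c1.

Lemma cellfun_neq0 chi : smooth_charT v chi -> (cellfun v chi : W) != 0.
Proof.
move=> hchi; apply/eqP => e; have e1 : gf (cellfun v chi) 0 = 0 by rewrite e.
have := cellfun_gf hchi 0; rewrite inp0 => E.
by have /eqP := eq_trans (esym E) e1; rewrite oner_eq0.
Qed.

Section Extension.
Variable phi : W -> V.
Hypothesis hphi : forall a f g, kap v c1 f -> kap v c1 g -> phi (a *: f + g) = a *: phi f + phi g.
Hypothesis phiP : forall b f, inP b -> kap v c1 f -> phi (rtW b f) = rho b (phi f).

Let ke := kap_e2 k hF.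

Definition delta : V := phi e2 + rho Pm (phi e2).

Lemma phi_e2_eigv : eigv v rho c1 (phi e2) /\ Nop R w rho (phi e2) = phi e2.
Proof.
have GD a d : inp 1 (a - 1) -> inp 1 (d - 1) -> [/\ a != 0, d != 0 & v a = v d].
  move=> /(one_vunit hF) ua /(one_vunit hF) ud.
  by rewrite (vunit_neq0 ua) (vunit_neq0 ud) !vunit_v.
have hN : Nop R w rho (phi e2) = phi e2.
  have kt := kap_rt hF (inPt w0) ke.
  rewrite -[in RHS](e2_N k hF hR w0 vw) /Nop (linon_sum kapS hphi) => [|r _]; last first.
    exact: (kap_rt hF (inPU r) kt).
  by apply: eq_bigr => r _; rewrite (phiP (inPU r) kt) (phiP (inPt w0) ke).
have hD a d : a != 0 -> d != 0 -> v a = v d -> rho (Dm a d) (phi e2) = phi e2.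
  by move=> a0 d0 e; rewrite -(phiP (inPD a0 d0) ke) (e2_D k hF).
split=> //; split; last by move=> a d a0 d0 e; rewrite hD // scale1r.
apply: (Nop_eigen_fixed hF hR w0 vw hr hrho (oner_neq0 k)); first by rewrite hN scale1r.
  by move=> y hy; rewrite -(phiP (inPU y) ke) (e2_fixU k hF).
by move=> a d ha hd; have [a0 d0 e] := GD a d ha hd; apply: hD.
Qed.

(** Pm exchanges the two summands because diag(w, w) acts trivially on them; s does as well as it
    should thanks to the image of [e2_Dop] under phi. Hence t = s Pm fixes delta, and so do U(o) and
    the torus units. Contraction extends this to P, and [line_det] to G. *)
Lemma delta_fixed g : inG g -> rho g delta = delta.
Proof.
have [e1 hN] := phi_e2_eigv; have [hx hx'] := e1; have [hP hP'] := eigv_P hF w0 vw hr e1.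
have GP := inGPm w0; have Gs := inGs F; have Gt := inGt w0.
have hPm : rho Pm delta = delta.
  by rewrite /delta (linD (rlin hr GP)) (rPP w0 hr) hx' // scale1r addrC.
have hs : rho (sm F) delta = delta.
  rewrite /delta (linD (rlin hr Gs)) -(rt_sP w0 hr) -{1}hN.
  rewrite (s_Nop hF hR w0 hr (fixed_fixU hP)).
  have -> : Dop R w rho (phi e2) = phi (Dop R w rtW e2).
    have kt := kap_rt hF (inPt w0) ke.
    have kD r : r \in R -> kap v c1 (rtW (Dm (- r^-1) r) (rtW tm e2)).
      move=> /(res_unit hR) /vunit_neq0 r0.
      by apply: (kap_rt hF _ kt); apply: inPD; rewrite ?oppr_eq0 ?invr_eq0.
    rewrite /Dop (linon_sum kapS hphi) => [|r rR]; last exact: (kap_rt hF (inPU _) (kD r rR)).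
    rewrite !big_seq; apply: eq_bigr => r rR.
    rewrite (phiP (inPU _) (kD r rR)); congr (rho _ _).
    have r0 := vunit_neq0 (res_unit hR rR).
    rewrite (phiP _ kt); last by apply: inPD; rewrite ?oppr_eq0 ?invr_eq0.
    by rewrite (phiP (inPt w0) ke).
  rewrite (e2_Dop k hF hR w0 vw) (linonB kapS hphi ke (kap_rt hF (inPt w0) ke)).
  by rewrite (phiP (inPt w0) ke) -addrA subrK addrC.
have ht : rho tm delta = delta by rewrite (rt_sP w0 hr) hPm hs.
have hU y : inp 0 y -> rho (Um y) delta = delta.
  move=> hy; rewrite /delta (linD (rlin hr (inGU _))).
  by rewrite (fixed_fixU hx) // (fixed_fixU hP).
have hD a d : a != 0 -> d != 0 -> v a = v d -> rho (Dm a d) delta = delta.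
  move=> a0 d0 e; rewrite /delta (linD (rlin hr (inGD a0 d0))) hx' // hP' //.
  by rewrite !scale1r.
pose Z (x : V) := x = 0.
have hZ : subspace Z by split=> [|x y -> ->|a x ->]; rewrite /Z ?addr0 ?scaler0.
have sZ : stable (@inP F) rho Z by move=> b x hb ->; apply: (lin0 (rlin hr (inP_inG hb))).
have eZ b : rho b delta = delta -> eigmod rho Z b delta.
  by move=> e; exists 1; rewrite ?oner_neq0 // e scale1r /Z subrr.
have hU' x : rho (Um x) delta = delta.
  apply/eqP; rewrite -subr_eq0; apply/eqP.
  apply: (Um_mod hF w0 vw hrho hZ sZ _ (eZ _ ht)) => y hy.
  by rewrite /Z hU // subrr.
have o0 := oner_neq0 F.
have hD1 a : a != 0 -> rho (Dm a 1) delta = delta.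
  move=> a0; pose i := v a; have wi : w ^ i != 0 by rewrite expfz_neq0.
  have tX n : rho (Dm (w ^+ n) 1) delta = delta.
    elim: n => [|n IH]; first by rewrite expr0 Dm1 (r1 hr).
    have wn : w ^+ n != 0 by rewrite expf_neq0.
    have -> : Dm (w ^+ n.+1) 1 = tm *m Dm (w ^+ n) 1 by rewrite DmM mulr1 exprS.
    by rewrite (rM hr _ Gt (inGD wn o0)) IH.
  have tz : rho (Dm (w ^ i) 1) delta = delta.
    have [n [->|->]] : exists n : nat, i = n%:Z \/ i = - n%:Z.
    - by case: i {wi} => n; [exists n; left | exists n.+1; right].
    - exact: tX.
    - have wn : w ^+ n != 0 by rewrite expf_neq0.
      have wV : w ^ (- n%:Z) != 0 by rewrite expfz_neq0.
      rewrite -{1}(tX n) (rDD hr) // mulr1 -exprnN mulVf // Dm1; exact: (r1 hr).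
  have ai : a / w ^ i != 0 by rewrite mulf_neq0 ?invr_eq0.
  have -> : Dm a 1 = Dm (w ^ i) 1 *m Dm (a / w ^ i) 1.
    by rewrite DmM mul1r mulrCA mulfV // mulr1.
  rewrite (rM hr _ (inGD wi o0) (inGD ai o0)) hD //.
  by rewrite (vf hF) // (vw_expz hF w0 vw) subrr (v1 hF).
move=> hg; rewrite (line_det hF w0 vw hrho hU') // ?hD1 // => a d a0 d0.
have [c c0 /eqP] := eigmod_Dm hF w0 vw hrho hZ sZ (eZ _ ht)
  (fun a d a0 d0 e => eZ _ (hD a d a0 d0 e)) a0 d0.
by rewrite subr_eq0 => /eqP ->; exists c.
Qed.

Definition extension (f : W) : V := phi (f - f 1%:M *: one) + f 1%:M *: delta.

Let k1 (f : W) : inInd v c1 f -> kap v c1 (f - f 1%:M *: one).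
Proof.
move=> hf; split; first by apply: (subB indS hf); apply: (subZ indS); apply: (one_Ind k hF).
have -> : (f - f 1%:M *: one) 1%:M = f 1%:M - f 1%:M * one 1%:M by [].
by rewrite oneE // mulr1 subrr.
Qed.

Lemma extension_kap (f : W) : kap v c1 f -> extension f = phi f.
Proof. by case=> _ f0; rewrite /extension f0 !scale0r subr0 addr0. Qed.

Lemma extension_lin a (f g : W) : inInd v c1 f -> inInd v c1 g ->
  extension (a *: f + g) = a *: extension f + extension g.
Proof.
move=> hf hg; rewrite /extension.
have -> : (a *: f + g) 1%:M = a * f 1%:M + g 1%:M by [].
have -> : a *: f + g - (a * f 1%:M + g 1%:M) *: one =
    a *: (f - f 1%:M *: one) + (g - g 1%:M *: one).
  by rewrite scalerBr scalerA scalerDl opprD addrACA.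
by rewrite (hphi _ (k1 hf) (k1 hg)) scalerDl !scalerDr !scalerA addrACA.
Qed.

Lemma extension_one : extension one = delta.
Proof.
rewrite /extension oneE // !scale1r subrr (linon0 kapS hphi) add0r //.
Qed.

Lemma extension_equiv g (f : W) : inG g -> inInd v c1 f -> extension (rtW g f) = rho g (extension f).
Proof.
have Iz : inInd v c1 one by apply: (one_Ind k hF).
have [[hx _] _] := phi_e2_eigv.
(* The functions on which equivariance holds for all g form a P-stable subspace, so by
   [kap_irreducible] the single function [e2] has to be checked. *)
pose S (f : W) := kap v c1 f /\ forall g, inG g -> extension (rtW g f) = rho g (phi f).
have Sk (f' : W) (kf' : kap v c1 f') : S f'.
  apply: (kap_irreducible hF (smooth_chi1 k v) pk hR w0 vw (S := S) _ _ _ _ kf').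
  - split=> [|f1 f2 [k1' h1] [k2' h2]|a f1 [k1' h1]].
    + split; first exact: (sub0 kapS).
      move=> g' hg'; rewrite (lin0 (rlin hrt hg')) extension_kap; last exact: (sub0 kapS).
      by rewrite (linon0 kapS hphi) (lin0 (rlin hr hg')).
    + split; first exact: (subD kapS).
      move=> g' hg'; rewrite (linD (rlin hrt hg')).
      rewrite (linonD extension_lin); [|exact: (inInd_rt hF hg' (proj1 k1'))|exact: (inInd_rt hF hg' (proj1 k2'))].
      by rewrite h1 // h2 // (linonD hphi) // (linD (rlin hr hg')).
    + split; first exact: (subZ kapS).
      move=> g' hg'; rewrite (linZ (rlin hrt hg')).
      rewrite (linonZ indS extension_lin); last exact: (inInd_rt hF hg' (proj1 k1')).
      by rewrite h1 // (linonZ kapS hphi) // (linZ (rlin hr hg')).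
  - by move=> f1 [].
  - move=> b f1 hb [k1' h1]; split; first exact: (kap_rt hF hb k1').
    move=> g' hg'; have Gb := inP_inG hb.
    by rewrite -(rM hrt _ hg' Gb) (h1 _ (inGM hg' Gb)) (phiP hb k1') (rM hr _ hg' Gb).
  - exists e2; last exact: (cellfun_neq0 (smooth_chi1 k v)).
    split=> // g' hg'; have [b [i [hb hi e]]] := iwasawa hF w0 vw hg'.
    have Gb := inP_inG hb; have GP := inGPm w0; have kb := kap_rt hF hb ke.
    have Gi : inG i by apply: (GamG hF) hi.
    case: e => ->.
      rewrite (rM hrt _ Gb Gi) (rM hr _ Gb Gi) (e2_fixed k hF w0 vw hi) (hx i hi).
      by rewrite extension_kap // phiP.
    rewrite (rM hrt _ (inGM Gb GP) Gi) (rM hr _ (inGM Gb GP) Gi) (e2_fixed k hF w0 vw hi) (hx i hi).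
    rewrite (rM hrt _ Gb GP) (rM hr _ Gb GP).
    have -> : rtW Pm e2 = one - e2 by rewrite -(e2_P k hF w0 vw) [e2 + _]addrC addrK.
    rewrite (linB (rlin hrt Gb)) one_rt // (linonB indS extension_lin) //; last exact: (proj1 kb).
    rewrite extension_one extension_kap // phiP // -{1}(delta_fixed Gb) -(linB (rlin hr Gb)).
    by rewrite /delta [X in X - _]addrC addrK.
move=> hg hf; have e0 : f = (f - f 1%:M *: one) + f 1%:M *: one by rewrite subrK.
have kf := k1 hf; have [_ /(_ g hg) h] := Sk _ kf.
rewrite e0 (linD (rlin hrt hg)) (linZ (rlin hrt hg)) one_rt //.
have Ig := inInd_rt hF hg (proj1 kf).
have Io a : inInd v c1 (a *: one : W) by apply: (subZ indS).
rewrite (linonD extension_lin Ig (Io _)) (linonD extension_lin (proj1 kf) (Io _)).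
rewrite !(linonZ indS extension_lin) // extension_one h extension_kap //.
by rewrite (linD (rlin hr hg)) (linZ (rlin hr hg)) delta_fixed.
Qed.
End Extension.

(** The constant function is [e2] plus its translate by [Pm], so its image is forced. *)
Lemma extension_unique (Phi1 Phi2 : W -> V) :
  (forall a (f g : W), inInd v c1 f -> inInd v c1 g -> Phi1 (a *: f + g) = a *: Phi1 f + Phi1 g) ->
  (forall a (f g : W), inInd v c1 f -> inInd v c1 g -> Phi2 (a *: f + g) = a *: Phi2 f + Phi2 g) ->
  (forall g f, inG g -> inInd v c1 f -> Phi1 (rtW g f) = rho g (Phi1 f)) ->
  (forall g f, inG g -> inInd v c1 f -> Phi2 (rtW g f) = rho g (Phi2 f)) ->
  (forall f : W, kap v c1 f -> Phi1 f = Phi2 f) ->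
  forall f : W, inInd v c1 f -> Phi1 f = Phi2 f.
Proof.
move=> l1 l2 g1 g2 e f hf.
have ke := kap_e2 k hF; have Iz := one_Ind k hF; have GP := inGPm w0.
have eo : Phi1 one = Phi2 one.
  have IP := inInd_rt hF GP (proj1 ke).
  rewrite -(e2_P k hF w0 vw) (linonD l1 (proj1 ke) IP) (linonD l2 (proj1 ke) IP).
  by rewrite g1 ?g2 ?(e _ ke) //; case: ke.
have kf : kap v c1 (f - f 1%:M *: one).
  split; first by apply: (subB indS hf); apply: (subZ indS).
  have -> : (f - f 1%:M *: one) 1%:M = f 1%:M - f 1%:M * one 1%:M by [].
  by rewrite oneE // mulr1 subrr.
rewrite -(subrK (f 1%:M *: one) f : _ = f :> W).
have Io : inInd v c1 (f 1%:M *: one : W) by apply: (subZ indS).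
rewrite (linonD l1 (proj1 kf) Io) (linonD l2 (proj1 kf) Io) (e _ kf).
by rewrite (linonZ indS l1) // (linonZ indS l2) // eo.
Qed.
End Steinberg.

(** * Restriction of irreducible representations to P *)

Lemma det_congr (p : nat) (F : fieldType) (v : F -> int) (hF : nonarch_local_field p v) n g :
  (0 < n)%N -> congr_sub v n g -> inpn v n (\det g - 1).
Proof.
move=> n0; move: g; apply: mx_ind2 => a b c d /congr_sub_mk /and4P[ha hb hc hd]; apply/inpnP.
have n1 : 1 <= n%:Z by rewrite lez_nat.
have n00 : 0 <= n%:Z by [].
rewrite det_mk addrAC; apply: (inpB hF); first by rewrite (one_mul hF).
by rewrite (inpMr hF) //; apply: inp_le hc.
Qed.

Section Restriction.
Variables (p : nat) (F : fieldType) (k : closedFieldType) (v : F -> int).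
Hypotheses (pp : prime p) (pk : p \in [pchar k]).
Hypothesis hF : nonarch_local_field p v.
Variable R : seq F.
Hypothesis hR : residues v R.
Variable w : F.
Hypotheses (w0 : w != 0) (vw : v w = 1).
Notation inp := (inp v).
Notation tm := (tm w).
Notation Pm := (Pm w).
Notation W := ('M[F]_2 -> k^o).
Variables (V : lmodType k) (rho : 'M[F]_2 -> V -> V).
Hypothesis hrho : is_rep v (@inG F) rho.
Let hr : grep rho := is_rep_grep hrho.
Notation Nop := (Nop R w rho).
Notation Dop := (Dop R w rho).

Lemma nonzero_ex (S : V -> Prop) : ~ (forall x, S x -> x = 0) -> exists2 x, S x & x != 0.
Proof.
move=> h; apply: contrapT => nx; apply: h => x Sx; apply/eqP; apply: contrapT => x0.
by apply: nx; exists x => //; apply/negP.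
Qed.

(** The composition series is cut out by evaluation at 1, whose kernel is irreducible and has
    codimension one. *)
Lemma principal_length2 : principal_series v rho -> length2 (@inP F) rho.
Proof.
case=> chi [hchi _ [T [T1 T2 T3 T4 T5]]]; have o0 := oner_neq0 k.
have indS := inInd_subspace v chi; have kapS := kap_subspace v chi.
have lT : lin (T : V -> W) by [].
pose S x := kap v chi (T x).
have ncell := cellfun_neq0 hchi.
exists S; split.
- split=> [|x y Sx Sy|a x Sx]; rewrite /S.
  + by rewrite (lin0 lT); apply: (sub0 kapS).
  + by rewrite (linD lT); apply: (subD kapS).
  + by rewrite (linZ lT); apply: (subZ kapS).
- by move=> b x hb Sx; rewrite /S (T5 _ _ (inP_inG hb)); apply: (kap_rt hF hb Sx).
- split.
    have [x hx] := T4 _ (cellfun_Ind hF hchi); exists x; split; first by rewrite /S hx; apply: (kap_cellfun hF).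
    by apply: contra_neq ncell => x0; rewrite -hx x0 (lin0 lT).
  move=> S' hS' sS' sub; have [h|h] := pselect (forall x, S' x -> x = 0); first by left.
  right=> x Sx; have [y Sy y0] := nonzero_ex h.
  pose S1 (f : W) := exists2 x, S' x & T x = f.
  have [x' Sx' /T3 <- //] : S1 (T x).
  apply: (kap_irreducible hF hchi pk hR w0 vw (S := S1) _ _ _ _ Sx).
  + split=> [|_ _ [a Sa <-] [b Sb <-]|c _ [a Sa <-]].
    * by exists 0; [apply: (sub0 hS') | apply: (lin0 lT)].
    * by exists (a + b); [apply: (subD hS') | apply: (linD lT)].
    * by exists (c *: a); [apply: (subZ hS') | apply: (linZ lT)].
  + by move=> _ [a Sa <-]; apply: sub.
  + move=> b _ hb [a Sa <-]; exists (rho b a); first exact: sS'.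
    by rewrite T5 //; apply: inP_inG.
  + exists (T y); first by exists y.
    by apply: contra_neq y0 => Ty; apply: T3; rewrite Ty (lin0 lT).
split.
  have [x hx] := T4 _ (inInd_rt hF (inGs F) (cellfun_Ind hF hchi)); exists x => -[_].
  rewrite hx => E.
  have e : gf (cellfun v chi) 0 = 0.
    by move: E; rewrite /rt mul1mx /gf Um0 mulmx1.
  have := cellfun_gf hchi 0; rewrite inp0 => E'.
  by have /eqP := eq_trans (esym E') e; rewrite (negPf o0).
move=> S' hS' sS' sub; have [h|h] := pselect (forall x, S' x -> S x); first by left.
right=> y; have [x Sx nx] : exists2 x, S' x & ~ S x.
  by apply: contrapT => n; apply: h => x Sx; apply: contrapT => nx; apply: n; exists x.
have x1 : T x 1%:M != 0 by apply/eqP => e; apply: nx; split.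
rewrite -(subrK ((T y 1%:M / T x 1%:M) *: x) y); apply: (subD hS'); last exact: (subZ hS').
apply: sub; split=> //; rewrite (linB lT) (linZ lT).
have -> : (T y - (T y 1%:M / T x 1%:M) *: (T x : W) : W) 1%:M =
  T y 1%:M - T y 1%:M / T x 1%:M * T x 1%:M by [].
by rewrite divfK // subrr.
Qed.

Hypothesis hirr : irreducible (@inG F) rho.

Lemma irreducible_span x : x != 0 -> forall y, span (@inG F) rho x y.
Proof.
move=> x0; case: hirr => _ /(_ (span (@inG F) rho x)) [||h|//].
- exact: span_subspace.
- by apply: span_stable => // g h; apply: inGM.
- by move: x0; rewrite (h x) ?eqxx //; apply: span_self.
Qed.

Hypothesis hcc : central_char rho.

Lemma hecke_eigenvector_ex (S : V -> Prop) : subspace S -> stable (@inP F) rho S ->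
  (exists2 x, S x & x != 0) ->
  exists chi c, exists2 x, S x & [/\ x != 0, eigv v rho chi x & Nop x = c *: x].
Proof.
move=> hS sS h; have [chi [y Sy [y0 ey]]] := eigv_ex pp pk hF hR w0 vw hrho hS sS hcc h.
have [P P0 hP] := hecke_torsion pp pk hF hR w0 vw hr irreducible_span ey y0.
have [Q [c [x0 hx]]] := pact_eigen (lin_Nop R w0 hr) P0 hP y0.
exists chi, c, (pact Nop Q y); last split=> //.
  by apply: (pact_sub hS) => // z Sz; apply: (sub_N R w0 hS sS).
by apply: (pact_sub (eigv_subspace hF hr chi)) => // z; apply: (eigv_N hF hR w0 vw hr).
Qed.

Section Functional.
Variable S : V -> Prop.
Hypotheses (hS : subspace S) (sS : stable (@inP F) rho S).
Variable e : V.
Hypothesis nSe : ~ S e.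
Hypothesis eU : forall x, S (rho (Um x) e - e).
Hypothesis eD : forall a d, a != 0 -> d != 0 -> eigmod rho S (Dm a d) e.
Hypothesis full : forall x, exists c, S (x - c *: e).
Hypothesis Sne : exists2 x, S x & x != 0.

(** The functional V -> V/S in the basis e, on which P acts through a character. *)
Definition coefS (x : V) : k := sval (cid (full x)).

Lemma coefSP x : S (x - coefS x *: e). Proof. exact: svalP (cid (full x)). Qed.

Lemma coefS_eq x c : S (x - c *: e) -> coefS x = c.
Proof.
move=> h; apply/eqP; rewrite -subr_eq0; apply: contrapT => /negP nz; apply: nSe.
have := subB hS h (coefSP x); rewrite opprB addrC addrA subrK -scalerBl.
by move=> /(subZ hS (coefS x - c)^-1); rewrite scalerA mulVf // scale1r.
Qed.

Lemma coefS_lin a x y : coefS (a *: x + y) = a * coefS x + coefS y.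
Proof.
apply: coefS_eq; rewrite scalerDl -scalerA opprD addrACA -scalerBr.
by apply: (subD hS); [apply: (subZ hS) |]; apply: coefSP.
Qed.

Lemma coefS_S x : S x -> coefS x = 0.
Proof. by move=> Sx; apply: coefS_eq; rewrite scale0r subr0. Qed.

Lemma coefS_e : coefS e = 1.
Proof. by apply: coefS_eq; rewrite scale1r subrr; apply: (sub0 hS). Qed.

Definition chiS a d : k := coefS (rho (Dm a d) e).

Lemma coefS_P b x : inP b -> coefS (rho b x) = chiS (b ord0 ord0) (b ord_max ord_max) * coefS x.
Proof.
move=> hb; have [a0 d0] := inP_diag hb; have Gb := inP_inG hb.
have E y : coefS (rho b y) = coefS (rho b e) * coefS y.
  have sx := coefS_S (sS hb (coefSP y)).
  rewrite -{1}(subrK (coefS y *: e) y) addrC (linD (rlin hr Gb)) (linZ (rlin hr Gb)).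
  by rewrite coefS_lin sx addr0 mulrC.
rewrite E; congr (_ * _); rewrite {1}(inP_UD hb) (rM hr _ (inGU _) (inGD a0 d0)).
have [c c0 ec] := eD a0 d0.
rewrite /chiS (coefS_eq ec); apply: coefS_eq.
set u := b ord0 ord_max / _; set z := rho (Dm _ _) e in ec *.
have -> : rho (Um u) z - c *: e = rho (Um u) (z - c *: e) + c *: (rho (Um u) e - e).
  rewrite (linB (rlin hr (inGU u))) (linZ (rlin hr (inGU u))) scalerBr.
  by rewrite addrA subrK.
by apply: (subD hS); [apply: sS => //; apply: inPU | apply: (subZ hS)].
Qed.

Lemma chiS_smooth : smooth_charT v chiS.
Proof.
split=> [a d a0 d0|a d a' d' a0 d0 a'0 d'0|].
- by have [c c0 ec] := eD a0 d0; rewrite /chiS (coefS_eq ec).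
- by rewrite /chiS -(rDD hr) // coefS_P ?mkE //; apply: inPD.
case: hrho => _ _ _ /(_ e) [n [n0 hn]]; exists n; split=> // a d /inpnP ha /inpnP hd.
have n1 : 1 <= n%:Z by rewrite lez_nat.
have a0 := vunit_neq0 (one_vunit hF (inp_le n1 ha)).
have d0 := vunit_neq0 (one_vunit hF (inp_le n1 hd)).
rewrite /chiS hn ?coefS_e //; last exact: inGD.
by apply/congr_sub_mk; rewrite ha hd inp0.
Qed.

(** Frobenius reciprocity applied to [coefS]. *)
Definition toInd (x : V) : W := fun g => if \det g != 0 then coefS (rho g x) else 0.

Lemma toIndE x g : inG g -> toInd x g = coefS (rho g x).
Proof. by rewrite /inG /toInd => ->. Qed.

Lemma toInd_lin : lin toInd.
Proof.
move=> a x y; apply: funext => g.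
have -> : (a *: toInd x + toInd y) g = a * toInd x g + toInd y g by [].
rewrite /toInd; case: ifP => hg; last by rewrite mulr0 addr0.
by rewrite (rlin hr hg) coefS_lin.
Qed.

Lemma toInd_Ind x : inInd v chiS (toInd x).
Proof.
split=> [h|b h hb hh|h hh].
- by rewrite /inG /toInd; case: eqP => // _ [].
- have Gb := inP_inG hb.
  by rewrite (toIndE _ (inGM Gb hh)) (toIndE _ hh) (rM hr _ Gb hh) coefS_P.
- case: hrho => _ _ _ /(_ x) [n [n0 hn]]; exists n; split=> // g hg.
  have Gg := congr_inG hF n0 hg.
  by rewrite (toIndE _ (inGM hh Gg)) (toIndE _ hh) (rM hr _ hh Gg) hn.
Qed.

Lemma toInd_rt g x : inG g -> toInd (rho g x) = rt g (toInd x).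
Proof.
move=> hg; apply: funext => h; rewrite /rt /toInd det_mulmx mulf_eq0 negb_or.
by rewrite (_ : \det g != 0) // andbT; case: ifP => // hh; rewrite (rM hr _ hh hg).
Qed.

Lemma toInd_inj : injective toInd.
Proof.
case: hirr => _ /(_ (fun x => toInd x = 0)) [||h|h].
- split=> [|x y hx hy|a x hx]; first exact: (lin0 toInd_lin).
    by rewrite (linD toInd_lin) hx hy addr0.
  by rewrite (linZ toInd_lin) hx scaler0.
- by move=> g x hg hx; rewrite toInd_rt // hx.
- move=> x y E; apply/eqP; rewrite -subr_eq0; apply/eqP; apply: h.
  by rewrite (linB toInd_lin) E subrr.
have /(congr1 (fun f => f 1%:M)) := h e; rewrite toIndE // (r1 hr) coefS_e => /eqP.
by rewrite oner_eq0.
Qed.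

Lemma toInd_kap f : kap v chiS f -> exists2 x, S x & toInd x = f.
Proof.
pose S1 (f : W) := exists2 x, S x & toInd x = f.
move=> kf; apply: (kap_irreducible hF chiS_smooth pk hR w0 vw (S := S1) _ _ _ _ kf).
- split=> [|_ _ [a Sa <-] [b Sb <-]|c _ [a Sa <-]].
  + by exists 0; [apply: (sub0 hS) | apply: (lin0 toInd_lin)].
  + by exists (a + b); [apply: (subD hS) | apply: (linD toInd_lin)].
  + by exists (c *: a); [apply: (subZ hS) | apply: (linZ toInd_lin)].
- move=> _ [a Sa <-]; split; first exact: toInd_Ind.
  by rewrite toIndE // (r1 hr) coefS_S.
- move=> b _ hb [a Sa <-]; exists (rho b a); first exact: sS.
  by rewrite toInd_rt //; apply: inP_inG.
- have [x Sx x0] := Sne; exists (toInd x); first by exists x.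
  by apply: contra_neq x0 => E; apply: toInd_inj; rewrite E (lin0 toInd_lin).
Qed.

Lemma toInd_surj f : inInd v chiS f -> exists x, toInd x = f.
Proof.
move=> hf; have indS := inInd_subspace v chiS.
have [|x _ hx] := @toInd_kap ((f : W) - f 1%:M *: toInd e).
  split; first by apply: (subB indS) => //; apply: (subZ indS); apply: toInd_Ind.
  have -> : ((f : W) - f 1%:M *: toInd e) 1%:M = f 1%:M - f 1%:M * toInd e 1%:M by [].
  by rewrite toIndE // (r1 hr) coefS_e mulr1 subrr.
by exists (x + f 1%:M *: e); rewrite (linD toInd_lin) (linZ toInd_lin) hx subrK.
Qed.

(** A character equal to its swap factors through the determinant, so Ind contains a G-stable line.
    Then V, isomorphic to Ind, would be that line, leaving no room for a proper nonzero S. *)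
Lemma chiS_neq : chi_neq_s chiS.
Proof.
apply: contrapT => neq; have o0 := oner_neq0 F.
have [chi0 chiM [n [n0 chi1]]] := chiS_smooth.
have sw a d : a != 0 -> d != 0 -> chiS a d = chiS d a.
  by move=> a0 d0; apply: contrapT => ne; apply: neq; exists a, d; split=> //; apply/eqP.
have chid a d : a != 0 -> d != 0 -> chiS a d = chiS (a * d) 1.
  move=> a0 d0; have -> : chiS a d = chiS a 1 * chiS 1 d by rewrite -chiM // mulr1 mul1r.
  by rewrite [chiS 1 d]sw // -chiM // mulr1.
pose f (g : 'M[F]_2) : k := if \det g != 0 then chiS (\det g) 1 else 0.
have fI : inInd v chiS f.
  split=> [h|b h hb hh|h hh].
  - by rewrite /inG /f; case: eqP => // _ [].
  - have [a0 d0] := inP_diag hb; rewrite /f det_mulmx mulf_eq0 negb_or.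
    have hbd : \det b = b ord0 ord0 * b ord_max ord_max.
      by case: hb => _ e0; rewrite {1}(mk_eta b) det_mk e0 mulr0 subr0.
    rewrite hbd mulf_neq0 //= (_ : \det h != 0) // (chid _ _ a0 d0) -chiM ?mulf_neq0 //.
    by rewrite mulr1.
  - exists n; split=> // g hg; have Gg := congr_inG hF n0 hg.
    rewrite /f det_mulmx mulf_eq0 negb_or (_ : \det h != 0) // (_ : \det g != 0) //=.
    rewrite -[X in chiS _ X]mulr1 chiM // [chiS (\det g) 1]chi1 ?mulr1 //; last first.
      by apply/inpnP; rewrite subrr inp0.
    exact: (det_congr hF n0 hg).
have [x hx] := toInd_surj fI.
have xg g : inG g -> rho g x = chiS (\det g) 1 *: x.
  move=> hg; apply: toInd_inj; rewrite toInd_rt // (linZ toInd_lin) hx; apply: funext => h.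
  have -> : (chiS (\det g) 1 *: (f : W)) h = chiS (\det g) 1 * f h by [].
  rewrite /rt /f det_mulmx mulf_eq0 negb_or (_ : \det g != 0) // andbT.
  case: ifP => hh; last by rewrite mulr0.
  by rewrite -chiM // mulr1 mulrC.
have [s Ss s0] := Sne.
case: hirr => _ /(_ (fun y => exists c, y = c *: x)) [||h|h].
- split=> [|_ _ [a ->] [b ->]|c _ [a ->]].
  + by exists 0; rewrite scale0r.
  + by exists (a + b); rewrite scalerDl.
  + by exists (c * a); rewrite scalerA.
- move=> g _ hg [c ->]; exists (c * chiS (\det g) 1).
  by rewrite (linZ (rlin hr hg)) xg // scalerA.
- have x0 : x = 0 by apply: h; exists 1; rewrite scale1r.
  move: hx; rewrite x0 (lin0 toInd_lin) => /(congr1 (fun f => f 1%:M)).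
  rewrite /f det1 o0 => /esym/eqP; apply/negP; exact: chi0.
have [c hc] := h s; have [d hd] := h e; apply: nSe; rewrite hd.
have c0 : c != 0 by apply: contra_neq s0 => c0; rewrite hc c0 scale0r.
have -> : x = c^-1 *: s by rewrite hc scalerA mulVf // scale1r.
by do 2!apply: (subZ hS).
Qed.

Lemma functional_principal : principal_series v rho.
Proof.
exists chiS; split; [exact: chiS_smooth | exact: chiS_neq | exists toInd; split].
- exact: toInd_lin.
- exact: toInd_Ind.
- exact: toInd_inj.
- exact: toInd_surj.
- by move=> g x; apply: toInd_rt.
Qed.
End Functional.

Theorem not_principal_irreducible : ~ principal_series v rho -> irreducible (@inP F) rho.
Proof.
move=> nps; have hx0 := proj1 hirr; split=> // S hS sS.
have [h|h] := pselect (forall x, S x -> x = 0); first by left.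
right; have Sne := nonzero_ex h.
have [chi [c [x Sx [x0 ex Nx]]]] := hecke_eigenvector_ex hS sS Sne.
have [hx hx'] := ex; have irr := irreducible_span x0.
have [SP|nSP] := pselect (S (rho Pm x)).
  by move=> y; apply: (sub_span_G hF w0 vw hr hS sS hx Sx SP) (irr y).
have [c0|c0] := eqVneq c 0.
  case: nSP; rewrite (P_of_N0 hF hR w0 vw hr hx) ?Nx ?c0 ?scale0r //.
  by apply: (subN hS); apply: (sub_D hR w0 hS sS).
case: nps; have [hP hP'] := eigv_P hF w0 vw hr ex.
have [_ _ chi0] := eigv_tchar hF hr ex x0.
(* On the one hand t Pm x = s diag(w, w) x = chi(w, w) s x, on the other c s x = s N x = Pm x + D x
   with D x in S. *)
have et : eigmod rho S tm (rho Pm x).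
  exists (chi w w / c); first by rewrite mulf_neq0 ?invr_eq0 ?chi0.
  have : c *: rho (sm F) x = rho Pm x + Dop x.
    by rewrite -(s_Nop hF hR w0 hr (fixed_fixU hP)) Nx (linZ (rlin hr (inGs F))).
  move=> /(congr1 (fun y => c^-1 *: y)); rewrite scalerA mulVf // scale1r => E.
  rewrite (rtP w0 hr) hx' // (linZ (rlin hr (inGs F))) E scalerA scalerDr addrC addKr.
  by apply: (subZ hS); apply: (sub_D hR w0 hS sS).
have eD a d : a != 0 -> d != 0 -> v a = v d -> eigmod rho S (Dm a d) (rho Pm x).
  move=> a0 d0 vad; exists (swap chi a d); first by apply: chi0.
  by rewrite hP' // subrr; apply: (sub0 hS).
have eU y : inp 0 y -> S (rho (Um y) (rho Pm x) - rho Pm x).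
  by move=> hy; rewrite (fixed_fixU hP) // subrr; apply: (sub0 hS).
have eDD := eigmod_Dm hF w0 vw hrho hS sS et eD.
have eUU := Um_mod hF w0 vw hrho hS sS eU et.
apply: (functional_principal hS sS nSP eUU (fun a d a0 d0 => eDD a d a0 d0)) => // y.
(* The preimage of the line of Pm x in V/S is P-stable and contains x and Pm x, hence it is V. *)
have hQ : subspace (fun y => exists c, S (y - c *: rho Pm x)).
  split=> [|y1 y2 [a Sa] [b Sb]|a y1 [b Sb]].
  - by exists 0; rewrite scale0r subr0; apply: (sub0 hS).
  - by exists (a + b); rewrite scalerDl opprD addrACA; apply: (subD hS).
  - by exists (a * b); rewrite -scalerA -scalerBr; apply: (subZ hS).
have sQ : stable (@inP F) rho (fun y => exists c, S (y - c *: rho Pm x)).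
  move=> b y1 hb [a Sa]; have Gb := inP_inG hb; have [a0 d0] := inP_diag hb.
  have [c' _ Sc'] := eigmodM hrho hS sS (inPU (b ord0 ord_max / b ord_max ord_max)) (inPD a0 d0)
    (ex_intro2 _ _ 1 (oner_neq0 k) (eq_ind_r (fun z => S (_ - z)) (eUU _) (scale1r _)))
    (eDD _ _ a0 d0).
  rewrite -(inP_UD hb) in Sc'; exists (a * c').
  have -> : rho b y1 - (a * c') *: rho Pm x =
     rho b (y1 - a *: rho Pm x) + a *: (rho b (rho Pm x) - c' *: rho Pm x).
    by rewrite (linB (rlin hr Gb)) (linZ (rlin hr Gb)) scalerBr scalerA addrA subrK.
  by apply: (subD hS); [apply: sS | apply: (subZ hS)].
apply: (sub_span_G hF w0 vw hr hQ sQ hx _ _ (irr y)).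
- by exists 0; rewrite scale0r subr0.
- by exists 1; rewrite scale1r subrr; apply: (sub0 hS).
Qed.
End Restriction.

(** * P-linear maps that are not G-linear *)

Section Cocycle.
Variables (p : nat) (F : fieldType) (k : closedFieldType) (v : F -> int).
Hypothesis pk : p \in [pchar k].
Hypothesis hF : nonarch_local_field p v.
Variable R : seq F.
Hypothesis hR : residues v R.
Variable w : F.
Hypotheses (w0 : w != 0) (vw : v w = 1).
Notation W := ('M[F]_2 -> k^o).
Notation c1 := (chi1 F k).
Notation one := (@one F k).
Variables (V : lmodType k) (rho : 'M[F]_2 -> V -> V).
Variables (V' : lmodType k) (rho' : 'M[F]_2 -> V' -> V').
Hypotheses (hrho : is_rep v (@inG F) rho) (hrho' : is_rep v (@inG F) rho').
Hypothesis hirr : irreducible (@inG F) rho.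
Let hr : grep rho := is_rep_grep hrho.
Let hr' : grep rho' := is_rep_grep hrho'.
Variable T : V -> V'.
Hypotheses (lT : lin T) (TP : forall b x, inP b -> T (rho b x) = rho' b (T x)).
Variables (delta : V') (psi : F -> k).
Hypotheses (delta0 : delta != 0) (psiS : smooth_char1 v psi).
Hypothesis deltaE : forall g, inG g -> rho' g delta = psi (\det g) *: delta.

Definition cocycle (y : V) (g : 'M[F]_2) : V' := T (rho g y) - rho' g (T y).

Hypothesis cocycle_line : forall y g, inG g -> exists c, cocycle y g = c *: delta.
Hypothesis cocycle_neq0 : exists x g, inG g /\ cocycle x g <> 0.

Let psi0 g : inG g -> psi (\det g) != 0. Proof. by case: psiS => h _ _; apply: h. Qed.
Let psiM g h : inG g -> inG h -> psi (\det (g *m h)) = psi (\det g) * psi (\det h).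
Proof. by case: psiS => _ hm _ hg hh; rewrite det_mulmx hm. Qed.

Lemma coef_ex y g : exists c : k, (inG g -> cocycle y g = (psi (\det g) * c) *: delta) /\
  (~ inG g -> c = 0).
Proof.
have [hg|ng] := pselect (inG g); last by exists 0.
have [c hc] := cocycle_line y hg; exists (c / psi (\det g)); split=> // _.
by rewrite hc mulrC divfK // psi0.
Qed.

Definition coef (y : V) : W := fun g => sval (cid (coef_ex y g)).

Lemma coefE y g : inG g -> cocycle y g = (psi (\det g) * coef y g) *: delta.
Proof. exact: (proj1 (svalP (cid (coef_ex y g)))). Qed.

Lemma coef_out y g : ~ inG g -> coef y g = 0.
Proof. exact: (proj2 (svalP (cid (coef_ex y g)))). Qed.

Lemma coef_eq y g c : inG g -> cocycle y g = (psi (\det g) * c) *: delta -> coef y g = c.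
Proof.
by move=> hg; rewrite coefE // => /(scale_inj delta0) /(mulfI (psi0 hg)).
Qed.

Lemma coef_lin : lin coef.
Proof.
move=> a x y; apply: funext => g.
have [hg|ng] := pselect (inG g); last first.
  have -> : (a *: coef x + coef y) g = a * coef x g + coef y g by [].
  by rewrite !coef_out // mulr0 addr0.
apply: (coef_eq (c := a * coef x g + coef y g)) => //; rewrite /cocycle (rlin hr hg) !lT (rlin hr' hg).
rewrite mulrDr mulrCA scalerDl -[(a * _) *: delta]scalerA -!coefE // /cocycle scalerBr opprD.
by rewrite addrACA.
Qed.

(** The cocycle relation. Subtracting the value at h is the action of G on Ind 1 modulo constants,
    each class being represented by its member vanishing at 1. *)
Lemma coef_act y g h : inG g -> inG h ->
  coef (rho h y) g = psi (\det h) * (coef y (g *m h) - coef y h).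
Proof.
move=> hg hh; apply: coef_eq => //; rewrite mulrA -psiM // mulrBr scalerBl -coefE; last exact: inGM.
rewrite psiM // -mulrA mulrC -scalerA -deltaE // -(linZ (rlin hr' hg)) -coefE // /cocycle.
by rewrite (linB (rlin hr' hg)) (rM hr _ hg hh) (rM hr' _ hg hh) opprB addrA subrK.
Qed.

Lemma coef_P y b : inP b -> coef y b = 0.
Proof.
move=> hb; apply: coef_eq; first exact: inP_inG.
by rewrite mulr0 scale0r /cocycle TP // subrr.
Qed.

Lemma coef_kap y : kap v c1 (coef y).
Proof.
split; last by apply: coef_P; split; rewrite ?mxE.
split=> [h|b h hb hh|h hh]; first exact: coef_out.
- have Gb := inP_inG hb; rewrite mul1r; apply: coef_eq; first exact: inGM.
  rewrite psiM // -mulrA -scalerA mulrC.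
  have -> : psi (\det b) *: ((coef y h * psi (\det h)) *: delta) = rho' b (cocycle y h).
    by rewrite coefE // (linZ (rlin hr' Gb)) deltaE // scalerA scalerA mulrC [coef y h * _]mulrC.
  by rewrite /cocycle (linB (rlin hr' Gb)) (rM hr _ Gb hh) (rM hr' _ Gb hh) TP.
case: hrho hrho' => _ _ _ /(_ y) [n1 [n10 hn1]] [_ _ _ /(_ (T y)) [n2 [n20 hn2]]].
case: psiS => _ _ [n3 [n30 hn3]].
have [m [m0 hm]] : exists m, (0 < m)%N /\ forall g, congr_sub v m g ->
    [/\ congr_sub v n1 g, congr_sub v n2 g & congr_sub v n3 g].
  exists (n1 + n2 + n3)%N; split; first by rewrite !addn_gt0 n10.
  move=> g hg; split; apply: congr_sub_le hg; rewrite -?addnA ?leq_addr //.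
    by rewrite addnCA leq_addr.
  by rewrite addnA leq_addl.
exists m; split=> // g hg; have Gg := congr_inG hF m0 hg; have [g1 g2 g3] := hm g hg.
apply: coef_eq; first exact: inGM.
have -> : psi (\det (h *m g)) = psi (\det h).
  by rewrite psiM // (hn3 _ (det_congr hF n30 g3)) mulr1.
by rewrite -coefE // /cocycle (rM hr _ hh Gg) (rM hr' _ hh Gg) hn1 // hn2.
Qed.

Lemma coef_inj : injective coef.
Proof.
case: hirr => _ /(_ (fun x => coef x = 0)) [||h|h].
- split=> [|x y hx hy|a x hx]; first exact: (lin0 coef_lin).
    by rewrite (linD coef_lin) hx hy addr0.
  by rewrite (linZ coef_lin) hx scaler0.
- move=> g x hg hx; apply: funext => h'; have [hh|nh] := pselect (inG h').
    by rewrite coef_act // hx subrr mulr0.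
  by rewrite coef_out.
- move=> x y E; apply/eqP; rewrite -subr_eq0; apply/eqP; apply: h.
  by rewrite (linB coef_lin) E subrr.
by case: cocycle_neq0 => x [g [hg []]]; rewrite coefE // h mulr0 scale0r.
Qed.

Lemma coef_surj f : kap v c1 f -> exists y, coef y = f.
Proof.
pose S1 (f : W) := exists y, coef y = f.
move=> kf; apply: (kap_irreducible hF (smooth_chi1 k v) pk hR w0 vw (S := S1) _ _ _ _ kf).
- split=> [|_ _ [a <-] [b <-]|c _ [a <-]].
  + by exists 0; apply: (lin0 coef_lin).
  + by exists (a + b); apply: (linD coef_lin).
  + by exists (c *: a); apply: (linZ coef_lin).
- by move=> _ [y <-]; apply: coef_kap.
- move=> b _ hb [y <-]; have Gb := inP_inG hb.
  exists ((psi (\det b))^-1 *: rho b y); rewrite (linZ coef_lin); apply: funext => g.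
  have -> : ((psi (\det b))^-1 *: coef (rho b y)) g = (psi (\det b))^-1 * coef (rho b y) g by [].
  have [hg|ng] := pselect (inG g).
    by rewrite coef_act // (coef_P y hb) subr0 mulrA mulVf ?psi0 // mul1r.
  rewrite coef_out // mulr0 /rt coef_out // => hg; apply: ng.
  by move: hg; rewrite /inG det_mulmx mulf_eq0 negb_or => /andP[].
- have [[x x0] _] := hirr; exists (coef x); first by exists x.
  by apply: contra_neq x0 => E; apply: coef_inj; rewrite E (lin0 coef_lin).
Qed.

Theorem cocycle_special : special_series v rho.
Proof.
have indS := inInd_subspace v c1; have Io := one_Ind k hF.
exists psi; split=> //.
have kf (f : W) : inInd v c1 f -> kap v c1 (f - f 1%:M *: one).
  move=> hf; split; first by apply: (subB indS) => //; apply: (subZ indS).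
  have -> : (f - f 1%:M *: one) 1%:M = f 1%:M - f 1%:M * one 1%:M by [].
  by rewrite oneE // mulr1 subrr.
(* The inverse of [coef], preceded by the projection along the constants. *)
have [|S hS] := @choice W V (fun f y => inInd v c1 f -> coef y = f - f 1%:M *: one).
  move=> f; have [hf|nf] := pselect (inInd v c1 f); last by exists 0.
  by have [y hy] := coef_surj (kf f hf); exists y.
exists S; split.
- move=> a f g hf hg; have hfg : inInd v c1 (a *: (f : W) + g).
    by apply: (subD indS) => //; apply: (subZ indS).
  apply: coef_inj; rewrite coef_lin !hS //.
  have -> : lc a f g 1%:M = a * f 1%:M + g 1%:M by [].
  have -> : lc a f g = a *: (f : W) + g by [].
  by rewrite scalerDl scalerBr scalerA opprD addrACA.
- move=> x; have [hx x1] := coef_kap x; exists (coef x) => //; apply: coef_inj.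
  by rewrite hS // x1 scale0r subr0.
- move=> f hf; split=> [E|[c hc]].
    exists (f 1%:M) => h hh; have := hS f hf; rewrite E (lin0 coef_lin).
    move/esym/eqP; rewrite subr_eq0 => /eqP /(congr1 (fun f => f h)) ->.
    have -> : (f 1%:M *: one) h = f 1%:M * one h by [].
    by rewrite oneE // mulr1.
  apply: coef_inj; rewrite (lin0 coef_lin) hS //; apply: funext => h.
  have -> : ((f : W) - f 1%:M *: one) h = f h - f 1%:M * one h by [].
  have [hh|nh] := pselect (inG h); first by rewrite oneE // mulr1 !hc ?subrr.
  have [f0 _ _] := hf; have [o0 _ _] := Io.
  by rewrite f0 // o0 // mulr0 subrr.
move=> g f hg hf; set f' := (fun h => _).
have hf' : inInd v c1 f' by apply: (subZ indS (psi (\det g)) (inInd_rt hF hg hf)).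
apply: coef_inj; rewrite hS //; apply: funext => h.
have -> : ((f' : W) - f' 1%:M *: one) h = f' h - f' 1%:M * one h by [].
have [hh|nh] := pselect (inG h); last first.
  by case: hf' => f'0 _ _; case: Io => o0 _ _; rewrite f'0 // o0 // mulr0 subrr coef_out.
rewrite oneE // mulr1 coef_act // hS // /f' /rt mul1mx -mulrBr; congr (_ * _).
have E h' : ((f : W) - f 1%:M *: one) h' = f h' - f 1%:M * one h' by [].
by rewrite !E !oneE ?mulr1 //; [rewrite opprB addrA subrK | apply: inGM].
Qed.
End Cocycle.

(** * Equivariance under G of P-linear maps *)

Section Equivariance.
Variables (p : nat) (F : fieldType) (k : closedFieldType) (v : F -> int).
Hypotheses (pp : prime p) (pk : p \in [pchar k]).
Hypothesis hF : nonarch_local_field p v.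
Variable R : seq F.
Hypothesis hR : residues v R.
Variable w : F.
Hypotheses (w0 : w != 0) (vw : v w = 1).
Notation inp := (inp v).
Notation tm := (tm w).
Notation Pm := (Pm w).
Variables (V : lmodType k) (rho : 'M[F]_2 -> V -> V).
Variables (V' : lmodType k) (rho' : 'M[F]_2 -> V' -> V').
Hypotheses (hrho : is_rep v (@inG F) rho) (hrho' : is_rep v (@inG F) rho').
Hypotheses (hirr : irreducible (@inG F) rho) (hcc : central_char rho).
Let hr : grep rho := is_rep_grep hrho.
Let hr' : grep rho' := is_rep_grep hrho'.
Variable T : V -> V'.
Hypotheses (lT : lin T) (TP : forall b x, inP b -> T (rho b x) = rho' b (T x)).

Lemma T_Nop x : T (Nop R w rho x) = Nop R w rho' (T x).
Proof.
rewrite /Nop (lin_sum lT); apply: eq_bigr => r _.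
by rewrite (TP _ (inPU r)) (TP _ (inPt w0)).
Qed.

Lemma T_Dop x : T (Dop R w rho x) = Dop R w rho' (T x).
Proof.
rewrite /Dop (lin_sum lT) !big_seq; apply: eq_bigr => r /(res_unit hR) /vunit_neq0 r0.
have hP : inP (Dm (- r^-1) r) by apply: inPD; rewrite ?oppr_eq0 ?invr_eq0.
by rewrite (TP _ (inPU _)) (TP _ hP) (TP _ (inPt w0)).
Qed.

Lemma T_fixU x : fixU v rho x -> fixU v rho' (T x).
Proof. by move=> h y hy; rewrite -(TP _ (inPU y)) h. Qed.

Lemma T_fixD x : fixD v rho x -> fixD v rho' (T x).
Proof.
move=> h a d ha hd; have a0 := vunit_neq0 (one_vunit hF ha).
have d0 := vunit_neq0 (one_vunit hF hd); by rewrite -(TP _ (inPD a0 d0)) h.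
Qed.

Lemma equivariant_of_generator x : x != 0 -> fixed rho (Gam v 0 1) x ->
  fixed rho' (Gam v 0 1) (T x) -> T (rho Pm x) = rho' Pm (T x) ->
  forall g y, inG g -> T (rho g y) = rho' g (T y).
Proof.
move=> x0 hx hTx e g y hg.
have base h : inG h -> T (rho h x) = rho' h (T x).
  move=> hh; have [b [i [hb hi eh]]] := iwasawa hF w0 vw hh.
  have Gb := inP_inG hb; have Gi : inG i by apply: (GamG hF) hi.
  have GP := inGPm w0; case: eh => ->.
    by rewrite (rM hr _ Gb Gi) (rM hr' _ Gb Gi) hx // hTx // TP.
  rewrite (rM hr _ (inGM Gb GP) Gi) (rM hr' _ (inGM Gb GP) Gi) hx // hTx //.
  by rewrite (rM hr _ Gb GP) (rM hr' _ Gb GP) TP // e.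
elim: (irreducible_span hrho hirr x0 y) => [|a h z hh _ IH].
  by rewrite (lin0 (rlin hr hg)) (lin0 lT) (lin0 (rlin hr' hg)).
rewrite (rlin hr hg) !lT (rlin hr' hg) IH -(rM hr _ hg hh) -?base //.
by rewrite base ?(rM hr' _ hg hh) ?base //; apply: inGM.
Qed.

Lemma equivariant_of_eigenvector chi c x : ~ special_series v rho ->
  x != 0 -> eigv v rho chi x -> Nop R w rho x = c *: x -> c != 0 ->
  forall g y, inG g -> T (rho g y) = rho' g (T y).
Proof.
move=> nsp x0 ex Nx c0; have [hx hx'] := ex; have o0 := oner_neq0 F.
have GP := inGPm w0; have Gs := inGs F.
have [hP hP'] := eigv_P hF w0 vw hr ex.
have hTx : fixed rho' (Gam v 0 1) (T x).
  apply: (Nop_eigen_fixed hF hR w0 vw hr' hrho' c0).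
  - by rewrite -T_Nop Nx (linZ lT).
  - exact: T_fixU (fixed_fixU hx).
  - exact: T_fixD (fixed_fixD hx).
have eTx : eigv v rho' chi (T x).
  by split=> // a d a0 d0 e; rewrite -(TP _ (inPD a0 d0)) hx' // (linZ lT).
have [hP1 hP1'] := eigv_P hF w0 vw hr' eTx.
pose delta := T (rho Pm x) - rho' Pm (T x).
have [d0|delta0] := eqVneq delta 0.
  by apply: (equivariant_of_generator x0 hx hTx); apply/eqP; rewrite -subr_eq0; apply/eqP.
have [_ _ chi0] := eigv_tchar hF hr ex x0.
(* Comparing c s x = Pm x + D x before and after T, the D terms cancel, so delta is also c times the
   defect of T at s; and t turns the defect at Pm into chi(w, w) times the defect at s. *)
have td : rho' tm delta = (chi w w / c) *: delta.
  have sE : c *: rho (sm F) x = rho Pm x + Dop R w rho x.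
    by rewrite -(s_Nop hF hR w0 hr (fixed_fixU hP)) Nx (linZ (rlin hr Gs)).
  have sE' : c *: rho' (sm F) (T x) = rho' Pm (T x) + Dop R w rho' (T x).
    rewrite -(s_Nop hF hR w0 hr' (fixed_fixU hP1)) -T_Nop Nx (linZ lT).
    by rewrite (linZ (rlin hr' Gs)).
  have E : c *: (T (rho (sm F) x) - rho' (sm F) (T x)) = delta.
    by rewrite scalerBr -(linZ lT) sE sE' (linD lT) T_Dop opprD addrACA subrr addr0.
  rewrite -[in RHS]E scalerA divfK // /delta (linB (rlin hr' (inGt w0))) -TP; last exact: inPt.
  rewrite (rtP w0 hr) (rtP w0 hr') hx' // -(TP _ (inPD w0 w0)) hx' // (linZ lT).
  by rewrite (linZ (rlin hr Gs)) (linZ (rlin hr' Gs)) (linZ lT) scalerBr.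
pose Z (y : V') := y = 0.
have hZ : subspace Z by split=> [|y z -> ->|a y ->]; rewrite /Z ?addr0 ?scaler0.
have sZ : stable (@inP F) rho' Z by move=> b y hb ->; apply: (lin0 (rlin hr' (inP_inG hb))).
have eZ b a : a != 0 -> rho' b delta = a *: delta -> eigmod rho' Z b delta.
  by move=> a0 e; exists a; rewrite // e /Z subrr.
have et : eigmod rho' Z tm delta.
  by apply: eZ td; rewrite mulf_neq0 ?invr_eq0 // chi0.
have eU y : inp 0 y -> Z (rho' (Um y) delta - delta).
  move=> hy; rewrite /Z /delta (linB (rlin hr' (inGU y))) -(TP _ (inPU y)).
  by rewrite (fixed_fixU hP) // (fixed_fixU hP1) // subrr.
have eD a d : a != 0 -> d != 0 -> v a = v d -> eigmod rho' Z (Dm a d) delta.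
  move=> a0 d0 e; apply: (eZ _ (swap chi a d)); first exact: chi0.
  rewrite /delta (linB (rlin hr' (inGD a0 d0))) -(TP _ (inPD a0 d0)) hP' // hP1' //.
  by rewrite (linZ lT) scalerBr.
have dU y : rho' (Um y) delta = delta.
  by apply/eqP; rewrite -subr_eq0; apply/eqP; apply: (Um_mod hF w0 vw hrho' hZ sZ eU et).
have dD a d : a != 0 -> d != 0 -> exists2 c' : k, c' != 0 & rho' (Dm a d) delta = c' *: delta.
  move=> a0 d0; have [c' c'0 /eqP] := eigmod_Dm hF w0 vw hrho' hZ sZ et eD a0 d0.
  by rewrite subr_eq0 => /eqP E; exists c'.
have ddet := line_det hF w0 vw hrho' dU dD.
(* psi a is the eigenvalue of diag(a, 1) on delta; by [line_det] it governs all of G through the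
   determinant. *)
have [|psi hpsi] := @choice F k (fun a c' => a != 0 ->
    c' != 0 /\ rho' (Dm a 1) delta = c' *: delta).
  move=> a; have [->|a0] := eqVneq a 0; first by exists 0.
  by have [c' c'0 E] := dD a 1 a0 o0; exists c'.
have psiS : smooth_char1 v psi.
  split=> [a a0|a b a0 b0|]; first by case: (hpsi a a0).
    apply: (scale_inj delta0); have ab0 := mulf_neq0 a0 b0.
    have [_ <-] := hpsi _ ab0; have [_ ea] := hpsi a a0; have [_ eb] := hpsi b b0.
    have -> : Dm (a * b) 1 = Dm a 1 *m Dm b 1 by rewrite DmM mulr1.
    rewrite (rM hr' _ (inGD a0 o0) (inGD b0 o0)) eb (linZ (rlin hr' (inGD a0 o0))) ea.
    by rewrite scalerA mulrC.
  case: hrho' => _ _ _ /(_ delta) [n [n0 hn]]; exists n; split=> // a /inpnP ha.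
  have n1 : 1 <= n%:Z by rewrite lez_nat.
  have a0 := vunit_neq0 (one_vunit hF (inp_le n1 ha)).
  apply: (scale_inj delta0); have [_ <-] := hpsi a a0; rewrite scale1r hn //.
    by apply/congr_sub_mk; rewrite ha subrr !inp0.
  exact: inGD.
case: nsp; apply: (@cocycle_special p F k v pk hF R hR w w0 vw V rho V' rho' hrho hrho' hirr T lT TP delta psi delta0 psiS).
- by move=> g hg; rewrite ddet //; case: (hpsi _ hg).
- move=> y g hg.
  have base h : inG h -> exists c', T (rho h x) - rho' h (T x) = c' *: delta.
    move=> hh; have [b [i [hb hi eh]]] := iwasawa hF w0 vw hh.
    have Gb := inP_inG hb; have Gi : inG i by apply: (GamG hF) hi.
    case: eh => ->.
      exists 0; rewrite scale0r.
      by rewrite (rM hr _ Gb Gi) (rM hr' _ Gb Gi) hx // hTx // TP // subrr.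
    rewrite (rM hr _ (inGM Gb GP) Gi) (rM hr' _ (inGM Gb GP) Gi) hx // hTx //.
    rewrite (rM hr _ Gb GP) (rM hr' _ Gb GP) TP // -(linB (rlin hr' Gb)).
    rewrite -/delta ddet //; have [_ E] := hpsi _ Gb; by exists (psi (\det b)).
  rewrite /cocycle; elim: (irreducible_span hrho hirr x0 y) => [|a h z hh _ [c2 IH]].
    exists 0; rewrite scale0r (lin0 (rlin hr hg)) (lin0 lT) (lin0 (rlin hr' hg)).
    by rewrite subrr.
  have [c1 E1] := base _ (inGM hg hh); have [c3 E3] := base h hh.
  (* The defect at g on h x is the defect of x at g h minus g applied to the defect of x at h. *)
  have [_ Eg] := hpsi _ hg; exists (a * (c1 - c3 * psi (\det g)) + c2).
  have -> : (a * (c1 - c3 * psi (\det g)) + c2) *: delta =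
      a *: (c1 *: delta - rho' g (c3 *: delta)) + c2 *: delta.
    by rewrite (linZ (rlin hr' hg)) (ddet g hg) Eg scalerDl -scalerA scalerBl -scalerA.
  rewrite -IH -E1 -E3 (rlin hr hg) !lT (rlin hr' hg).
  rewrite (linB (rlin hr' hg)) (rM hr _ hg hh) (rM hr' _ hg hh).
  move: (T (rho g (rho h x))) (rho' g (rho' h (T x))) (rho' g (T (rho h x))) => A B C.
  have -> : A - B - (C - B) = A - C by rewrite opprB addrA subrK.
  by rewrite scalerBr opprD addrACA.
- by exists x, Pm; split=> //; rewrite /cocycle; apply/eqP.
Qed.

(** The vectors T z and T (Pm z) determine each other through level-improving operators: N z = 0
    gives T (Pm z) = - D (T z). Backwards, T z is a^-1 N T (Pm z) if a is nonzero; if a = 0, the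
    relation N Pm z = 0 gives chi(w, w) T z = - D T (Pm z). *)
Lemma equivariant_of_supersingular chi a z : z != 0 -> eigv v rho chi z ->
  Nop R w rho z = 0 -> Nop R w rho (rho Pm z) = a *: z ->
  forall g y, inG g -> T (rho g y) = rho' g (T y).
Proof.
move=> z0 ez Nz NPz; have [hz hz'] := ez; have [hP hP'] := eigv_P hF w0 vw hr ez.
have [_ _ chi0] := eigv_tchar hF hr ez z0.
have eY : T (rho Pm z) = - Dop R w rho' (T z).
  by rewrite (P_of_N0 hF hR w0 vw hr hz Nz) (linN lT) T_Dop.
have zU := T_fixU (fixed_fixU hz); have zD := T_fixD (fixed_fixD hz).
have yU := T_fixU (fixed_fixU hP); have yD := T_fixD (fixed_fixD hP).
have hG1 n : 1 <= n -> forall g, Gam v 1 n g -> inG g by move=> n1 g; apply: (GamG hF).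
have hTz : fixed rho' (Gam v 0 1) (T z).
  have [a0|a0] := eqVneq a 0.
    have cw : chi w w != 0 by apply: chi0.
    apply: (descent_fixed hF hR w0 vw hr' hrho' zU zD yU yD eY
      (G := fun y => - ((chi w w)^-1 *: Dop R w rho' y))).
      move=> n n1 hy; have hS := fixed_subspace hr' (hG1 n n1).
      by apply: (subN hS); apply: (subZ hS); apply: (Dop_fixed hF hR w0 vw hr').
    have := P_of_N0 hF hR w0 vw hr hP; rewrite NPz a0 scale0r => /(_ erefl).
    rewrite (rPP w0 hr) hz' // => /(congr1 T); rewrite (linZ lT) (linN lT) T_Dop => E.
    by rewrite -scalerN -E scalerA mulVf // scale1r.
  apply: (descent_fixed hF hR w0 vw hr' hrho' zU zD yU yD eY
    (G := fun y => a^-1 *: Nop R w rho' y)).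
    move=> n n1 hy; have hS := fixed_subspace hr' (hG1 n n1); apply: (subZ hS).
    apply: (fixed_le (b := 0) (n := n)) => //.
    exact: (Nop_fixed hF hR w0 vw hr' n1 (lexx _) hy).
  by rewrite -T_Nop NPz (linZ lT) scalerA mulVf // scale1r.
apply: (equivariant_of_generator z0 hz hTz).
by rewrite eY (P_of_N0 hF hR w0 vw hr' hTz) // -T_Nop Nz (lin0 lT).
Qed.

Theorem equivariant_of_not_special : ~ special_series v rho ->
  forall g y, inG g -> T (rho g y) = rho' g (T y).
Proof.
move=> nsp; have hS : subspace (fun _ : V => True) by [].
have [|chi [c [x _ [x0 ex Nx]]]] := hecke_eigenvector_ex pp pk hF hR w0 vw hrho hirr hcc hS (fun _ _ _ _ => I).
  by case: hirr => [[x x0] _]; exists x.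
have [c0|c0] := eqVneq c 0; last exact: (equivariant_of_eigenvector nsp x0 ex Nx c0).
rewrite c0 scale0r in Nx.
have eP := eigv_P hF w0 vw hr ex; have eNP := eigv_N hF hR w0 vw hr eP.
(* With N x = 0 and N Pm x = 0, x itself satisfies the two relations with a = 0. Otherwise the
   eigenvector is sought among the polynomials in N applied to N Pm x. *)
have [NP0|NP0] := eqVneq (Nop R w rho (rho Pm x)) 0.
  by apply: (equivariant_of_supersingular (a := 0) x0 ex Nx); rewrite scale0r.
have irr := irreducible_span hrho hirr.
have [P P0 hP] := hecke_torsion pp pk hF hR w0 vw hr irr eNP NP0.
have lN := lin_Nop R w0 hr.
have [Q [c' [z0 hz]]] := pact_eigen lN P0 hP NP0.
have subE := eigv_subspace hF hr (swap chi).
have Nst z : eigv v rho (swap chi) z -> eigv v rho (swap chi) (Nop R w rho z).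
  exact: (eigv_N hF hR w0 vw hr).
have ez := pact_sub subE Nst Q eNP.
have [c'0|c'0] := eqVneq c' 0; last exact: (equivariant_of_eigenvector nsp z0 ez hz c'0).
rewrite c'0 scale0r in hz.
(* The eigenvector is N of an eigenvector for the swapped character, so [NPN] computes N Pm on
   it. *)
have E : pact (Nop R w rho) Q (Nop R w rho (rho Pm x)) =
    Nop R w rho (pact (Nop R w rho) Q (rho Pm x)).
  apply/esym; apply: pact_commute => // i.
  by rewrite -iterS iterSr.
apply: (equivariant_of_supersingular (a := hecke_const R w (swap chi)) z0 ez hz).
by rewrite E; apply: (NPN hF hR w0 vw hr pp pk); apply: (pact_sub subE Nst Q eP).
Qed.
End Equivariance.

Theorem mainTheorem1 (p : nat) (k : closedFieldType) (F : fieldType)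
  (v : F -> int)
  (hp : prime p) (hk : is_Fpbar p k) (hF : nonarch_local_field p v)
  (V : lmodType k) (rho : 'M[F]_2 -> V -> V)
  (V' : lmodType k) (rho' : 'M[F]_2 -> V' -> V')
  (hrho : is_rep v (@inG F) rho) (hrho' : is_rep v (@inG F) rho')
  (hirr : irreducible (@inG F) rho) (hcc : central_char rho) :
  (* (i) *)
  (principal_series v rho -> length2 (@inP F) rho) /\
  (~ principal_series v rho -> irreducible (@inP F) rho) /\
  (* (ii), first part: Hom_G(Ind_P^G 1, pi') -> Hom_P(Sp, pi') is bijective *)
  ((forall phi : ('M[F]_2 -> k) -> V',
      linear_on ((@inSpP F v k)) phi ->
      (forall b f, inP b -> (@inSpP F v k) f -> phi (rt b f) = rho' b (phi f)) ->
      exists Phi : ('M[F]_2 -> k) -> V',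
        [/\ linear_on (inInd v (chi1 F k)) Phi,
            forall g f, inG g -> inInd v (chi1 F k) f -> Phi (rt g f) = rho' g (Phi f) &
            forall f, (@inSpP F v k) f -> Phi f = phi f]) /\
   (forall Phi1 Phi2 : ('M[F]_2 -> k) -> V',
      linear_on (inInd v (chi1 F k)) Phi1 ->
      linear_on (inInd v (chi1 F k)) Phi2 ->
      (forall g f, inG g -> inInd v (chi1 F k) f -> Phi1 (rt g f) = rho' g (Phi1 f)) ->
      (forall g f, inG g -> inInd v (chi1 F k) f -> Phi2 (rt g f) = rho' g (Phi2 f)) ->
      (forall f, (@inSpP F v k) f -> Phi1 f = Phi2 f) ->
      forall f, inInd v (chi1 F k) f -> Phi1 f = Phi2 f)) /\
  (* (ii), second part: Hom_P(pi, pi') = Hom_G(pi, pi') *)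
  (~ special_series v rho ->
   forall T : V -> V',
     (forall (a : k) x y, T (a *: x + y) = a *: T x + T y) ->
     (forall b x, inP b -> T (rho b x) = rho' b (T x)) ->
     forall g x, inG g -> T (rho g x) = rho' g (T x)).
Proof.
have pk := proj1 hk; have [w w0 vw] := uniformizer_ex hF; have [R hR] := residues_ex hF.
split; first exact: (principal_length2 pk hF hR w0 vw).
split; first exact: (not_principal_irreducible hp pk hF hR w0 vw hrho hirr hcc).
split.
  split=> [phi lphi phiP|Phi1 Phi2 l1 l2 h1 h2 e f hf]; last first.
    exact: (extension_unique hF w0 vw l1 l2 h1 h2 e hf).
  exists (extension v w rho' phi); split.
  - by move=> a f g hf hg; apply: (extension_lin hF).
  - by move=> g f hg hf; apply: (extension_equiv pk hF hR w0 vw hrho').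
  - by move=> f hf; apply: extension_kap.
move=> nsp T lT TP g x hg.
exact: (equivariant_of_not_special hp pk hF hR w0 vw hrho hrho' hirr hcc lT TP nsp).
Qed.
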